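(* If $\omega$ is a regular frequency, then, as $\varepsilon\to0$ along the sequence $(\varepsilon_j)$ occurring in the definition of a regular frequency (up to a subsequence extraction), $$\forall(\varphi,n)\in L^2_{per}(\mathbb R)\times\mathbb N,\quad \lim_{\varepsilon\to0}\|U^r_\varepsilon(\varphi)-U^r(\varphi)\|_{H^1_\theta((0,1)\times(n,n+1))}=0\qquad\text{and}\qquad\lim_{\varepsilon\to0}\|\boldsymbol\Lambda^r_\varepsilon-\boldsymbol\Lambda^r\|_{\mathscr L(L^2_{per}(\mathbb R))}=0.$$ Moreover, for any $\varphi\in L^2_{per}(\mathbb R)\setminus\{0\}$, $$\mathrm{Re}\int_0^1 (I-\boldsymbol\Lambda^r)\varphi\ \overline{(I+\boldsymbol\Lambda^r)\varphi}\,ds=Q^r_0\int_0^1|\varphi(s)|^2\,|\varphi^r_0(s)|^{-2}\,ds>0.$$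
   Context: Periodic coefficients. $\mu_p,\rho_p:\mathbb R^2\to\mathbb R$ are continuous, $1$-periodic in each variable and bounded below by positive constants; $(\theta_1,\theta_2)\in\mathbb R^2$ with $\theta_2>0$ and $\delta:=\theta_1/\theta_2$ irrational; $z>0$; $\omega\in\mathbb R$. For $s\in\mathbb R$ put $\mu_s(x):=\mu_p(s+\theta_1x,\theta_2x)$, $\rho_s(x):=\rho_p(s+\theta_1x,\theta_2x)$. Equations $-(\mu u')'-\rho\kappa u=0$ are understood weakly for $u\in H^1$, so that $u$ and $\mu u'$ have point values. Standing assumptions. The irrationality measure $m(\delta):=\sup\{\nu>0:\ |\delta-p/q|\le q^{-\nu}\text{ for infinitely many }(p,q)\in\mathbb Z\times\mathbb N^*\}$ is finite and $\mu_p,\rho_p\in C^m(\mathbb R^2)$ for some integer $m>m(\delta)$. Also $\omega^2\in\sigma(\mathcal A_\theta)$, where $\mathcal A_\theta u=-\frac1{\rho_0}(\mu_0u')'$ with domain $\{u\in H^1(\mathbb R):\mu_0u'\in H^1(\mathbb R)\}$ is self-adjoint in $L^2(\mathbb R;\rho_0\,dx)$ ($\mu_0,\rho_0$ are $\mu_s,\rho_s$ at $s=0$). Robin operators. $R^r_{\pm,s}u:=\mp\mu_su'-izu$, $R^l_{\pm,s}u:=\pm\mu_su'-izu$. Function spaces and winding number. $L^2_{per}(\mathbb R)$: $1$-periodic functions in $L^2_{loc}(\mathbb R)$, with the $L^2(0,1)$ inner product. For an open set $\mathcal O\subset\mathbb R^2$, $H^1_\theta(\mathcal O)=\{U\in L^2(\mathcal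 O):D_\theta U\in L^2(\mathcal O)\}$ with $D_\theta=\theta_1\partial_{y_1}+\theta_2\partial_{y_2}$ and norm $(\|U\|^2+\|D_\theta U\|^2)^{1/2}$. $\mathcal N_{per}$: continuous $1$-periodic functions $f:\mathbb R\to\mathbb C$ that never vanish; writing $f=|f|e^{i\,\mathrm{Arg} f}$ with $\mathrm{Arg} f$ continuous on $\mathbb R$, $\mathbf w(f):=(\mathrm{Arg} f(1)-\mathrm{Arg} f(0))/2\pi$. Fundamental eigenpairs for $\varepsilon>0$. $u^r_{s,\varepsilon}\in H^1(0,\infty)$ and $u^l_{s,\varepsilon}\in H^1(-\infty,0)$ are the unique solutions of $-(\mu_su')'-\rho_s(\omega^2+i\varepsilon)u=0$ with $R^r_{+,s}u^r_{s,\varepsilon}(0)=1$, $R^l_{+,s}u^l_{s,\varepsilon}(0)=1$. Put $p^r_\varepsilon(s)=R^r_{+,s}u^r_{s,\varepsilon}(1/\theta_2)$, $\boldsymbol s^r_\varepsilon(s)=R^r_{-,s}u^r_{s,\varepsilon}(1/\theta_2)$, $p^l_\varepsilon(s)=R^l_{+,s}u^l_{s,\varepsilon}(-1/\theta_2)$, $\boldsymbol s^l_\varepsilon(s)=R^l_{-,s}u^l_{s,\varepsilon}(-1/\theta_2)$, and define on $L^2_{per}(\mathbb R)$: $\mathcal P^r_\varepsilon\varphi(s)=p^r_\varepsilon(s-\delta)\varphi(s-\delta)$, $\mathcal S^r_\varepsilon\varphi(s)=\boldsymbol s^r_\varepsilon(s-\delta)\varphi(s-\delta)$, $\mathcal P^l_\varepsilon\varphi(s)=p^l_\varepsilon(s+\delta)\varphi(s+\delta)$,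 $\mathcal S^l_\varepsilon\varphi(s)=\boldsymbol s^l_\varepsilon(s+\delta)\varphi(s+\delta)$. For $i\in\{l,r\}$ there is a unique pair $(\lambda^i_{0,\varepsilon},\varphi^i_{0,\varepsilon})\in\mathbb C\times\mathcal N_{per}$ with $|\lambda^i_{0,\varepsilon}|<1$, $\mathbf w(\varphi^i_{0,\varepsilon})=0$, $\varphi^i_{0,\varepsilon}(0)=1$ and $\mathcal P^i_\varepsilon\varphi^i_{0,\varepsilon}=\lambda^i_{0,\varepsilon}\varphi^i_{0,\varepsilon}$; put $\psi^i_{0,\varepsilon}:=\mathcal S^i_\varepsilon\varphi^i_{0,\varepsilon}$. Cell functions without absorption. $e^{r,0}_s,e^{r,1}_s\in H^1(0,1/\theta_2)$ solve $-(\mu_su')'-\rho_s\omega^2u=0$ on $(0,1/\theta_2)$ with $R^r_{+,s}e^{r,0}_s(0)=1,\ R^r_{-,s}e^{r,0}_s(1/\theta_2)=0$ and $R^r_{+,s}e^{r,1}_s(0)=0,\ R^r_{-,s}e^{r,1}_s(1/\theta_2)=1$; $t^{r,00}(s)=R^r_{-,s}e^{r,0}_s(0)$, $t^{r,10}(s)=R^r_{-,s}e^{r,1}_s(0)$. Likewise $e^{l,0}_s,e^{l,1}_s\in H^1(-1/\theta_2,0)$ solve the same equation on $(-1/\theta_2,0)$ with $R^l_{+,s}e^{l,0}_s(0)=1,\ R^l_{-,s}e^{l,0}_s(-1/\theta_2)=0$ and $R^l_{+,s}e^{l,1}_s(0)=0,\ R^l_{-,s}e^{l,1}_s(-1/\theta_2)=1$;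 $t^{l,00}(s)=R^l_{-,s}e^{l,0}_s(0)$, $t^{l,10}(s)=R^l_{-,s}e^{l,1}_s(0)$. Flux density. With $\delta^r:=\delta$, $\delta^l:=-\delta$, $$Q^i_s(\varphi,\psi):=\mathrm{Re}\Big\{\big[(1-t^{i,00}(s))\varphi(s)-t^{i,10}(s)\psi(s+\delta^i)\big]\,\overline{\big[(1+t^{i,00}(s))\varphi(s)+t^{i,10}(s)\psi(s+\delta^i)\big]}\Big\}.$$ Regular frequency. $\omega$ is regular if: (a) there is a sequence $\varepsilon_j\to0^+$ such that for each $i\in\{l,r\}$, along it, $\lambda^i_{0,\varepsilon}\to\lambda^i_0$ in $\mathbb C$ and $\varphi^i_{0,\varepsilon}\to\varphi^i_0$, $\psi^i_{0,\varepsilon}\to\psi^i_0$ uniformly on $\mathbb R$, for some $\lambda_0^i\in\mathbb C$ and continuous $1$-periodic $\varphi_0^i,\psi_0^i$; (b) for each $i$, $Q^i_0\ne0$, where $Q^i_0\ge 0$ is the value of $Q^i_s(\varphi^i_0,\psi^i_0)$, which is independent of $s$. (When $\omega$ is regular, $\varphi^i_0$ never vanishes.) Limit operators. $\mathcal P^r\varphi(s)=\boldsymbol p^r(s-\delta)\varphi(s-\delta)$ with $\boldsymbol p^r(s)=\lambda^r_0\,\varphi^r_0(s+\delta)/\varphi^r_0(s)$; $\mathcal S^r\varphi(s)=\boldsymbol s^r(s-\delta)\varphi(s-\delta)$ with $\boldsymbol s^r(s)=\psi^r_0(s+\delta)/\varphi^r_0(s)$. Half-space functions. For $\varepsilon>0$,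 $U^r_\varepsilon(\varphi)$ on $\mathbb R\times(0,\infty)$ is given by $U^r_\varepsilon(\varphi)(s+\theta_1x,\theta_2x)=\varphi(s)u^r_{s,\varepsilon}(x)$, $s\in\mathbb R,\ x>0$. The cell functions $E^{r,0}(\varphi),E^{r,1}(\varphi)$ on $\mathbb R\times(0,1)$ are $E^{r,0}(\varphi)(s+\theta_1x,\theta_2x)=\varphi(s)e^{r,0}_s(x)$, $E^{r,1}(\varphi)(s+\theta_1x,\theta_2x)=\varphi(s+\delta)e^{r,1}_s(x)$, $x\in(0,1/\theta_2)$. The limit $U^r(\varphi)$ is defined by $U^r(\varphi)(y_1,y_2+n)=\big[E^{r,0}((\mathcal P^r)^n\varphi)+E^{r,1}(\mathcal S^r(\mathcal P^r)^n\varphi)\big](y_1,y_2)$, $y_2\in(0,1)$, $n\in\mathbb N$. RtR operators. $\boldsymbol\Lambda^r_\varepsilon\varphi(s)=\big(R^r_{-,s}u^r_{s,\varepsilon}(0)\big)\varphi(s)$, and $\boldsymbol\Lambda^r\varphi(s)=t^{r,00}(s)\varphi(s)+t^{r,10}(s)(\mathcal S^r\varphi)(s+\delta)$. *)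

(* Defs.v *)
From HB Require Import structures.
From mathcomp Require Import all_boot all_order all_algebra.
From mathcomp Require Import all_classical all_reals all_analysis.
From mathcomp Require Export complex.

Set Implicit Arguments.
Unset Strict Implicit.
Unset Printing Implicit Defensive.

Import Order.TTheory GRing.Theory Num.Theory.
Import numFieldNormedType.Exports.

Local Open Scope classical_set_scope.
Local Open Scope ring_scope.
Local Open Scope complex_scope.

Notation modc := Normc.normc.

Section complex_valued_functions.
Context {R : realType}.
Local Notation leb := (@lebesgue_measure R).
Local Notation leb2 := (@lebesgue_measure R \x @lebesgue_measure R)%E.

Definition ccontinuous_on (D : set R) (f : R -> R[i]) : Prop :=
  {within D, continuous (fun x => complex.Re (f x))} /\
  {within D, continuous (fun x => complex.Im (f x))}.

Section L2.
Context d (T : measurableType d) (mu : {measure set T -> \bar R}).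

Definition cintegral (D : set T) (f : T -> R[i]) : R[i] :=
  (\int[mu]_(x in D) complex.Re (f x)) +i*
  (\int[mu]_(x in D) complex.Im (f x)).

Definition L2norm (D : set T) (f : T -> R[i]) : \bar R :=
  Lnorm mu 2%:E ((fun x => (modc (f x))%:E) \_ D).

(* Elements of L^2 are represented by (Borel) measurable functions. *)
Definition L2 (D : set T) (f : T -> R[i]) : Prop :=
  [/\ measurable_fun D (fun x => complex.Re (f x)),
      measurable_fun D (fun x => complex.Im (f x)) &
      (L2norm D f < +oo)%E].

End L2.

(* C^k regularity, through continuity of all partial derivatives of order at
   most k. *)
Fixpoint Ck (k : nat) (f : R * R -> R) : Prop :=
  continuous f /\
  match k with
  | 0%N => True
  | k'.+1 =>
      [/\ forall y, derivable f y ((1, 0) : R * R),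
          forall y, derivable f y ((0, 1) : R * R),
          Ck k' (fun y => 'D_((1, 0) : R * R) f y) &
          Ck k' (fun y => 'D_((0, 1) : R * R) f y)]
  end.

Definition test1 (I : set R) (g : R -> R) : Prop :=
  [/\ forall x, derivable g x 1, continuous (derive1 g) &
      exists K : set R, [/\ compact K, K `<=` I & forall x, ~ K x -> g x = 0]].

Definition test2 (O : set (R * R)) (g : R * R -> R) : Prop :=
  Ck 1 g /\
  exists K : set (R * R),
    [/\ compact K, K `<=` O & forall y, ~ K y -> g y = 0].

(* Weak derivatives are tested against C^1 functions with compact support in
   the open set; real test functions suffice, both sides being C-linear. *)
Definition weak_derivative (I : set R) (u v : R -> R[i]) : Prop :=
  forall g, test1 I g ->
    cintegral leb I (fun x => u x * (derive1 g x)%:C) =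
    - cintegral leb I (fun x => v x * (g x)%:C).

(* u belongs to H^1(I) and u' = v. *)
Definition H1_with_derivative (I : set R) (u v : R -> R[i]) : Prop :=
  [/\ L2 leb I u, L2 leb I v & weak_derivative I u v].

(* U belongs to H^1_theta(O) and D_theta U = V. *)
Definition H1theta_with_derivative (th1 th2 : R) (O : set (R * R))
    (U V : R * R -> R[i]) : Prop :=
  [/\ L2 leb2 O U, L2 leb2 O V &
      forall g, test2 O g ->
        cintegral leb2 O (fun y => U y *
          (th1 * 'D_((1, 0) : R * R) g y + th2 * 'D_((0, 1) : R * R) g y)%:C) =
        - cintegral leb2 O (fun y => V y * (g y)%:C)].

(* D_theta U is unique up to null sets, so the infimum below is over at most one
   value; it is +oo exactly when U is not in H^1_theta(O). *)
Definition H1theta_norm (th1 th2 : R) (O : set (R * R)) (U : R * R -> R[i]) :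
    \bar R :=
  ereal_inf [set N | exists2 V, H1theta_with_derivative th1 th2 O U V &
    N = poweR (L2norm leb2 O U ^+ 2 + L2norm leb2 O V ^+ 2)%E 2^-1].

Definition periodic1 (f : R -> R[i]) : Prop := forall s, f (s + 1) = f s.

Definition L2per (f : R -> R[i]) : Prop :=
  periodic1 f /\ forall a b : R, L2 leb `]a, b[ f.

Definition L2per_norm (f : R -> R[i]) : \bar R := L2norm leb `]0, 1[ f.

(* Operator norm on L^2_per; +oo when T is not bounded from L^2_per to itself. *)
Definition L2per_opnorm (T : (R -> R[i]) -> (R -> R[i])) : \bar R :=
  ereal_inf [set c%:E | c in [set c : R | 0 <= c /\
    forall f, L2per f ->
      L2per (T f) /\ (L2per_norm (T f) <= c%:E * L2per_norm f)%E]].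

Definition Nper (f : R -> R[i]) : Prop :=
  [/\ ccontinuous_on setT f, periodic1 f & forall s, f s != 0].

Definition has_winding_number (f : R -> R[i]) (w : R) : Prop :=
  exists a : R -> R, [/\ continuous a,
    forall s, f s = (modc (f s))%:C * (cos (a s) +i* sin (a s)) &
    w = (a 1 - a 0) / (2 * pi)].

Definition irrationality_measure (delta : R) : \bar R :=
  ereal_sup [set nu%:E | nu in [set nu : R | 0 < nu /\
    infinite_set [set pq : int * nat | (0 < pq.2)%N /\
      `|delta - pq.1%:~R / pq.2%:R| <= pq.2%:R `^ (- nu)]]].

End complex_valued_functions.

(* A solution u of -(mu u')' - rho kappa u = 0, given by the point values of u
   and of mu u', i.e. by their continuous representatives. *)
Record solution (R : realType) := Solution {
  pval : R -> R[i];
  pflux : R -> R[i] }.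

Inductive side := lft | rgt.

Section quasiperiodic.
Context {R : realType}.
Variables (mu rho : R * R -> R) (th1 th2 z om : R).
Local Notation leb := (@lebesgue_measure R).

Definition delta : R := th1 / th2.

Definition slice (f : R * R -> R) (s x : R) : R := f (s + th1 * x, th2 * x).

Definition is_solution (m r : R -> R) (kappa : R[i]) (I : set R)
    (F : solution R) : Prop :=
  [/\ ccontinuous_on (closure I) (pval F),
      ccontinuous_on (closure I) (pflux F) &
      exists v, [/\ H1_with_derivative I (pval F) v,
        {ae leb, forall x, I x -> pflux F x = (m x)%:C * v x} &
        weak_derivative I (fun x => (m x)%:C * v x)
          (fun x => - ((r x)%:C * kappa * pval F x))]].

(* A_theta u = f, for the operator A_theta of L^2(R; rho_0 dx). *)
Definition Atheta_maps (u f : R -> R[i]) : Prop :=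
  exists v g, [/\ H1_with_derivative setT u v,
    H1_with_derivative setT (fun x => (slice mu 0 x)%:C * v x) g &
    {ae leb, forall x, f x = - ((slice rho 0 x)^-1%:C * g x)}].

Definition weighted (f : R -> R[i]) (x : R) : R[i] :=
  (Num.sqrt (slice rho 0 x))%:C * f x.

(* A_theta - lam is a bijection from its domain onto L^2(R; rho_0 dx), with
   bounded inverse. *)
Definition Atheta_resolvent_set (lam : R[i]) : Prop :=
  (forall f, L2 leb setT (weighted f) ->
     exists u, Atheta_maps u (fun x => lam * u x + f x)) /\
  exists c : R, forall u f, L2 leb setT (weighted f) ->
    Atheta_maps u (fun x => lam * u x + f x) ->
    (L2norm leb setT (weighted u) <= c%:E * L2norm leb setT (weighted f))%E.

Definition Atheta_spectrum (lam : R[i]) : Prop := ~ Atheta_resolvent_set lam.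

(* The left objects are obtained from the right ones by reversing the sign of
   the flux, of delta and of the abscissa of the end of the cell. *)
Definition sgn (i : side) : R := if i is rgt then 1 else -1.

Definition sdelta (i : side) : R := sgn i * delta.

Definition half_line (i : side) : set R :=
  if i is rgt then `]0, +oo[ else `]-oo, 0[.

Definition cell (i : side) : set R :=
  if i is rgt then `]0, th2^-1[ else `](- th2^-1), 0[.

Definition cell_end (i : side) : R := sgn i * th2^-1.

Definition Robin_plus (i : side) (F : solution R) (x : R) : R[i] :=
  - (sgn i)%:C * pflux F x - (0 +i* z) * pval F x.

Definition Robin_minus (i : side) (F : solution R) (x : R) : R[i] :=
  (sgn i)%:C * pflux F x - (0 +i* z) * pval F x.

Definition is_half_line_solution (i : side) (eps s : R) (F : solution R) :=
  is_solution (slice mu s) (slice rho s) ((om ^+ 2) +i* eps) (half_line i) F /\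
  Robin_plus i F 0 = 1.

Definition is_cell_solution (i : side) (s : R) (F : solution R)
    (a b : R[i]) : Prop :=
  [/\ is_solution (slice mu s) (slice rho s) (om ^+ 2)%:C (cell i) F,
      Robin_plus i F 0 = a & Robin_minus i F (cell_end i) = b].

Definition wshift (i : side) (a f : R -> R[i]) (s : R) : R[i] :=
  a (s - sdelta i) * f (s - sdelta i).

Definition Peps (i : side) (u : R -> solution R) : (R -> R[i]) -> R -> R[i] :=
  wshift i (fun s => Robin_plus i (u s) (cell_end i)).

Definition Seps (i : side) (u : R -> solution R) : (R -> R[i]) -> R -> R[i] :=
  wshift i (fun s => Robin_minus i (u s) (cell_end i)).

Definition is_fundamental_eigenpair (i : side) (u : R -> solution R)
    (lam : R[i]) (f : R -> R[i]) : Prop :=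
  [/\ modc lam < 1, Nper f, has_winding_number f 0, f 0 = 1 &
      forall s, Peps i u f s = lam * f s].

(* t^{i,00} and t^{i,10} are the cases e = e^{i,0} and e = e^{i,1}. *)
Definition tcoef (i : side) (e : R -> solution R) (s : R) : R[i] :=
  Robin_minus i (e s) 0.

Definition flux_density (i : side) (e0 e1 : R -> solution R)
    (f g : R -> R[i]) (s : R) : R :=
  complex.Re (((1 - tcoef i e0 s) * f s - tcoef i e1 s * g (s + sdelta i)) *
    conjc ((1 + tcoef i e0 s) * f s + tcoef i e1 s * g (s + sdelta i))).

Definition converges_uniformly (F : nat -> R -> R[i]) (f : R -> R[i]) : Prop :=
  forall e : R, 0 < e -> \forall j \near \oo, forall s, modc (F j s - f s) < e.

(* om is regular, as witnessed by the sequence eps and by the limits lam0, phi0,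
   psi0. The flux density of (phi0 i, psi0 i) does not depend on s; its value
   Q^i_0 is taken at s = 0. *)
Definition regular_along (u : side -> R -> R -> solution R)
    (lamE : side -> R -> R[i]) (phiE : side -> R -> R -> R[i])
    (e0 e1 : side -> R -> solution R) (eps : nat -> R)
    (lam0 : side -> R[i]) (phi0 psi0 : side -> R -> R[i]) : Prop :=
  [/\ forall j, 0 < eps j,
      eps j @[j --> \oo] --> 0,
      forall i,
        [/\ modc (lamE i (eps j) - lam0 i) @[j --> \oo] --> 0,
            ccontinuous_on setT (phi0 i) /\ periodic1 (phi0 i),
            ccontinuous_on setT (psi0 i) /\ periodic1 (psi0 i),
            converges_uniformly (fun j => phiE i (eps j)) (phi0 i) &
            converges_uniformly
              (fun j => Seps i (u i (eps j)) (phiE i (eps j))) (psi0 i)] &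
      forall i, flux_density i (e0 i) (e1 i) (phi0 i) (psi0 i) 0 != 0].

Definition Plim (i : side) (lam0 : R[i]) (phi0 : R -> R[i]) :
    (R -> R[i]) -> R -> R[i] :=
  wshift i (fun s => lam0 * phi0 (s + sdelta i) / phi0 s).

Definition Slim (i : side) (phi0 psi0 : R -> R[i]) :
    (R -> R[i]) -> R -> R[i] :=
  wshift i (fun s => psi0 (s + sdelta i) / phi0 s).

(* The function U such that U (s + th1 * x, th2 * x) = f s x. *)
Definition along_lines (f : R -> R -> R[i]) (y : R * R) : R[i] :=
  f (y.1 - delta * y.2) (y.2 / th2).

Lemma along_linesE (f : R -> R -> R[i]) (s x : R) : th2 != 0 ->
  along_lines f (s + th1 * x, th2 * x) = f s x.
Proof.
move=> th20; rewrite /along_lines /delta /=.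
by rewrite mulrA divfK// addrK mulrAC divff// mul1r.
Qed.

Definition Ueps (u : R -> solution R) (f : R -> R[i]) : R * R -> R[i] :=
  along_lines (fun s x => f s * pval (u s) x).

Definition E0 (e0 : R -> solution R) (f : R -> R[i]) : R * R -> R[i] :=
  along_lines (fun s x => f s * pval (e0 s) x).

Definition E1 (e1 : R -> solution R) (f : R -> R[i]) : R * R -> R[i] :=
  along_lines (fun s x => f (s + delta) * pval (e1 s) x).

(* For n < y.2 < n + 1 the truncation of y.2 is n. *)
Definition Ulim (e0 e1 : R -> solution R) (P S : (R -> R[i]) -> R -> R[i])
    (f : R -> R[i]) (y : R * R) : R[i] :=
  let n := Num.truncn y.2 in
  E0 e0 (iter n P f) (y.1, y.2 - n%:R) +
  E1 e1 (S (iter n P f)) (y.1, y.2 - n%:R).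

Definition Lambda_eps (u : R -> solution R) (f : R -> R[i]) (s : R) : R[i] :=
  Robin_minus rgt (u s) 0 * f s.

Definition Lambda_lim (e0 e1 : R -> solution R) (S : (R -> R[i]) -> R -> R[i])
    (f : R -> R[i]) (s : R) : R[i] :=
  tcoef rgt e0 s * f s + tcoef rgt e1 s * S f (s + delta).

End quasiperiodic.

(* Main.v *)
Require Import Defs.
From HB Require Import structures.
From mathcomp Require Import all_boot all_order all_algebra.
From mathcomp Require Import all_classical all_reals all_analysis.
From mathcomp Require Import ring lra.
From mathcomp Require Import measurable_realfun.

(** Let p = u and q = mu u' be the Cauchy data of a solution of
    - (mu u')' - rho k u = 0.  The flux J = Im (q conj p) satisfies
    J' = - rho (Im k) |p|^2, and the two Robin traces R+ = - q - i z p and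
    R- = q - i z p satisfy |R+|^2 - |R-|^2 = 4 z J ([robin_flux]).  When
    Im k >= 0 the flux decreases, so the traces |R-(0)|^2 + |R+(L)|^2 leaving
    the segment [0, L] are at most the traces |R+(0)|^2 + |R-(L)|^2 entering it
    ([robin_reflection]).  Together with a Gronwall estimate, this bounds a
    solution on a segment by its entering Robin traces and its residuals,
    uniformly as Im k tends to 0 ([robin_stability]); Dirichlet data would not
    do, since omega^2 may be a Dirichlet eigenvalue of the cell.

    For positive absorption, square integrability forces J >= 0 on the half
    line ([flux_ge0]): the solution with R+(0) = 1 is unique, is 1-periodic in
    s, and satisfies u_s(x + 1/th2) = p(s) u_(s + delta)(x), where p(s) is
    lam phi(s + delta) / phi(s) by the eigenvalue equation.  Hence, with
    v_s = phi(s) u_s, the solution on the cell number n is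
    lam^n phi(s)^-1 v_(s + n delta) ([half_line_cell]).  On the first cell v_s
    has the entering traces phi(s) and psi(s + delta).  These converge
    uniformly at a regular frequency, so by stability v_s converges uniformly,
    with its flux, to w_s = phi0(s) e0_s + psi0(s + delta) e1_s ([mode_cvg]).

    Passing to the limit in lam^n phi(s)^-1 requires a lower bound on |phi0|.
    The flux density is Q_s = 4 z J(w_s)(0).  It is nonnegative as a limit of
    nonnegative fluxes, and conservation of the flux across the cell gives
    Q_s = |lam0|^2 Q_(s + delta).  As Q is bounded and Q_0 > 0, |lam0| = 1
    ([lam0_norm]); a continuous function with the periods 1 and delta, delta
    irrational, is constant ([flux_density_const]); finally
    |phi0(s)|^2 >= Q_s = Q_0.

    So U_eps(phi) - U(phi) has the form phi(s) G(s, x) along the characteristic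
    lines, with G and its x-derivative uniformly small ([cell_error_cvg]).  In
    the coordinates (s, x) the derivative D_theta is the derivative in x, and
    the change of coordinates is a shear, which preserves the area; thus the
    norm is at most the supremum of G and its derivative times the L2 mass of
    phi on the strip ([H1theta_norm_le]).  The error on the RtR operator is the
    multiplication by the trace R- of G at the entry of the first cell.  The
    energy identity holds pointwise: for f(s) = c phi0(s) one has
    Lambda f(s) = c R-(w_s)(0), so the real part of
    (f - Lambda f) conj (f + Lambda f) is
    |c|^2 (|R+(w_s)(0)|^2 - |R-(w_s)(0)|^2) = |f / phi0|^2 Q_0. *)

Set Implicit Arguments.
Unset Strict Implicit.
Unset Printing Implicit Defensive.

Import Order.TTheory GRing.Theory Num.Theory.
Import numFieldNormedType.Exports.

Local Open Scope classical_set_scope.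
Local Open Scope ring_scope.
Local Open Scope complex_scope.

(** * Calculus on the real line *)

Section calc.
Context {R : realType}.
Implicit Types (f g : R -> R) (x a b : R).

Lemma is_deriveD1 f g x a b : is_derive x 1 f a -> is_derive x 1 g b ->
  is_derive x 1 (fun t => f t + g t) (a + b).
Proof. by move=> hf hg; apply: is_deriveD. Qed.

Lemma is_deriveB1 f g x a b : is_derive x 1 f a -> is_derive x 1 g b ->
  is_derive x 1 (fun t => f t - g t) (a - b).
Proof. by move=> hf hg; apply: is_deriveB. Qed.

Lemma is_deriveN1 f x a : is_derive x 1 f a ->
  is_derive x 1 (fun t => - f t) (- a).
Proof. by move=> hf; apply: is_deriveN. Qed.

Lemma is_deriveM1 f g x a b : is_derive x 1 f a -> is_derive x 1 g b ->
  is_derive x 1 (fun t => f t * g t) (a * g x + f x * b).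
Proof.
by move=> hf hg; apply: is_derive_eq; rewrite addrC /GRing.scale/= [g x * a]mulrC.
Qed.

Lemma is_deriveZ1 f x a c : is_derive x 1 f a ->
  is_derive x 1 (fun t => c * f t) (c * a).
Proof. by move=> hf; apply: is_deriveZ. Qed.

Lemma is_derive_affine f (l c : R) x a : is_derive (l * x + c) 1 f a ->
  is_derive x 1 (fun t => f (l * t + c)) (a * l).
Proof.
move=> hf; apply: (@is_derive1_comp _ f (fun t => l * t + c)).
by apply: is_derive_eq; rewrite ?addr0 /GRing.scale /= mulr1.
Qed.

Lemma is_derive_shift (f : R -> R) (c x a : R) : is_derive (x + c) 1 f a ->
  is_derive x 1 (fun t => f (t + c)) a.
Proof.
move=> hf; have := @is_derive_affine f 1 c x a; rewrite mul1r mulr1.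
by move=> /(_ hf); under eq_fun do rewrite mul1r.
Qed.

Lemma contD f g : continuous f -> continuous g -> continuous (fun t => f t + g t).
Proof. by move=> cf cg x; apply: continuousD; [exact: cf|exact: cg]. Qed.

Lemma contB f g : continuous f -> continuous g -> continuous (fun t => f t - g t).
Proof. by move=> cf cg x; apply: continuousB; [exact: cf|exact: cg]. Qed.

Lemma contM f g : continuous f -> continuous g -> continuous (fun t => f t * g t).
Proof. by move=> cf cg x; apply: continuousM; [exact: cf|exact: cg]. Qed.

Lemma cont_cst (c : R) : continuous (fun _ : R => c).
Proof. exact: cst_continuous. Qed.

Lemma continuous_shift (a : R) : continuous (fun t : R => t + a).
Proof. by apply: contD; [move=> ?; exact: cvg_id|exact: cont_cst]. Qed.

Lemma within_contD (D : set R) f g :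
  {within D, continuous f} -> {within D, continuous g} ->
  {within D, continuous (fun t => f t + g t)}.
Proof. by move=> hf hg x; apply: continuousD; [apply: hf|apply: hg]. Qed.

Lemma within_contM (D : set R) f g :
  {within D, continuous f} -> {within D, continuous g} ->
  {within D, continuous (fun t => f t * g t)}.
Proof. by move=> hf hg x; apply: continuousM; [apply: hf|apply: hg]. Qed.

Lemma within_contN (D : set R) f :
  {within D, continuous f} -> {within D, continuous (fun t => - f t)}.
Proof. by move=> hf x; apply: continuousN; apply: hf. Qed.

Lemma within_cst (D : set R) (c : R) : {within D, continuous (fun=> c)}.
Proof. by move=> x; apply: cst_continuous. Qed.

Lemma within_cont (D : set R) f : continuous f -> {within D, continuous f}.
Proof. exact: continuous_subspaceT. Qed.

Lemma within_comp (E D : set R) f (c : R -> R) : (forall x, E x -> D (c x)) ->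
  continuous c -> {within D, continuous f} ->
  {within E, continuous (fun t => f (c t))}.
Proof.
move=> ED cc /subspace_continuousP cf; apply/subspace_continuousP => x Ex.
move=> P /(cf _ (ED _ Ex)) H; have {}H := cc _ _ H.
suff : \forall t \near x, E t -> P (f (c t)) by [].
have {}H : \forall t \near x, D (c t) -> P (f (c t)) by exact: H.
by apply: filterS H => y H /ED.
Qed.

(** One-sided mean value theorem: the form in which differential inequalities
    are integrated below. *)
Lemma increment_le f df a b c : a <= b -> {within `[a, b], continuous f} ->
  (forall x, a < x < b -> is_derive x 1 f (df x)) ->
  (forall x, a < x < b -> df x <= c) -> f b - f a <= c * (b - a).
Proof.
rewrite le_eqVlt => /predU1P[->|ab] cf hf hc; first by rewrite !subrr mulr0.
have hf' x : x \in `]a, b[ -> is_derive x 1 f (df x).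
  by rewrite in_itv/=; exact: hf.
have [y] := MVT ab hf' cf.
by rewrite in_itv/= => yab ->; rewrite ler_wpM2r ?hc// subr_ge0 ltW.
Qed.

Lemma le_sqr_succ (B : R) : 0 <= B -> B <= (B + 1) ^+ 2.
Proof. by move=> B0; nra. Qed.

(** Used to choose a tolerance once the constant T of an estimate is known. *)
Lemma small_factor (T e : R) : 0 <= T -> 0 < e -> exists2 h : R, 0 < h <= 1 & h * T <= e.
Proof.
move=> T0 e0; have T1 : 0 < T + 1 by rewrite ltr_wpDl.
exists (Num.min 1 (e / (T + 1))).
  by rewrite lt_min ltr01 divr_gt0//= ge_min lexx.
apply: (@le_trans _ _ (e / (T + 1) * T)).
  by rewrite ler_wpM2r// ge_min lexx orbT.
rewrite mulrAC ler_pdivrMr// ler_wpM2l ?(ltW e0)//.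
by rewrite lerDl.
Qed.

End calc.

(** * Complex-valued functions of a real variable *)

Section complex_valued.
Context {R : realType}.
Implicit Types (x : R) (c : R[i]).

(** The squared modulus as a polynomial in the real and imaginary parts, so that
    [ring] and [nra] apply to it. *)
Definition nsq (w : R[i]) : R := complex.Re w ^+ 2 + complex.Im w ^+ 2.

Lemma nsq_ge0 w : 0 <= nsq w.
Proof. by rewrite addr_ge0// sqr_ge0. Qed.

Lemma nsqM (v w : R[i]) : nsq (v * w) = nsq v * nsq w.
Proof. by case: v w => [a b] [c d]; rewrite /nsq /=; ring. Qed.

Lemma nsqD (v w : R[i]) : nsq (v + w) <= 2 * (nsq v + nsq w).
Proof.
case: v w => [a b] [c d]; rewrite /nsq /= -subr_ge0.
have := sqr_ge0 (a - c); have := sqr_ge0 (b - d); lra.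
Qed.

Lemma nsqN (w : R[i]) : nsq (- w) = nsq w.
Proof. by case: w => [a b]; rewrite /nsq /=; ring. Qed.

Lemma nsq_eq0 (w : R[i]) : nsq w = 0 -> w = 0.
Proof.
case: w => a b; rewrite /nsq /= => /eqP; rewrite paddr_eq0 ?sqr_ge0//.
by rewrite !sqrf_eq0 => /andP[/eqP -> /eqP ->].
Qed.

Lemma nsq0 : nsq (0 : R[i]) = 0.
Proof. by rewrite /nsq /= expr0n addr0. Qed.

Lemma nsq1 : nsq (1 : R[i]) = 1.
Proof. by rewrite /nsq /= expr1n expr0n addr0. Qed.

Lemma nsqX (w : R[i]) n : nsq (w ^+ n) = nsq w ^+ n.
Proof.
elim: n => [|n IH]; first by rewrite !expr0 nsq1.
by rewrite !exprS nsqM IH.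
Qed.

Lemma nsq_div (v w : R[i]) : w != 0 -> nsq (v / w) = nsq v / nsq w.
Proof.
move=> w0; have <- : nsq (v / w) * nsq w = nsq v by rewrite -nsqM divfK.
by rewrite mulfK//; apply/eqP => /nsq_eq0/eqP; exact/negP.
Qed.

Lemma modc_ge0 (w : R[i]) : 0 <= modc w.
Proof. by case: w => a b; exact: sqrtr_ge0. Qed.

Lemma modc_sqr (w : R[i]) : modc w ^+ 2 = nsq w.
Proof. by case: w => a b; rewrite /Normc.normc sqr_sqrtr// addr_ge0// sqr_ge0. Qed.

Lemma nsq_modc (w : R[i]) (h : R) : modc w < Num.min 1 h -> nsq w <= h.
Proof.
rewrite lt_min -modc_sqr => /andP[w1 wh]; apply: le_trans (ltW wh).
by rewrite expr2 ler_piMl ?modc_ge0// ltW.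
Qed.

Lemma ReD (v w : R[i]) : complex.Re (v + w) = complex.Re v + complex.Re w.
Proof. by case: v w => [a b] [c d]. Qed.

Lemma ImD (v w : R[i]) : complex.Im (v + w) = complex.Im v + complex.Im w.
Proof. by case: v w => [a b] [c d]. Qed.

Lemma ReB (v w : R[i]) : complex.Re (v - w) = complex.Re v - complex.Re w.
Proof. by case: v w => [a b] [c d]. Qed.

Lemma ImB (v w : R[i]) : complex.Im (v - w) = complex.Im v - complex.Im w.
Proof. by case: v w => [a b] [c d]. Qed.

Lemma ReM (v w : R[i]) : complex.Re (v * w) =
  complex.Re v * complex.Re w - complex.Im v * complex.Im w.
Proof. by case: v w => [a b] [c d]. Qed.

Lemma ImM (v w : R[i]) : complex.Im (v * w) =
  complex.Re v * complex.Im w + complex.Im v * complex.Re w.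
Proof. by case: v w => [a b] [c d]. Qed.

Lemma nsq_small (w : R[i]) (h : R) : 0 < h -> nsq w <= h ^+ 2 / 4 ->
  `|complex.Re w| < h /\ `|complex.Im w| < h.
Proof.
case: w => a b; rewrite /nsq /= => h0 hw; have := sqr_ge0 a; have := sqr_ge0 b.
by rewrite !ltr_norml => *; split; apply/andP; split; nra.
Qed.

Definition cderive (f : R -> R[i]) (x : R) (d : R[i]) : Prop :=
  is_derive x 1 (fun t => complex.Re (f t)) (complex.Re d) /\
  is_derive x 1 (fun t => complex.Im (f t)) (complex.Im d).

Lemma cderiveD (f g : R -> R[i]) x a b : cderive f x a -> cderive g x b ->
  cderive (fun t => f t + g t) x (a + b).
Proof.
case: a b => [a a'] [b b'] [h1 h2] [h3 h4]; split.
  by under eq_fun do rewrite ReD; apply: is_deriveD1.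
by under eq_fun do rewrite ImD; apply: is_deriveD1.
Qed.

Lemma cderiveZ c (f : R -> R[i]) x a : cderive f x a ->
  cderive (fun t => c * f t) x (c * a).
Proof.
case=> h1 h2; split; rewrite ?ReM ?ImM.
  by under eq_fun do rewrite ReM; apply: is_deriveB1; apply: is_deriveZ1.
by under eq_fun do rewrite ImM; apply: is_deriveD1; apply: is_deriveZ1.
Qed.

Lemma ccontinuousD D (f g : R -> R[i]) : ccontinuous_on D f ->
  ccontinuous_on D g -> ccontinuous_on D (fun t => f t + g t).
Proof.
move=> [h1 h2] [h3 h4]; split.
  by under eq_fun do rewrite ReD; apply: within_contD.
by under eq_fun do rewrite ImD; apply: within_contD.
Qed.

Lemma ccontinuousM D (f g : R -> R[i]) : ccontinuous_on D f ->
  ccontinuous_on D g -> ccontinuous_on D (fun t => f t * g t).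
Proof.
move=> [h1 h2] [h3 h4]; split.
  under eq_fun do rewrite ReM; apply: within_contD; last apply: within_contN.
    exact: within_contM.
  exact: within_contM.
by under eq_fun do rewrite ImM; apply: within_contD; apply: within_contM.
Qed.

Lemma ccontinuous_cst D c : ccontinuous_on D (fun=> c).
Proof. by split; exact: within_cst. Qed.

Lemma ccontinuous_shift (f : R -> R[i]) (a : R) : ccontinuous_on setT f ->
  ccontinuous_on setT (fun s => f (s + a)).
Proof.
move=> [c1 c2]; have cs := @continuous_shift R a; split.
  exact: (@within_comp _ setT setT _ _ _ cs c1).
exact: (@within_comp _ setT setT _ _ _ cs c2).
Qed.

Lemma ccontinuousT (f : R -> R[i]) : ccontinuous_on setT f ->
  continuous (fun x => complex.Re (f x)) /\ continuous (fun x => complex.Im (f x)).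
Proof. by move=> [h1 h2]; split; exact/continuous_subspace_setT. Qed.

Lemma ccont_nsq (f : R -> R[i]) : ccontinuous_on setT f ->
  continuous (fun x => nsq (f x)).
Proof. by move=> /ccontinuousT[c1 c2]; apply: contD; apply: contM. Qed.

Lemma ccontinuousV (g : R -> R[i]) : ccontinuous_on setT g -> (forall s, g s != 0) ->
  ccontinuous_on setT (fun s => (g s)^-1).
Proof.
move=> cg g0; have cn := ccont_nsq cg; have [c1 c2] := ccontinuousT cg.
have cV : continuous (fun s => (nsq (g s))^-1).
  move=> s; apply: (@continuousV _ _ (fun s => nsq (g s))); last exact: cn.
  by apply/eqP => /nsq_eq0 /eqP; rewrite (negbTE (g0 s)).
have E s : (g s)^-1 = (complex.Re (g s) * (nsq (g s))^-1) -i* (complex.Im (g s) * (nsq (g s))^-1).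
  by case: (g s).
split; apply: within_cont.
  by under eq_fun do rewrite E /=; exact: contM.
have -> : (fun s => complex.Im (g s)^-1) =
    (fun s => -1 * (complex.Im (g s) * (nsq (g s))^-1)).
  by apply/funext => s; rewrite E mulN1r.
by apply: contM; [exact: cont_cst|exact: contM].
Qed.

Lemma ccontinuous_nsq (g : R -> R[i]) :
  (forall s0 h, 0 < h -> \forall s \near s0, nsq (g s - g s0) <= h) ->
  ccontinuous_on setT g.
Proof.
have h4 (h : R) : 0 < h -> 0 < h ^+ 2 / 4 by move=> h0; rewrite divr_gt0// exprn_gt0.
by move=> H; split; apply: within_cont => s0; apply/cvgrPdist_lt => h h0;
  apply: filterS (H s0 _ (h4 h h0)) => s;
  move=> /(nsq_small h0)[]; rewrite distrC ReB ImB.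
Qed.

Definition ccvg (a : nat -> R[i]) (l : R[i]) : Prop :=
  (complex.Re (a j) @[j --> \oo] --> complex.Re l) /\
  (complex.Im (a j) @[j --> \oo] --> complex.Im l).

(** Only the squared modulus is estimated in this development; these lemmas
    exchange it for convergence of the real and imaginary parts. *)
Lemma ccvg_nsq (a : nat -> R[i]) l :
  (forall h : R, 0 < h -> \forall j \near \oo, nsq (a j - l) <= h) -> ccvg a l.
Proof.
have h4 (h : R) : 0 < h -> 0 < h ^+ 2 / 4 by move=> h0; rewrite divr_gt0// exprn_gt0.
by move=> H; split; apply/cvgrPdist_lt => h h0; apply: filterS (H _ (h4 h h0)) => j;
  move=> /(nsq_small h0)[]; rewrite distrC ReB ImB.
Qed.

Lemma ccvg_small (a : nat -> R[i]) l h : ccvg a l -> 0 < h ->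
  \forall j \near \oo, nsq (a j - l) <= h.
Proof.
move=> [h1 h2] h0; pose t : R := Num.min 1 (h / 2).
have t0 : 0 < t by rewrite lt_min ltr01 divr_gt0.
have t1 : t <= 1 by rewrite ge_min lexx.
have t2 : t <= h / 2 by rewrite ge_min lexx orbT.
move/cvgrPdist_lt : h1 => /(_ _ t0) h1; move/cvgrPdist_lt : h2 => /(_ _ t0) h2.
near=> j.
have k1 : `|complex.Re l - complex.Re (a j)| < t by near: j.
have k2 : `|complex.Im l - complex.Im (a j)| < t by near: j.
move: k1 k2; case: (a j) (l) => [x y] [x' y']; rewrite /nsq /= !ltr_norml.
by move=> /andP[? ?] /andP[? ?]; nra.
Unshelve. all: by end_near. Qed.

Lemma ccvgM (a b : nat -> R[i]) l m : ccvg a l -> ccvg b m ->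
  ccvg (fun j => a j * b j) (l * m).
Proof.
move=> [a1 a2] [b1 b2]; split; rewrite ?ReM ?ImM.
  by under eq_fun do rewrite ReM; apply: cvgB; apply: cvgM.
by under eq_fun do rewrite ImM; apply: cvgD; apply: cvgM.
Qed.

Lemma ccvgX (a : nat -> R[i]) l n : ccvg a l -> ccvg (fun j => a j ^+ n) (l ^+ n).
Proof.
move=> al; elim: n => [|n IH]; first by split; exact: cvg_cst.
by under eq_fun do rewrite exprS; rewrite exprS; exact: ccvgM.
Qed.

Lemma ccvg_unique (a : nat -> R[i]) l m : ccvg a l -> ccvg a m -> l = m.
Proof.
case: l m => [x y] [x' y'] [/= h1 h2] [/= h3 h4].
by congr (_ +i* _); [exact: cvg_unique h1 h3|exact: cvg_unique h2 h4].
Qed.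

Lemma converges_uniformly_nsq (F : nat -> R -> R[i]) f : converges_uniformly F f ->
  forall h : R, 0 < h -> \forall j \near \oo, forall s, nsq (F j s - f s) <= h.
Proof.
move=> Ff h h0; have t0 : 0 < Num.min 1 h by rewrite lt_min ltr01.
by apply: filterS (Ff _ t0) => j H s; exact: nsq_modc.
Qed.

End complex_valued.

(** * The first-order system for the Cauchy data and its flux *)

Section ode.
Context {R : realType}.
Implicit Types (F G : solution R) (A r : R -> R) (k c d : R[i]) (x eta X M : R).

Definition cauchy_norm F (x : R) : R := nsq (pval F x) + nsq (pflux F x).

(** Im (q conj p) for the Cauchy data (p, q); up to a factor, the energy carried
    through x. *)
Definition flux F (x : R) : R :=
  complex.Im (pflux F x) * complex.Re (pval F x) -
  complex.Re (pflux F x) * complex.Im (pval F x).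

Definition lincomb c F d G : solution R :=
  Solution (fun x => c * pval F x + d * pval G x)
           (fun x => c * pflux F x + d * pflux G x).

Definition shift_sol (a : R) F : solution R :=
  Solution (fun x => pval F (x + a)) (fun x => pflux F (x + a)).

(** Solutions of p' = A q, q' = - r k p up to residuals of size eta. The
    difference of two exact solutions with close coefficients is of this kind,
    which reduces every continuity statement to an estimate on a single
    function. *)
Definition approx_sol A r k (eta X : R) F : Prop :=
  [/\ ccontinuous_on `[0, X] (pval F), ccontinuous_on `[0, X] (pflux F) &
   exists dp dq : R -> R[i], forall x, 0 < x < X ->
    [/\ cderive (pval F) x (dp x), cderive (pflux F) x (dq x),
        nsq (dp x - (A x)%:C * pflux F x) <= eta ^+ 2 &
        nsq (dq x + (r x)%:C * k * pval F x) <= eta ^+ 2]].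

Definition exact_sol A r k (X : R) F : Prop :=
  [/\ ccontinuous_on `[0, X] (pval F), ccontinuous_on `[0, X] (pflux F) &
   forall x, 0 < x < X ->
    cderive (pval F) x ((A x)%:C * pflux F x) /\
    cderive (pflux F) x (- ((r x)%:C * k * pval F x))].

Lemma cauchy_norm_ge0 F x : 0 <= cauchy_norm F x.
Proof. by rewrite addr_ge0// nsq_ge0. Qed.

Lemma cauchy_norm_eq0 F x : cauchy_norm F x <= 0 -> pval F x = 0 /\ pflux F x = 0.
Proof.
rewrite /cauchy_norm => h; have := nsq_ge0 (pval F x); have := nsq_ge0 (pflux F x).
by move=> h1 h2; split; apply: nsq_eq0; lra.
Qed.

Lemma cauchy_norm_lincomb (c d : R[i]) F G x : cauchy_norm (lincomb c F d G) x <=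
  2 * (nsq c * cauchy_norm F x + nsq d * cauchy_norm G x).
Proof.
rewrite /cauchy_norm /=; have := nsqD (c * pval F x) (d * pval G x).
by have := nsqD (c * pflux F x) (d * pflux G x); rewrite !nsqM; lra.
Qed.

Lemma cauchy_norm_diff F G x : cauchy_norm (lincomb 1 F (-1) G) x <=
  2 * (cauchy_norm F x + cauchy_norm G x).
Proof.
apply: le_trans (cauchy_norm_lincomb _ _ _ _ _) _.
by rewrite nsqN nsq1 !mul1r.
Qed.

Lemma cauchy_norm_diff_small F G x h : cauchy_norm (lincomb 1 F (-1) G) x <= h ->
  nsq (pval F x - pval G x) <= h /\ nsq (pflux F x - pflux G x) <= h.
Proof.
by rewrite /cauchy_norm /= !mul1r !mulN1r => H; split; apply: le_trans H;
  rewrite ?lerDl ?lerDr nsq_ge0.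
Qed.

Lemma cauchy_norm_cont (D : set R) F : ccontinuous_on D (pval F) ->
  ccontinuous_on D (pflux F) -> {within D, continuous (cauchy_norm F)}.
Proof.
by move=> [c1 c2] [c3 c4]; apply: within_contD; apply: within_contD;
  apply: within_contM.
Qed.

Lemma exact_sol_lincomb A r k X c F d G :
  exact_sol A r k X F -> exact_sol A r k X G ->
  exact_sol A r k X (lincomb c F d G).
Proof.
move=> [cF1 cF2 dF] [cG1 cG2 dG]; split.
- by apply: ccontinuousD; apply: ccontinuousM => //; exact: ccontinuous_cst.
- by apply: ccontinuousD; apply: ccontinuousM => //; exact: ccontinuous_cst.
move=> x xX; have [F1 F2] := dF x xX; have [G1 G2] := dG x xX.
rewrite /lincomb /=; split.
- have -> : (A x)%:C * (c * pflux F x + d * pflux G x) =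
    c * ((A x)%:C * pflux F x) + d * ((A x)%:C * pflux G x) by ring.
  by apply: cderiveD; apply: cderiveZ.
- have -> : - ((r x)%:C * k * (c * pval F x + d * pval G x)) =
   c * (- ((r x)%:C * k * pval F x)) + d * (- ((r x)%:C * k * pval G x)) by ring.
  by apply: cderiveD; apply: cderiveZ.
Qed.

Lemma exact_sol_shift A r k (a X : R) F : 0 <= a -> exact_sol A r k (X + a) F ->
  exact_sol (fun x => A (x + a)) (fun x => r (x + a)) k X (shift_sol a F).
Proof.
move=> a0 [[c1 c2] [c3 c4] dF].
have sub x : `[0, X]%classic x -> `[0, X + a]%classic (x + a).
  by rewrite /= !in_itv/= => /andP[? ?]; apply/andP; split; lra.
have cs := @continuous_shift R a.
split; first by split; [exact: (within_comp sub cs c1)|exact: (within_comp sub cs c2)].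
  by split; [exact: (within_comp sub cs c3)|exact: (within_comp sub cs c4)].
move=> x /andP[x0 xX]; have xa : 0 < x + a < X + a.
  by apply/andP; split; lra.
have [[h1 h2] [h3 h4]] := dF _ xa.
by split; split; apply: is_derive_shift.
Qed.

(** G solves the system of F up to the difference of the coefficients applied to
    G. *)
Lemma exact_sol_diff (A1 A2 r1 r2 : R -> R) (k1 k2 : R[i]) e M X F G :
  exact_sol A1 r1 k1 X F -> exact_sol A2 r2 k2 X G ->
  (forall x, 0 < x < X -> (A1 x - A2 x) ^+ 2 <= e ^+ 2) ->
  (forall x, 0 < x < X -> nsq ((r1 x)%:C * k1 - (r2 x)%:C * k2) <= e ^+ 2) ->
  (forall x, 0 < x < X -> cauchy_norm G x <= M ^+ 2) ->
  approx_sol A1 r1 k1 (e * M) X (lincomb 1 F (-1) G).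
Proof.
move=> [cF1 cF2 dF] [cG1 cG2 dG] hA hr hM; split.
- by apply: ccontinuousD; apply: ccontinuousM => //; exact: ccontinuous_cst.
- by apply: ccontinuousD; apply: ccontinuousM => //; exact: ccontinuous_cst.
exists (fun x => 1 * ((A1 x)%:C * pflux F x) + -1 * ((A2 x)%:C * pflux G x)).
exists (fun x => 1 * (- ((r1 x)%:C * k1 * pval F x)) + -1 * (- ((r2 x)%:C * k2 * pval G x))).
move=> x xX; have [F1 F2] := dF x xX; have [G1 G2] := dG x xX.
split; [by apply: cderiveD; apply: cderiveZ|by apply: cderiveD; apply: cderiveZ| |].
- rewrite [X in nsq X](_ : _ = (A1 x - A2 x)%:C * pflux G x); last first.
    by rewrite /= rmorphB; ring.
  rewrite nsqM exprMn ler_pM ?nsq_ge0//.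
    by rewrite /nsq /= expr0n addr0 hA.
  by apply: le_trans (hM _ xX); rewrite lerDr nsq_ge0.
- rewrite [X in nsq X](_ : _ = - ((r1 x)%:C * k1 - (r2 x)%:C * k2) * pval G x).
    rewrite nsqM nsqN exprMn ler_pM ?nsq_ge0//; first exact: hr.
    by apply: le_trans (hM _ xX); rewrite lerDl nsq_ge0.
  by rewrite /=; ring.
Qed.

Lemma exact_approx A r k X F : exact_sol A r k X F -> approx_sol A r k 0 X F.
Proof.
move=> [c1 c2 dF]; split => //.
exists (fun x => (A x)%:C * pflux F x).
exists (fun x => - ((r x)%:C * k * pval F x)) => x xX.
have [h1 h2] := dF x xX; split => //.
  by rewrite subrr nsq0 expr0n.
by rewrite addNr nsq0 expr0n.
Qed.

Lemma exact_sol_bounded A r k X F : 0 <= X -> exact_sol A r k X F ->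
  exists2 K, 0 <= K & forall t, 0 <= t <= X -> cauchy_norm F t <= K ^+ 2.
Proof.
move=> X0 [c1 c2 _]; have [c _ hc] := EVT_max X0 (cauchy_norm_cont c1 c2).
exists (cauchy_norm F c + 1); first by rewrite addr_ge0 ?cauchy_norm_ge0.
move=> t tX; apply: (@le_trans _ _ (cauchy_norm F c)).
  by apply: hc; rewrite in_itv.
by have := cauchy_norm_ge0 F c; nra.
Qed.

Lemma approx_solW (A r : R -> R) k eta X Y F : Y <= X -> approx_sol A r k eta X F ->
  approx_sol A r k eta Y F.
Proof.
move=> YX [[c1 c2] [c3 c4] [dp [dq dF]]].
have sub : `[0, Y] `<=` `[0, X].
  by move=> t /=; rewrite !in_itv/= => /andP[-> /le_trans ->].
split; [split|split|].
- exact: (continuous_subspaceW sub c1).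
- exact: (continuous_subspaceW sub c2).
- exact: (continuous_subspaceW sub c3).
- exact: (continuous_subspaceW sub c4).
by exists dp, dq => x /andP[x0 xY]; apply: dF; rewrite x0/= (lt_le_trans xY).
Qed.

Lemma flux_le_norm F x : `|flux F x| <= cauchy_norm F x.
Proof.
rewrite /flux /cauchy_norm /nsq; move: (pval F x) (pflux F x) => [a b] [c d] /=.
have := sqr_ge0 (d - a); have := sqr_ge0 (c + b).
have := sqr_ge0 (d + a); have := sqr_ge0 (c - b).
by rewrite ler_norml => *; apply/andP; split; nra.
Qed.

(** The Cauchy-Schwarz inequality in the plane. *)
Lemma cross_le (a b c d e M : R) : 0 <= e -> 0 <= M ->
  a ^+ 2 + b ^+ 2 <= e ^+ 2 -> c ^+ 2 + d ^+ 2 <= M ^+ 2 ->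
  a * c - b * d <= e * M.
Proof.
move=> e0 M0 h1 h2; have eM : 0 <= e * M by rewrite mulr_ge0.
rewrite leNgt; apply/negP => lt_eM.
suff : (a * c - b * d) ^+ 2 <= (e * M) ^+ 2.
  by rewrite leNgt ltrXn2r// lt_eM.
rewrite [leRHS]exprMn; apply: (@le_trans _ _ ((a ^+ 2 + b ^+ 2) * (c ^+ 2 + d ^+ 2))).
  by rewrite -subr_ge0; have := sqr_ge0 (a * d + b * c); lra.
by rewrite ler_pM// ?addr_ge0 ?sqr_ge0.
Qed.

(** Up to the residuals, the derivative of the flux is - r (Im k) |p|^2, which
    is nonpositive. *)
Lemma flux_increment A r k eta X M F : 0 <= X -> 0 <= eta -> 0 <= M ->
  0 <= complex.Im k -> (forall x, 0 < x < X -> 0 <= r x) ->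
  (forall x, 0 < x < X -> cauchy_norm F x <= M ^+ 2) ->
  approx_sol A r k eta X F -> flux F X - flux F 0 <= 2 * eta * M * X.
Proof.
move=> X0 eta0 M0 k0 r0 FM [[cpr cpi] [cqr cqi]] [dp [dq hd]].
pose df x := complex.Im (dq x) * complex.Re (pval F x) +
   complex.Im (pflux F x) * complex.Re (dp x) -
   (complex.Re (dq x) * complex.Im (pval F x) +
   complex.Re (pflux F x) * complex.Im (dp x)).
rewrite -[X in _ * X]subr0; apply: (@increment_le _ _ df) => //.
- by apply: within_contD; [|apply: within_contN]; apply: within_contM.
- move=> x /hd[[h1 h2] [h3 h4] _ _].
  by apply: is_deriveB1; apply: is_deriveM1.
- move=> x x0X; have [_ _] := hd _ x0X; have := FM _ x0X; move: (r x) (A x) (r0 _ x0X) => rx Ax rx0.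
  rewrite /df /nsq /cauchy_norm /nsq.
  case: (dp x) (dq x) (pval F x) (pflux F x) (k) k0 => [dpr dpi] [dqr dqi].
  move=> [pr pi] [qr qi] [k1 k2] /= k20 FMx e1 e2.
  have e1' : (dpr - Ax * qr) ^+ 2 + (dpi - Ax * qi) ^+ 2 <= eta ^+ 2.
    by move: e1; lra.
  have e2' : (dqi + rx * (k1 * pi + k2 * pr)) ^+ 2 +
      (dqr + rx * (k1 * pr - k2 * pi)) ^+ 2 <= eta ^+ 2.
    by move: e2; lra.
  have nq : qi ^+ 2 + qr ^+ 2 <= M ^+ 2.
    by rewrite addrC; apply: le_trans FMx; rewrite lerDr addr_ge0// sqr_ge0.
  have np : pr ^+ 2 + pi ^+ 2 <= M ^+ 2.
    by apply: le_trans FMx; rewrite lerDl addr_ge0// sqr_ge0.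
  have h1 := cross_le eta0 M0 e2' np.
  have h2 := cross_le eta0 M0 e1' nq.
  have h3 : 0 <= rx * k2 * (pr ^+ 2 + pi ^+ 2).
    by rewrite !mulr_ge0// addr_ge0// sqr_ge0.
  lra.
Qed.

(** For real k the derivative of the flux is 0. *)
Lemma flux_conserved (A r : R -> R) (k : R[i]) X F : 0 <= X -> complex.Im k = 0 ->
  exact_sol A r k X F -> flux F X = flux F 0.
Proof.
move=> X0 k0 [[c1 c2] [c3 c4] dF].
have cf : {within `[0, X], continuous (flux F)}.
  by apply: within_contD; [|apply: within_contN]; apply: within_contM.
have df x : 0 < x < X -> is_derive x 1 (flux F) 0.
  move=> /dF[[h1 h2] [h3 h4]].
  apply: (@is_derive_eq _ _ _ _ _ _ _ _ (is_deriveB1 (is_deriveM1 h4 h1) (is_deriveM1 h3 h2))).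
  move: k0; case: (pval F x) (pflux F x) (k) => [a b] [c d] [k1 k2] /= ->.
  by ring.
have i1 := @increment_le _ (flux F) (fun=> 0) 0 X 0 X0 cf df (fun _ _ => lexx 0).
have dN x : 0 < x < X -> is_derive x 1 (fun t => - flux F t) 0.
  by move=> /df h; rewrite -oppr0; exact: is_deriveN1.
have i2 := @increment_le _ (fun t => - flux F t) (fun=> 0) 0 X 0 X0 (within_contN cf) dN (fun _ _ => lexx 0).
by rewrite !mul0r in i1 i2; apply/eqP; rewrite eq_le; apply/andP; split; lra.
Qed.

(** Gronwall: N = |p|^2 + |q|^2 satisfies N' <= B N + 2 eta^2, because each term
    of N' is a product of two components, hence at most a multiple of N, up to
    the residuals. The constant depends on the bounds of the coefficients only,
    which makes the later estimates uniform in s and in the absorption. *)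
Lemma approx_sol_growth (CA Cr K2 X : R) : 0 <= X -> 0 <= CA -> 0 <= Cr -> 0 <= K2 ->
  exists2 K, 0 < K & forall A r k eta F,
  (forall x, 0 < x < X -> 0 <= A x <= CA) ->
  (forall x, 0 < x < X -> 0 <= r x <= Cr) -> nsq k <= K2 ->
  approx_sol A r k eta X F ->
  forall x, 0 <= x <= X -> cauchy_norm F x <= K * (cauchy_norm F 0 + eta ^+ 2).
Proof.
move=> X0 CA0 Cr0 K20.
pose B : R := CA + Cr * (K2 + 1) + 1.
have B0 : 0 <= B by rewrite /B !addr_ge0// mulr_ge0// addr_ge0.
exists (expR (B * X) * (1 + 2 * X)).
  by rewrite mulr_gt0// ?expR_gt0// ltr_pwDl// mulr_ge0.
move=> A r k eta F hA hr hk [[cpr cpi] [cqr cqi]] [dp [dq hd]] x /andP[x0 xX].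
pose dE t := 2 * (complex.Re (pval F t) * complex.Re (dp t) +
  complex.Im (pval F t) * complex.Im (dp t) +
  complex.Re (pflux F t) * complex.Re (dq t) +
  complex.Im (pflux F t) * complex.Im (dq t)).
have sub (t : R) : 0 < t < x -> 0 < t < X.
  by case/andP=> -> tx /=; exact: lt_le_trans xX.
have subD (f : R -> R) : {within `[0, X], continuous f} ->
    {within `[0, x], continuous f}.
  by apply: continuous_subspaceW => t /=; rewrite !in_itv/= => /andP[->] /le_trans ->.
have contE : {within `[0, x], continuous (cauchy_norm F)}.
  by rewrite /cauchy_norm /nsq; apply: within_contD;
    apply: within_contD; apply: within_contM; apply: subD.
have derE (t : R) : 0 < t < x -> is_derive t 1 (cauchy_norm F) (dE t).
  move=> /sub /hd[[h1 h2] [h3 h4] _ _].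
  by apply: is_derive_eq; rewrite /dE /GRing.scale /=; ring.
have dE_le (t : R) : 0 < t < x -> dE t <= B * cauchy_norm F t + 2 * eta ^+ 2.
  move=> /sub tX; have [_ _] := hd _ tX; have := hA _ tX; have := hr _ tX.
  move: hk; rewrite /dE /cauchy_norm /nsq /B.
  move: (A t) (r t) => At rt.
  case: (dp t) (dq t) (pval F t) (pflux F t) (k) => [dpr dpi] [dqr dqi].
  move=> [pr pi] [qr qi] [k1 k2] /= hk /andP[r0 rC] /andP[A0 AC] e1 e2.
  set np : R := pr ^+ 2 + pi ^+ 2; set nq : R := qr ^+ 2 + qi ^+ 2.
  have np0 : 0 <= np by rewrite addr_ge0// sqr_ge0.
  have nq0 : 0 <= nq by rewrite addr_ge0// sqr_ge0.
  have kk0 : 0 <= k1 ^+ 2 + k2 ^+ 2 by rewrite addr_ge0// sqr_ge0.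
  have h1 : 2 * At * (pr * qr + pi * qi) <= CA * (np + nq).
    apply: (@le_trans _ _ (At * (np + nq))); last by rewrite ler_wpM2r// addr_ge0.
    rewrite [2 * At]mulrC -mulrA ler_wpM2l// -subr_ge0.
    by have := sqr_ge0 (pr - qr); have := sqr_ge0 (pi - qi); rewrite /np /nq; lra.
  have h2 : 2 * (pr * (dpr - At * qr) + pi * (dpi - At * qi)) <= np + eta ^+ 2.
    have := sqr_ge0 (pr - (dpr - At * qr)); have := sqr_ge0 (pi - (dpi - At * qi)).
    by move: e1; rewrite /np; lra.
  have h3 : 2 * (qr * (dqr + rt * (k1 * pr - k2 * pi)) +
       qi * (dqi + rt * (k1 * pi + k2 * pr))) <= nq + eta ^+ 2.
    have := sqr_ge0 (qr - (dqr + rt * (k1 * pr - k2 * pi))).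
    have := sqr_ge0 (qi - (dqi + rt * (k1 * pi + k2 * pr))).
    by move: e2; rewrite /nq; lra.
  have h4 : - (2 * rt * (qr * (k1 * pr - k2 * pi) + qi * (k1 * pi + k2 * pr))) <=
      Cr * ((K2 + 1) * (np + nq)).
    apply: (@le_trans _ _ (rt * ((K2 + 1) * (np + nq)))); last first.
      by rewrite ler_wpM2r// mulr_ge0// addr_ge0.
    rewrite [2 * rt]mulrC -mulrA -mulrN ler_wpM2l//.
    apply: (@le_trans _ _ (nq + (k1 ^+ 2 + k2 ^+ 2) * np)).
      have := sqr_ge0 (qr + (k1 * pr - k2 * pi)).
      have := sqr_ge0 (qi + (k1 * pi + k2 * pr)).
      by rewrite /np /nq; lra.
    have : (k1 ^+ 2 + k2 ^+ 2) * np <= K2 * np by rewrite ler_wpM2r.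
    have : 0 <= K2 * nq by rewrite mulr_ge0.
    lra.
  move: h1 h2 h3 h4; rewrite /np /nq; lra.
(* integrate exp(- B t) N(t), whose derivative is at most 2 eta^2 *)
have contexp : continuous (fun t : R => expR (- B * t)).
  move=> t; apply: continuous_comp; last exact: continuous_expR.
  by apply: continuousM; [exact: cst_continuous|exact: cvg_id].
have derexp (t : R) : is_derive t 1 (fun t : R => expR (- B * t)) (- B * expR (- B * t)).
  have h := @is_derive_affine R expR (- B) 0 t _ (is_derive_expR _).
  move: h; rewrite addr0 mulrC; under eq_fun do rewrite addr0.
  by [].
have := @increment_le R (fun t => expR (- B * t) * cauchy_norm F t)
  (fun t => - B * expR (- B * t) * cauchy_norm F t + expR (- B * t) * dE t) 0 x
  (2 * eta ^+ 2) x0.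
move=> /(_ _ _ _) H.
have {H}: expR (- B * x) * cauchy_norm F x - expR (- B * 0) * cauchy_norm F 0 <=
   2 * eta ^+ 2 * (x - 0).
  apply: H.
  - by apply: within_contM => //; apply: within_cont.
  - by move=> t tx; have := derE t tx; have := derexp t; move=> ? ?; apply: is_deriveM1.
  - move=> t tx; have /andP[/ltW t0 _] := tx.
    apply: (@le_trans _ _ (expR (- B * t) * (2 * eta ^+ 2))).
      rewrite -subr_ge0.
      have -> : expR (- B * t) * (2 * eta ^+ 2) - (- B * expR (- B * t) * cauchy_norm F t + expR (- B * t) * dE t) = expR (- B * t) * (B * cauchy_norm F t + 2 * eta ^+ 2 - dE t) by ring.
      by rewrite mulr_ge0 ?expR_ge0// subr_ge0 dE_le.
    apply: ler_piMl; first by rewrite mulr_ge0// sqr_ge0.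
    rewrite -expR0 ler_expR mulNr oppr_le0 mulr_ge0//.
rewrite mulr0 expR0 mul1r subr0 mulNr expRN => H.
have e0 : 0 < expR (B * x) by exact: expR_gt0.
have {H}: cauchy_norm F x <= expR (B * x) * (cauchy_norm F 0 + 2 * eta ^+ 2 * x).
  by rewrite -ler_pdivrMl// addrC -lerBlDr.
move=> /le_trans; apply; rewrite -[leRHS]mulrA.
have n0 : 0 <= cauchy_norm F 0 by rewrite addr_ge0// nsq_ge0.
apply: ler_pM; rewrite ?expR_ge0//.
- by rewrite addr_ge0// mulr_ge0// mulr_ge0// sqr_ge0.
- by rewrite ler_expR ler_wpM2l.
- by have := sqr_ge0 eta; nra.
Qed.

End ode.

(** * Robin traces *)

Section robin.
Context {R : realType}.
Implicit Types (F G : solution R) (A r : R -> R) (k c d : R[i]) (x eta X M z : R).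
Local Notation Rp z := (Robin_plus z rgt).
Local Notation Rm z := (Robin_minus z rgt).

Lemma robin_plus_lincomb z i (c d : R[i]) F G x : Robin_plus z i (lincomb c F d G) x =
  c * Robin_plus z i F x + d * Robin_plus z i G x.
Proof. by rewrite /Robin_plus /=; ring. Qed.

Lemma robin_minus_lincomb z i (c d : R[i]) F G x : Robin_minus z i (lincomb c F d G) x =
  c * Robin_minus z i F x + d * Robin_minus z i G x.
Proof. by rewrite /Robin_minus /=; ring. Qed.

Lemma robin_minus_le z F x : nsq (Rm z F x) <= 2 * (1 + z ^+ 2) * cauchy_norm F x.
Proof.
rewrite /Robin_minus /cauchy_norm /nsq /sgn.
move: (pval F x) (pflux F x) => [a b] [c d] /=.
have := sqr_ge0 (c - z * b); have := sqr_ge0 (d + z * a).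
have := sqr_ge0 (z * c); have := sqr_ge0 (z * d).
have := sqr_ge0 a; have := sqr_ge0 b.
by lra.
Qed.

(** The two traces differ by the sign of the flux unknown: this turns statements
    on the flux into statements on the Robin traces. *)
Lemma robin_flux z F x :
  nsq (Rp z F x) - nsq (Rm z F x) = 4 * z * flux F x.
Proof.
rewrite /flux /Robin_plus /Robin_minus /nsq /sgn.
by case: (pval F x) (pflux F x) => [a b] [c d] /=; ring.
Qed.

(** As z is nonzero, the two traces are independent combinations of p and q. *)
Lemma robin_cauchy z F x : 0 < z ->
  cauchy_norm F x <= (1 + z ^- 2) * (nsq (Rp z F x) + nsq (Rm z F x)).
Proof.
move=> z0; have z20 : 0 < z ^+ 2 by rewrite exprn_gt0.
have -> : nsq (Rp z F x) + nsq (Rm z F x) =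
    2 * nsq (pflux F x) + 2 * z ^+ 2 * nsq (pval F x).
  rewrite /Robin_plus /Robin_minus /nsq /sgn.
  by case: (pval F x) (pflux F x) => [a b] [c d] /=; ring.
rewrite /cauchy_norm.
have := nsq_ge0 (pval F x); have := nsq_ge0 (pflux F x).
move: (nsq (pflux F x)) (nsq (pval F x)) => a b a0 b0.
have -> : (1 + z ^- 2) * (2 * a + 2 * z ^+ 2 * b) =
    2 * a + 2 * b + 2 * (z ^+ 2 * b) + 2 * (z ^- 2 * a).
  by field; rewrite gt_eqF.
have : 0 <= z ^+ 2 * b by rewrite mulr_ge0// ltW.
have : 0 <= z ^- 2 * a by rewrite mulr_ge0// invr_ge0 ltW.
lra.
Qed.

(** Energy balance of a segment: the flux does not increase, so the leaving
    traces are dominated by the entering ones. *)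
Lemma robin_reflection z A r k eta X M F : 0 < z -> 0 <= X -> 0 <= eta ->
  0 <= M -> 0 <= complex.Im k -> (forall x, 0 < x < X -> 0 <= r x) ->
  (forall x, 0 < x < X -> cauchy_norm F x <= M ^+ 2) ->
  approx_sol A r k eta X F ->
  nsq (Rm z F 0) + nsq (Rp z F X) <=
  nsq (Rp z F 0) + nsq (Rm z F X) + 8 * z * (eta * M * X).
Proof.
move=> z0 X0 eta0 M0 k0 r0 FM Fsol.
have := flux_increment X0 eta0 M0 k0 r0 FM Fsol.
rewrite -(ler_pM2l z0) => H.
by have := robin_flux z F X; have := robin_flux z F 0; lra.
Qed.

(** The entering traces bound R-(0) by the energy balance, hence all the Cauchy
    data at 0, hence the solution by Gronwall. The bound stays uniform as Im k
    tends to 0, and contains uniqueness for the Robin problem. The a priori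
    bound M enters only multiplied by the residual. *)
Lemma robin_stability z (CA Cr K2 : R) X : 0 < z -> 0 <= X -> 0 <= CA ->
  0 <= Cr -> 0 <= K2 -> exists2 K, 0 < K & forall A r k eta M F,
  (forall x, 0 < x < X -> 0 <= A x <= CA) ->
  (forall x, 0 < x < X -> 0 <= r x <= Cr) -> nsq k <= K2 ->
  0 <= complex.Im k -> 0 <= eta -> 0 <= M ->
  (forall x, 0 < x < X -> cauchy_norm F x <= M ^+ 2) ->
  approx_sol A r k eta X F ->
  forall x, 0 <= x <= X -> cauchy_norm F x <=
    K * (nsq (Rp z F 0) + nsq (Rm z F X) + eta * M + eta ^+ 2).
Proof.
move=> z0 X0 CA0 Cr0 K20.
have [K K0 HK] := approx_sol_growth X0 CA0 Cr0 K20.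
pose Cz := 1 + z ^- 2; have Cz1 : 1 <= Cz by rewrite lerDl invr_ge0 sqr_ge0.
exists (K * (Cz * (2 + 8 * z * X))).
  by rewrite !mulr_gt0// ?(lt_le_trans _ Cz1)// ltr_pwDl// !mulr_ge0// ltW.
move=> A r k eta M F hA hr hk k0 eta0 M0 FM Fsol x xX.
apply: (le_trans (HK _ _ _ _ _ hA hr hk Fsol _ xX)).
rewrite -[leRHS]mulrA ler_wpM2l ?(ltW K0)//.
have r0 y : 0 < y < X -> 0 <= r y by move=> /hr /andP[].
have := robin_reflection z0 X0 eta0 M0 k0 r0 FM Fsol.
have := robin_cauchy F 0 z0; rewrite -/Cz.
move: (nsq_ge0 (Rp z F 0)) (nsq_ge0 (Rm z F X)) (nsq_ge0 (Rp z F X)).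
move: (nsq (Rp z F 0)) (nsq (Rm z F X)) (nsq (Rp z F X)) (nsq (Rm z F 0)) (cauchy_norm F 0).
move=> a b a' b' n a0 b0 a'0 h1 h2.
have e20 : 0 <= eta ^+ 2 by rewrite sqr_ge0.
have eM0 : 0 <= eta * M by rewrite mulr_ge0.
have zX0 : 0 <= z * X by rewrite mulr_ge0// ltW.
apply: (@le_trans _ _ (Cz * (2 * a + b + 8 * z * (eta * M * X) + eta ^+ 2))).
  apply: (@le_trans _ _ (Cz * (a + b') + Cz * eta ^+ 2)).
    by rewrite lerD// ler_peMl.
  by rewrite -mulrDr ler_wpM2l ?(le_trans _ Cz1)//; lra.
rewrite -[leRHS]mulrA ler_wpM2l ?(le_trans _ Cz1)//.
have : 0 <= z * X * (a + b + eta ^+ 2) by rewrite mulr_ge0// !addr_ge0.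
lra.
Qed.

Lemma robin_stability_exact z (CA Cr K2 : R) X : 0 < z -> 0 <= X -> 0 <= CA ->
  0 <= Cr -> 0 <= K2 -> exists2 K, 0 < K & forall A r k F,
  (forall x, 0 < x < X -> 0 <= A x <= CA) ->
  (forall x, 0 < x < X -> 0 <= r x <= Cr) -> nsq k <= K2 ->
  0 <= complex.Im k -> exact_sol A r k X F ->
  forall x, 0 <= x <= X -> cauchy_norm F x <=
    K * (nsq (Rp z F 0) + nsq (Rm z F X)).
Proof.
move=> z0 X0 CA0 Cr0 K20.
have [K K0 HK] := robin_stability z0 X0 CA0 Cr0 K20.
have [K' K'0 HK'] := approx_sol_growth X0 CA0 Cr0 K20.
exists K => // A r k F hA hr hk k0 /exact_approx Fsol x xX.
have := HK _ _ _ _ (K' * cauchy_norm F 0 + 1) _ hA hr hk k0 (lexx 0) _ _ Fsol x xX.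
have F0 : 0 <= K' * cauchy_norm F 0.
  by rewrite mulr_ge0 ?(ltW K'0)// addr_ge0// nsq_ge0.
rewrite mul0r expr0n/= !addr0; apply; first by rewrite addr_ge0.
(* any a priori bound will do, since it is multiplied by a zero residual *)
move=> y /andP[/ltW y0 /ltW yX].
have := HK' _ _ _ _ _ hA hr hk Fsol y; rewrite expr0n/= addr0 y0 yX => /(_ isT).
by move=> /le_trans; apply; nra.
Qed.

End robin.

(** * From weak to classical solutions *)

Section variational_calculus.
Context {R : realType}.
Local Notation leb := (@lebesgue_measure R).
Implicit Types (f g h U W : R -> R) (a b p q x c : R).

(** Freezing a function outside a segment turns continuity on the segment into
    continuity on the line. *)
Definition clamp p q x : R := Num.max p (Num.min q x).

Lemma clamp_itv p q x : p <= q -> p <= clamp p q x <= q.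
Proof. by move=> pq; rewrite /clamp le_max lexx/= ge_max pq ge_min lexx. Qed.

Lemma clamp_id p q x : p <= x <= q -> clamp p q x = x.
Proof. by move=> /andP[px xq]; rewrite /clamp min_r// max_r. Qed.

Lemma clamp_continuous p q : continuous (clamp p q).
Proof.
move=> x; apply: continuous_max; first exact: cst_continuous.
by apply: continuous_min; [exact: cst_continuous|exact: cvg_id].
Qed.

Lemma continuous_comp_within (D : set R) f (c : R -> R) : (forall x, D (c x)) ->
  continuous c -> {within D, continuous f} -> continuous (fun t => f (c t)).
Proof.
move=> cD cc cf; apply/continuous_subspace_setT.
exact: (@within_comp _ setT D).
Qed.

Lemma continuous_clamp p q f : p <= q -> {within `[p, q], continuous f} ->
  continuous (fun t => f (clamp p q t)).
Proof.
move=> pq; apply: continuous_comp_within; last exact: clamp_continuous.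
by move=> x; rewrite /= in_itv/= clamp_itv.
Qed.

Lemma ccompact_integrable a b f : {within `[a, b], continuous f} ->
  leb.-integrable `[a, b] (EFin \o f).
Proof. by move=> cf; apply: continuous_compact_integrable => //; exact: segment_compact. Qed.

(** The base point a is chosen strictly to the left of the points at which the
    primitive is differentiated, as [prim_derive] requires. *)
Definition prim a f x : R := \int[leb]_(t in `[a, x]) f t.

Lemma prim_derive a f x : continuous f -> a < x ->
  is_derive x 1 (prim a f) (f x).
Proof.
move=> cf ax; have xx1 : x < x + 1 by rewrite ltrDl.
have [|d e] := continuous_FTC1_closed xx1 _ ax (cf x).
  by apply: ccompact_integrable; exact: within_cont.
split; first exact: d.
by rewrite -derive1E; exact: e.
Qed.

Lemma prim0 a f x : (forall t, a <= t <= x -> f t = 0) -> prim a f x = 0.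
Proof.
move=> f0; rewrite /prim (@eq_Rintegral _ _ _ _ _ (cst 0)) ?Rintegral_cst ?mul0r//.
by move=> t; rewrite inE/= in_itv/= => /f0.
Qed.

Lemma RFTC2 f F a b : a < b -> {within `[a, b], continuous f} ->
  {within `[a, b], continuous F} ->
  (forall x, a < x < b -> is_derive x 1 F (f x)) ->
  \int[leb]_(x in `[a, b]) f x = F b - F a.
Proof.
move=> ab cf /(continuous_within_itvP _ ab)[_ Fa Fb] dF.
rewrite /Rintegral (@continuous_FTC2 _ _ F _ _ ab)//.
  split=> // x; rewrite in_itv/= => /dF[dF1 _]; exact: dF1.
by move=> x; rewrite in_itv/= => /dF df; rewrite derive1E derive_val.
Qed.

Lemma Rintegral_support I a b f : measurable I -> `[a, b] `<=` I ->
  (forall x, I x -> ~ `[a, b]%classic x -> f x = 0) ->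
  \int[leb]_(x in I) f x = \int[leb]_(x in `[a, b]) f x.
Proof.
move=> mI sI f0; rewrite Rintegral_mkcond [RHS]Rintegral_mkcond; congr Rintegral.
apply/funext => x; rewrite !patchE; case: ifPn; case: ifPn => //.
- by rewrite notin_setE inE => h1 h2; exact: f0.
- by rewrite notin_setE inE => /sI.
Qed.

(** The primitive is nondecreasing and takes the same value at both ends, so it
    is constant. *)
Lemma continuous_ge0_eq0 f p q : p < q -> {within `[p, q], continuous f} ->
  (forall x, p <= x <= q -> 0 <= f x) -> \int[leb]_(x in `[p, q]) f x = 0 ->
  forall x, p < x < q -> f x = 0.
Proof.
move=> pq cf f0 if0 x /andP[px xq].
pose g t := f (clamp p q t).
have cg : continuous g by exact: continuous_clamp (ltW pq) cf.
have g0 t : 0 <= g t by apply: f0; exact: clamp_itv (ltW pq).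
have p1p : p - 1 < p by rewrite ltrBlDr ltrDl.
pose G := prim (p - 1) g.
have dG (t : R) : p - 1 < t -> is_derive t 1 G (g t) by exact: prim_derive.
have contG a b : p - 1 < a -> {within `[a, b], continuous G}.
  move=> pa; apply: derivable_within_continuous => t; rewrite in_itv/= => /andP[at_ _].
  by apply: ex_derive; apply: dG; exact: lt_le_trans at_.
have Gpq : G q - G p = 0.
  have <- : \int[leb]_(x in `[p, q]) g x = G q - G p.
    apply: RFTC2 => //; [exact: within_cont|exact: contG|].
    by move=> t /andP[pt _]; apply: dG; exact: lt_trans pt.
  rewrite -[RHS]if0; apply: eq_Rintegral => t; rewrite inE/= in_itv/= => tpq.
  by rewrite /g clamp_id.
have incr a b : p <= a -> a <= b -> G a <= G b.
  move=> pa ab; rewrite -lerN2 -subr_ge0 addrC opprK -oppr_le0 opprB.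
  have := @increment_le _ (fun t => - G t) (fun t => - g t) a b 0 ab.
  rewrite mul0r => /(_ _ _ _); rewrite opprK [- G b + _]addrC; apply.
  - by apply: within_contN; apply: contG; exact: lt_le_trans pa.
  - move=> t /andP[at_ _]; apply: is_deriveN1; apply: dG.
    by apply: lt_trans at_; exact: lt_le_trans pa.
  - by move=> t _; rewrite oppr_le0.
have Gc t : p <= t <= q -> G t = G p.
  move=> /andP[pt tq]; apply: le_anti; rewrite (incr p t)// andbT.
  by move/eqP: Gpq; rewrite subr_eq0 => /eqP <-; exact: incr.
have <- : g x = f x by rewrite /g clamp_id ?(ltW px) ?ltW.
have dx : is_derive x 1 G (g x) by apply: dG; exact: lt_trans px.
have h : is_derive x 1 G 0.
  apply: (@near_eq_is_derive _ _ _ (cst (G p))) => //.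
  near=> y; rewrite /= Gc//; apply/andP; split.
    by near: y; exact: lt_le_nbhsr.
  by near: y; exact: lt_le_nbhsl.
by rewrite -(@derive_val _ _ _ _ _ _ _ dx) (@derive_val _ _ _ _ _ _ _ h).
Unshelve. all: by end_near. Qed.

Definition hump p q x : R := Num.max 0 ((x - p) * (q - x)).

Lemma hump_continuous p q : continuous (hump p q).
Proof.
rewrite /hump => x; apply: (@continuous_max _ _ (cst 0) (fun x : R => (x - p) * (q - x))); first exact: cst_continuous.
apply: continuousM; first by apply: continuousB; [exact: cvg_id|exact: cst_continuous].
by apply: continuousB; [exact: cst_continuous|exact: cvg_id].
Qed.

Lemma hump_ge0 p q x : 0 <= hump p q x.
Proof. by rewrite /hump le_max lexx. Qed.

Lemma hump_gt0 p q x : p < x < q -> 0 < hump p q x.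
Proof. by move=> /andP[px xq]; rewrite /hump lt_max mulr_gt0 ?orbT// subr_gt0. Qed.

Lemma hump_eq0 p q x : p <= q -> (x <= p) || (q <= x) -> hump p q x = 0.
Proof. by move=> pq /orP[xp|qx]; rewrite /hump; apply: max_l; nra. Qed.

(** The primitive of a function of mean zero supported in a segment vanishes on
    both sides of the segment, hence is a test function. *)
Lemma test1_of_derivative I p q f : p < q -> `[p, q] `<=` I -> continuous f ->
  (forall x, (x <= p) || (q <= x) -> f x = 0) ->
  \int[leb]_(x in `[p, q]) f x = 0 ->
  exists g, [/\ test1 I g, forall x, is_derive x 1 g (f x) &
    forall x, (x <= p) || (q <= x) -> g x = 0].
Proof.
move=> pq sI cf f0 if0; pose g := prim (p - 1) f.
have p1p : p - 1 < p by rewrite ltrBlDr ltrDl.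
have gl x : x <= p -> g x = 0.
  by move=> xp; apply: prim0 => t /andP[_ tx]; rewrite f0// (le_trans tx).
have dr x : p - 1 < x -> is_derive x 1 g (f x) by exact: prim_derive.
have dg x : is_derive x 1 g (f x).
  have [px|xp] := ltP (p - 1) x; first exact: dr.
  have xp' : x < p by exact: le_lt_trans p1p.
  rewrite f0 ?(ltW xp')//; apply: (@near_eq_is_derive _ _ _ (cst 0)).
  near=> y; rewrite /= gl//.
  by near: y; exact: lt_le_nbhsl.
have cg : continuous g.
  by move=> x; apply: differentiable_continuous; apply/derivable1_diffP; case: (dg x).
have gq : g q = 0.
  have : \int[leb]_(x in `[p, q]) f x = g q - g p.
    by apply: RFTC2 => //; exact: within_cont.
  by rewrite if0 (gl p)// subr0.
have gr x : q <= x -> g x = 0.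
  rewrite le_eqVlt => /predU1P[<-//|qx].
  have : \int[leb]_(t in `[q, x]) f t = g x - g q.
    by apply: RFTC2 => //; exact: within_cont.
  rewrite gq subr0 => <-.
  rewrite (@eq_Rintegral _ _ _ _ _ (cst 0)) ?Rintegral_cst ?mul0r//.
  by move=> t; rewrite inE/= in_itv/= => /andP[qt _]; rewrite f0// qt orbT.
have gout x : (x <= p) || (q <= x) -> g x = 0 by case/orP; [exact: gl|exact: gr].
exists g; split => //; split.
- by move=> x; case: (dg x).
- rewrite (_ : derive1 g = f)//; apply/funext => x.
  by rewrite derive1E; exact: derive_val.
- exists `[p, q]%classic; split => //; first exact: segment_compact.
  move=> x /= /negP; rewrite in_itv/= negb_and -!ltNge => xpq; apply: gout.
  by case/orP: xpq => /ltW ->; rewrite ?orbT.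
Unshelve. all: by end_near. Qed.

(** Let V be a primitive of W. Integrating by parts, U - V is orthogonal to
    every derivative of a test function, that is, to every f of mean zero.
    Taking f = (h - c) times the hump, where h is U - V and c its weighted mean,
    gives that the weighted integral of (h - c)^2 is 0, so U - V is constant. *)
Lemma dubois_reymond I U W p q : measurable I -> p < q -> `[p, q] `<=` I ->
  {within `[p, q], continuous U} -> {within `[p, q], continuous W} ->
  (forall g, test1 I g ->
    \int[leb]_(x in I) (U x * derive1 g x) = - \int[leb]_(x in I) (W x * g x)) ->
  forall x, p < x < q -> is_derive x 1 U (W x).
Proof.
move=> mI pq sI cU cW weak x xpq.
have p1p : p - 1 < p by rewrite ltrBlDr ltrDl.
pose U' t := U (clamp p q t); pose W' t := W (clamp p q t).
have cU' : continuous U' by exact: continuous_clamp (ltW pq) cU.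
have cW' : continuous W' by exact: continuous_clamp (ltW pq) cW.
pose V := prim (p - 1) W'.
have dV t : p - 1 < t -> is_derive t 1 V (W' t) by exact: prim_derive.
have cV : {within `[p, q], continuous V}.
  apply: derivable_within_continuous => t; rewrite in_itv/= => /andP[pt _].
  by case: (dV t (lt_le_trans p1p pt)).
pose V' t := V (clamp p q t).
have cV' : continuous V' by exact: continuous_clamp (ltW pq) cV.
pose h t := U' t - V' t.
have ch : continuous h by exact: contB.
have chi := @hump_continuous p q.
have ihump : 0 < \int[leb]_(t in `[p, q]) hump p q t.
  rewrite lt_neqAle eq_sym Rintegral_ge0 ?andbT; last by move=> *; exact: hump_ge0.
  apply/eqP => i0.
  have := @continuous_ge0_eq0 (hump p q) p q pq (within_cont chi).
  move=> /(_ (fun t _ => hump_ge0 p q t) i0 _ xpq) /eqP.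
  by rewrite gt_eqF// hump_gt0.
(* the constant that gives (h - c) times the hump mean zero *)
pose c := (\int[leb]_(t in `[p, q]) (h t * hump p q t)) /
   \int[leb]_(t in `[p, q]) hump p q t.
pose f t := (h t - c) * hump p q t.
have cf : continuous f.
  by apply: contM => //; apply: contB => //; exact: cont_cst.
have intc k : continuous k -> leb.-integrable `[p, q] (EFin \o k).
  by move=> ck; apply: ccompact_integrable; exact: within_cont.
have chh : continuous (fun t => h t * hump p q t).
  exact: contM.
have cch : continuous (fun t => c * hump p q t).
  by apply: contM => //; exact: cont_cst.
have if0 : \int[leb]_(t in `[p, q]) f t = 0.
  under eq_Rintegral do rewrite /f mulrBl.
  rewrite RintegralB//; [|exact: intc|exact: intc].
  rewrite RintegralZl//; last exact: intc.
  by rewrite /c divfK ?subrr// gt_eqF.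
have f0 t : (t <= p) || (q <= t) -> f t = 0.
  by move=> tpq; rewrite /f hump_eq0 ?mulr0// ltW.
have [g [tg dg g0]] := test1_of_derivative pq sI cf f0 if0.
have cg : continuous g.
  by move=> t; apply: differentiable_continuous; apply/derivable1_diffP; case: (dg t).
have Eg : derive1 g = f by apply/funext => t; rewrite derive1E; exact: derive_val.
have := weak g tg; rewrite Eg.
have out t : ~ `[p, q]%classic t -> (t <= p) || (q <= t).
  move=> /negP; rewrite in_itv/= negb_and -!ltNge.
  by case/orP => /ltW ->; rewrite ?orbT.
rewrite (@Rintegral_support I p q)//; last first.
  by move=> t _ /out /f0 ->; rewrite mulr0.
rewrite (@Rintegral_support I p q)//; last first.
  by move=> t _ /out /g0 ->; rewrite mulr0.
have -> : \int[leb]_(t in `[p, q]) (U t * f t) = \int[leb]_(t in `[p, q]) (U' t * f t).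
  by apply: eq_Rintegral => t; rewrite inE/= in_itv/= => tpq; rewrite /U' clamp_id.
have -> : - (\int[leb]_(t in `[p, q]) (W t * g t)) = \int[leb]_(t in `[p, q]) (V' t * f t).
  have E : \int[leb]_(t in `[p, q]) (W' t * g t + V' t * f t) = 0.
    have -> : 0 = V q * g q - V p * g p.
      by rewrite (g0 q) ?lexx ?orbT// (g0 p) ?lexx// !mulr0 subrr.
    apply: (@RFTC2 _ (fun t => V t * g t)) => //.
    - by apply: within_cont; apply: contD; exact: contM.
    - by apply: within_contM => //; exact: within_cont.
    move=> t /andP[pt tq].
    have dVt := dV t (lt_trans p1p pt); have dgt := dg t.
    have -> : V' t = V t by rewrite /V' clamp_id// !ltW.
    exact: is_deriveM1.
  have cWg : continuous (fun t => W' t * g t).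
    by move=> t; apply: continuousM; [exact: cW'|exact: cg].
  have cVf : continuous (fun t => V' t * f t).
    by move=> t; apply: continuousM; [exact: cV'|exact: cf].
  move: E; rewrite RintegralD//; [|exact: intc|exact: intc].
  move=> /eqP; rewrite addr_eq0 => /eqP E.
  rewrite -[RHS]opprK -E; congr (- _).
  by apply: eq_Rintegral => t; rewrite inE/= in_itv/= => tpq; rewrite /W' clamp_id.
have cUf : continuous (fun t => U' t * f t).
  by move=> t; apply: continuousM; [exact: cU'|exact: cf].
have cVf : continuous (fun t => V' t * f t).
  by move=> t; apply: continuousM; [exact: cV'|exact: cf].
move=> E.
have ihf : \int[leb]_(t in `[p, q]) (h t * f t) = 0.
  under eq_Rintegral do rewrite /h mulrBl.
  rewrite RintegralB//; [|exact: intc|exact: intc].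
  by rewrite E subrr.
have chf : continuous (fun t => h t * f t).
  exact: contM.
have ccf : continuous (fun t => c * f t).
  by apply: contM => //; exact: cont_cst.
have isq : \int[leb]_(t in `[p, q]) ((h t - c) * f t) = 0.
  under eq_Rintegral do rewrite mulrBl.
  rewrite RintegralB//; [|exact: intc|exact: intc].
  by rewrite RintegralZl//; [rewrite ihf if0 mulr0 subrr|exact: intc].
have hc t : p < t < q -> h t = c.
  move=> tpq; have := @continuous_ge0_eq0 (fun t => (h t - c) * f t) p q pq.
  move=> /(_ _ _ isq t tpq) H.
  have : (h t - c) * f t = 0.
    apply: H.
    - apply: within_cont; apply: contM => //.
      by apply: contB => //; exact: cont_cst.
    - by move=> s _; rewrite /f mulrA mulr_ge0 ?hump_ge0// -expr2 sqr_ge0.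
  rewrite /f mulrA => /eqP; rewrite mulf_eq0 (gt_eqF (hump_gt0 tpq)) orbF.
  by rewrite mulf_eq0 orbb subr_eq0 => /eqP.
have /andP[px xq] := xpq.
have dVx : is_derive x 1 V (W x).
  have -> : W x = W' x by rewrite /W' clamp_id// !ltW.
  exact: dV (lt_trans p1p px).
apply: (@near_eq_is_derive _ _ _ (fun t => V t + c)); last first.
  by apply: is_derive_eq; rewrite addr0.
near=> y.
have /andP[py yq] : p < y < q.
  apply/andP; split; near: y; [exact: lt_nbhsr|exact: lt_nbhsl].
have := hc y; rewrite py yq => /(_ isT); rewrite /h /U' /V' clamp_id ?ltW// => <-.
by rewrite addrC subrK.
Unshelve. all: by end_near. Qed.

End variational_calculus.

Section weak_to_classical.
Context {R : realType}.
Local Notation leb := (@lebesgue_measure R).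
Implicit Types (F : solution R) (m r f g : R -> R) (I : set R) (X x : R).

Lemma weak_derivative_parts I (u v : R -> R[i]) g : weak_derivative I u v ->
  test1 I g ->
  \int[leb]_(x in I) (complex.Re (u x) * derive1 g x) =
    - (\int[leb]_(x in I) (complex.Re (v x) * g x)) /\
  \int[leb]_(x in I) (complex.Im (u x) * derive1 g x) =
    - \int[leb]_(x in I) (complex.Im (v x) * g x).
Proof.
move=> uv /uv[h1 h2]; split.
- transitivity (\int[leb]_(x in I) complex.Re (u x * (derive1 g x)%:C)).
    by apply: eq_Rintegral => x _; rewrite ReM /= mulr0 subr0.
  rewrite h1; congr (- _).
  by apply: eq_Rintegral => x _; rewrite ReM /= mulr0 subr0.
- transitivity (\int[leb]_(x in I) complex.Im (u x * (derive1 g x)%:C)).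
    by apply: eq_Rintegral => x _; rewrite ImM /= mulr0 add0r.
  rewrite h2; congr (- _).
  by apply: eq_Rintegral => x _; rewrite ImM /= mulr0 add0r.
Qed.

Lemma ae_imply (P Q : R -> Prop) : (forall x, P x -> Q x) ->
  {ae leb, forall x, P x} -> {ae leb, forall x, Q x}.
Proof. exact: (@filterS _ _ (@ae_filter_ringOfSetsType _ _ _ leb)). Qed.

Lemma ae_eq_Rintegral I f g : measurable I -> measurable_fun I f ->
  measurable_fun I g -> {ae leb, forall x, I x -> f x = g x} ->
  \int[leb]_(x in I) f x = \int[leb]_(x in I) g x.
Proof.
move=> mI mf mg fg; congr fine; apply: ae_eq_integral => //.
- exact/measurable_EFinP.
- exact/measurable_EFinP.
- by apply: ae_imply fg => x fg Ix; rewrite fg.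
Qed.

Lemma open_within_measurable I f : open I -> {within I, continuous f} ->
  measurable_fun I f.
Proof.
move=> oI cf; apply: open_continuous_measurable_fun => //.
by rewrite -continuous_open_subspace.
Qed.

Lemma segment_closure (a b : R) : a < b -> `[a, b] `<=` closure `]a, b[%classic.
Proof.
move=> ab x /=; rewrite in_itv/= => /andP[ax xb] B /nbhs_ballP[e/= e0 hB].
pose t : R := Num.min 1 (e / (b - a)).
have ba : 0 < b - a by rewrite subr_gt0.
have t0 : 0 < t by rewrite /t lt_min ltr01 divr_gt0.
have t1 : t <= 1 by rewrite /t ge_min lexx.
have te : t * (b - a) <= e by rewrite -ler_pdivlMr// /t ge_min lexx orbT.
exists (x + t * ((a + b) / 2 - x)); split.
  by rewrite /= in_itv/=; apply/andP; split; nra.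
apply: hB; rewrite /ball/= opprD addrA subrr add0r normrN normrM gtr0_norm//.
apply: lt_le_trans te; rewrite ltr_pM2l// ltr_norml; apply/andP; split; lra.
Qed.

(** Both weak derivatives of the definition have continuous representatives: p'
    = q / m almost everywhere and q' = - r k p. The du Bois-Reymond lemma
    applied to the four real and imaginary parts makes them classical. *)
Lemma is_solution_exact m r k I F X : open I -> `[0, X] `<=` closure I ->
  `]0, X[ `<=` I -> continuous m -> continuous r -> (forall x, 0 < m x) ->
  is_solution m r k I F -> exact_sol (fun x => (m x)^-1) r k X F.
Proof.
move=> oI sIc sI cm cr m0 [[cpr cpi] [cqr cqi] [v [[_ [mvr mvi _] wpv] qv wq]]].
have mI : measurable I by exact: open_measurable.
have sIc' : I `<=` closure I by exact: subset_closure.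
have mm : measurable_fun I m.
  by apply: measurable_funTS; exact: continuous_measurable_fun.
have cmV : continuous (fun x => (m x)^-1).
  by move=> x; apply: continuousV; [rewrite gt_eqF|exact: cm].
have mmV : measurable_fun I (fun x => (m x)^-1).
  by apply: measurable_funTS; exact: continuous_measurable_fun.
have test_meas g : test1 I g -> measurable_fun I g /\ measurable_fun I (derive1 g).
  move=> [dg cg _]; split; apply: measurable_funTS;
    apply: continuous_measurable_fun => //.
  by move=> x; apply: differentiable_continuous; apply/derivable1_diffP.
have closed_sub f : {within closure I, continuous f} -> {within `[0, X], continuous f}.
  exact: continuous_subspaceW.
have meas f : {within closure I, continuous f} -> measurable_fun I f.
  by move=> cf; apply: open_within_measurable => //; exact: continuous_subspaceW cf.
(* du Bois-Reymond on a compact neighbourhood of x inside I *)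
have dv f f' : {within closure I, continuous f} -> {within closure I, continuous f'} ->
    (forall g, test1 I g -> \int[leb]_(x in I) (f x * derive1 g x) =
      - \int[leb]_(x in I) (f' x * g x)) ->
    forall x, 0 < x < X -> is_derive x 1 f (f' x).
  move=> cf cf' w x /andP[x0 xX].
  have s : `[x / 2, (x + X) / 2] `<=` I.
    apply: subset_trans sI => t /=; rewrite !in_itv/= => /andP[xt tX].
    by apply/andP; split; lra.
  have s' : `[x / 2, (x + X) / 2] `<=` closure I by exact: subset_trans sIc'.
  apply: (@dubois_reymond _ I f f' (x / 2) ((x + X) / 2)) => //; try lra.
  - exact: continuous_subspaceW cf.
  - exact: continuous_subspaceW cf'.
have dvp (fp fv fq : R -> R) : {within closure I, continuous fp} ->
    {within closure I, continuous fq} -> measurable_fun I fv ->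
    {ae leb, forall x, I x -> fq x = m x * fv x} ->
    (forall g, test1 I g -> \int[leb]_(x in I) (fp x * derive1 g x) =
      - \int[leb]_(x in I) (fv x * g x)) ->
    forall x, 0 < x < X -> is_derive x 1 fp ((m x)^-1 * fq x).
  move=> cp cq mv qE w; apply: (dv _ (fun x => (m x)^-1 * _)) => //.
    by apply: within_contM => //; exact: within_cont.
  move=> g tg; rewrite w//; have [mg _] := test_meas g tg; congr (- _).
  apply: ae_eq_Rintegral => //; first exact: measurable_funM.
    by apply: measurable_funM => //; apply: measurable_funM => //; exact: meas.
  by apply: ae_imply qE => y qE /qE ->; rewrite mulKf// gt_eqF.
have dvq (fq fw f : R -> R) : {within closure I, continuous fq} ->
    {within closure I, continuous f} -> measurable_fun I fw ->
    {ae leb, forall x, I x -> fq x = fw x} ->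
    (forall g, test1 I g -> \int[leb]_(x in I) (fw x * derive1 g x) =
      - \int[leb]_(x in I) (f x * g x)) ->
    forall x, 0 < x < X -> is_derive x 1 fq (f x).
  move=> cq cf mw qE w; apply: dv => // g tg; rewrite -w//.
  have [mg mdg] := test_meas g tg; apply: ae_eq_Rintegral => //.
  - by apply: measurable_funM => //; exact: meas.
  - exact: measurable_funM.
  by apply: ae_imply qE => y qE /qE ->.
have [rk1 rk2] : ccontinuous_on (closure I) (fun x => - ((r x)%:C * k * pval F x)).
  rewrite (_ : (fun _ => _) = fun x => -1 * ((r x)%:C * k * pval F x)); last first.
    by apply/funext => y; rewrite mulN1r.
  have crC : ccontinuous_on (closure I) (fun x => (r x)%:C).
    by split; [exact: within_cont|exact: within_cst].
  have cst c := @ccontinuous_cst R (closure I) c.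
  by apply: ccontinuousM => //; apply: ccontinuousM => //; exact: ccontinuousM.
split; [by split; exact: closed_sub|by split; exact: closed_sub|].
move=> x x0X; split; split.
- rewrite ReM /= mul0r subr0.
  apply: (@dvp _ (fun x => complex.Re (v x)) (fun x => complex.Re (pflux F x))) => //.
    by apply: ae_imply qv => y qv /qv ->; rewrite ReM /= mul0r subr0.
  by move=> g tg; have [] := weak_derivative_parts wpv tg.
- rewrite ImM /= mul0r addr0.
  apply: (@dvp _ (fun x => complex.Im (v x)) (fun x => complex.Im (pflux F x))) => //.
    by apply: ae_imply qv => y qv /qv ->; rewrite ImM /= mul0r addr0.
  by move=> g tg; have [] := weak_derivative_parts wpv tg.
- apply: (@dvq _ (fun x => complex.Re ((m x)%:C * v x)) _ _ rk1) => //.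
  + by under eq_fun do rewrite ReM /= mul0r subr0; exact: measurable_funM.
  + by apply: ae_imply qv => y qv /qv ->.
  by move=> g tg; have [] := weak_derivative_parts wq tg.
- apply: (@dvq _ (fun x => complex.Im ((m x)%:C * v x)) _ _ rk2) => //.
  + by under eq_fun do rewrite ImM /= mul0r addr0; exact: measurable_funM.
  + by apply: ae_imply qv => y qv /qv ->.
  by move=> g tg; have [] := weak_derivative_parts wq tg.
Qed.

End weak_to_classical.

Section L2facts.
Context {R : realType} d (T : measurableType d) (mu : {measure set T -> \bar R}).
Implicit Types (D : set T) (f : T -> R[i]).

Lemma L2normE D f :
  L2norm mu D f = ((\int[mu]_(x in D) (nsq (f x))%:E) `^ 2^-1)%E.
Proof.
rewrite /L2norm unlock; congr poweR; rewrite [RHS]integral_mkcond.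
apply: eq_integral => x _; rewrite !patchE; case: ifPn => _.
  by rewrite /= ger0_norm ?modc_ge0// powR_mulrn ?modc_ge0// modc_sqr.
by rewrite /= normr0 powR0// gt_eqF.
Qed.

Lemma L2norm_lty D f : (L2norm mu D f < +oo)%E <->
  (\int[mu]_(x in D) (nsq (f x))%:E < +oo)%E.
Proof.
rewrite L2normE; split; last exact: poweR_lty.
by apply: lty_poweRy; rewrite invr_neq0.
Qed.

Lemma nsq_measurable D f : measurable_fun D (fun x => complex.Re (f x)) ->
  measurable_fun D (fun x => complex.Im (f x)) ->
  measurable_fun D (fun x => nsq (f x)).
Proof. by move=> h1 h2; apply: measurable_funD; apply: measurable_funX. Qed.

End L2facts.

(** * Finite energy on the half line *)

Section halfline.
Context {R : realType}.
Local Notation leb := (@lebesgue_measure R).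
Implicit Types (F G : solution R) (m r A : R -> R) (X x : R) (k c d : R[i]).

(** Square integrability of (p, q) expressed by a bounded function G whose
    derivative dominates |p|^2 + |q|^2: this form is stable under linear
    combinations and shifts, and is used with differential calculus only. *)
Definition finite_energy F : Prop :=
  exists (G G' : R -> R) (B : R), forall x, 0 < x ->
  [/\ is_derive x 1 G (G' x), cauchy_norm F x <= G' x & `|G x| <= B].

Lemma finite_energy_lincomb c F d G : finite_energy F -> finite_energy G ->
  finite_energy (lincomb c F d G).
Proof.
move=> [P [P' [B hP]]] [Q [Q' [C hQ]]].
pose a := 2 * nsq c; pose b := 2 * nsq d.
have a0 : 0 <= a by rewrite mulr_ge0// nsq_ge0.
have b0 : 0 <= b by rewrite mulr_ge0// nsq_ge0.
exists (fun x => a * P x + b * Q x), (fun x => a * P' x + b * Q' x), (a * B + b * C).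
move=> x x0; have [P1 P2 P3] := hP x x0; have [Q1 Q2 Q3] := hQ x x0; split.
- by apply: is_deriveD1; apply: is_deriveZ1.
- apply: (@le_trans _ _ (a * cauchy_norm F x + b * cauchy_norm G x)); last first.
    by rewrite lerD// ler_wpM2l.
  rewrite /cauchy_norm /= /a /b.
  have := nsqD (c * pval F x) (d * pval G x).
  have := nsqD (c * pflux F x) (d * pflux G x).
  by rewrite !nsqM; lra.
- rewrite (le_trans (ler_normD _ _))// lerD// normrM (ger0_norm a0, ger0_norm b0).
    by rewrite ler_wpM2l.
  by rewrite ler_wpM2l.
Qed.

Lemma finite_energy_shift a F : 0 <= a -> finite_energy F -> finite_energy (shift_sol a F).
Proof.
move=> a0 [G [G' [B hG]]]; exists (fun x => G (x + a)), (fun x => G' (x + a)), B.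
move=> x x0; have [h1 h2 h3] := hG (x + a) (ltr_wpDr a0 x0).
by split => //; exact: is_derive_shift.
Qed.

(** The flux does not increase. If it were negative at x, then |p|^2 + |q|^2 >=
    |J| would be bounded below by a positive constant beyond x, and the energy
    would be infinite. *)
Lemma flux_ge0 A r k F : (forall x, 0 < x -> 0 <= r x) -> 0 <= complex.Im k ->
  (forall X, exact_sol A r k X F) -> finite_energy F ->
  forall x, 0 <= x -> 0 <= flux F x.
Proof.
move=> r0 k0 Fsol [G [G' [B hG]]] x x0; rewrite leNgt; apply/negP => Fx.
have decr y : x <= y -> flux F y <= flux F x.
  move=> xy; have yx0 : 0 <= y - x by rewrite subr_ge0.
  have Fs : exact_sol (fun t => A (t + x)) (fun t => r (t + x)) k (y - x) (shift_sol x F).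
    exact: exact_sol_shift.
  have [K K0 HK] : exists2 K, 0 <= K & forall t, 0 < t < y - x ->
      cauchy_norm (shift_sol x F) t <= K ^+ 2.
    have [K K0 HK] := exact_sol_bounded yx0 Fs.
    by exists K => // t /andP[/ltW t0 /ltW ty]; apply: HK; rewrite t0.
  have := flux_increment yx0 (lexx 0) K0 k0 _ HK (exact_approx Fs).
  rewrite mulr0 !mul0r subr_le0 /flux /= add0r subrK; apply.
  by move=> t /andP[t0 _]; apply: r0; rewrite ltr_pwDl.
pose c := - flux F x; have c0 : 0 < c by rewrite oppr_gt0.
have big y : x <= y -> c <= cauchy_norm F y.
  move=> xy; apply: le_trans (flux_le_norm F y).
  by rewrite -normrN (le_trans _ (ler_norm _))// lerN2 decr.
have B0 : 0 <= B by have [_ _ /(le_trans (normr_ge0 _))] := hG 1 ltr01.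
(* on a segment of length l the energy exceeds c l = 2 B + 1, more than the
   oscillation of G *)
pose x1 := x + 1; pose l := (2 * B + 1) / c.
have l0 : 0 <= l by rewrite divr_ge0 ?(ltW c0)// addr_ge0// mulr_ge0.
have x1l : x1 <= x1 + l by rewrite lerDl.
have x10 : 0 < x1 by rewrite /x1 ltr_wpDl.
have : - G (x1 + l) - - G x1 <= - c * (x1 + l - x1).
  apply: (@increment_le _ (fun t => - G t) (fun t => - G' t)) => //.
  - apply: within_contN; apply: derivable_within_continuous => t.
    rewrite in_itv/= => /andP[xt _].
    by have [[]] := hG t (lt_le_trans x10 xt).
  - move=> t /andP[xt _]; have [dG _ _] := hG t (lt_trans x10 xt).
    exact: is_deriveN1.
  - move=> t /andP[xt _]; have [_ h _] := hG t (lt_trans x10 xt).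
    rewrite lerN2; apply: le_trans h; apply: big.
    by apply: le_trans (ltW xt); rewrite lerDl.
have [_ _] := hG x1 x10; rewrite ler_norml => /andP[h1 h2].
have [_ _] := hG (x1 + l) (lt_le_trans x10 x1l); rewrite ler_norml => /andP[h3 h4].
rewrite [x1 + l]addrC addrK [- c * l]mulrC /l mulrN divfK ?gt_eqF//.
move: h3 h4; rewrite [x1 + l]addrC /l; lra.
Qed.

(** A primitive of |p|^2 + |q|^2 is bounded by the integral of |p|^2 + M^2
    |v|^2, where v is the weak derivative of p and M an upper bound of m. *)
Lemma energy_of_H1 m r k F (M : R) : (forall x, 0 < m x <= M) ->
  is_solution m r k `]0, +oo[ F -> finite_energy F.
Proof.
move=> mM [[cpr cpi] [cqr cqi] [v [[[pmr pmi pL] [vmr vmi vL] _] qv _]]].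
rewrite !set_itvoy !closure_gt in cpr cpi cqr cqi.
pose h (t : R) : R := Num.max 0 t.
have ch : continuous h.
  by move=> t; apply: continuous_max; [exact: cst_continuous|exact: cvg_id].
have h0 (t : R) : [set x | 0 <= x] (h t) by rewrite /= /h le_max lexx.
pose g (t : R) := cauchy_norm F (h t).
have cg : continuous g.
  by apply: (continuous_comp_within h0 ch); apply: within_contD;
    apply: within_contD; apply: within_contM.
have g0 (t : R) : 0 <= g t by rewrite addr_ge0// nsq_ge0.
have w0 (t : R) : 0 <= nsq (pval F t) + M ^+ 2 * nsq (v t).
  by rewrite addr_ge0 ?nsq_ge0// mulr_ge0 ?nsq_ge0// sqr_ge0.
pose E := (\int[leb]_(x in `]0%R, +oo[) (nsq (pval F x) + M ^+ 2 * nsq (v x))%:E)%E.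
have E0 : (0 <= E)%E.
  by apply: integral_ge0 => x _; rewrite lee_fin w0.
have mI : measurable (`]0%R, +oo[%classic : set R) by exact: measurable_itv.
have mp := nsq_measurable pmr pmi; have mv := nsq_measurable vmr vmi.
have Efin : (E < +oo)%E.
  rewrite /E; under eq_integral do rewrite EFinD EFinM.
  rewrite ge0_integralD//=; last 4 first.
  - by move=> x _; rewrite lee_fin nsq_ge0.
  - exact/measurable_EFinP.
  - by move=> x _; rewrite mule_ge0 ?lee_fin ?nsq_ge0// sqr_ge0.
  - by apply/measurable_EFinP; apply: measurable_funM.
  apply: lte_add_pinfty; first exact/L2norm_lty.
  rewrite ge0_integralZl//; last 3 first.
  - exact/measurable_EFinP.
  - by move=> x _; rewrite lee_fin nsq_ge0.
  - by rewrite lee_fin sqr_ge0.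
  by apply: lte_mul_pinfty => //; [rewrite lee_fin sqr_ge0|exact/L2norm_lty].
exists (prim 0 g), g, (fine E) => x x0; split.
- exact: prim_derive.
- by rewrite /g /h max_r// ltW.
rewrite ger0_norm; last by apply: Rintegral_ge0 => *; exact: g0.
have sub : `]0, x] `<=` `]0%R, +oo[%classic.
  by move=> t /=; rewrite !in_itv/= andbT => /andP[].
have bound : (\int[leb]_(t in `[0%R, x]) (g t)%:E <= E)%E.
  rewrite -integral_itv_obnd_cbnd; last first.
    apply: measurable_funTS.
    by apply/measurable_EFinP; exact: continuous_measurable_fun.
  rewrite /E; apply: (@le_trans _ _ (\int[leb]_(t in `]0%R, x])
      (nsq (pval F t) + M ^+ 2 * nsq (v t))%:E)%E); last first.
    apply: ge0_subset_integral => //.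
    - by apply/measurable_EFinP; apply: measurable_funD => //; exact: measurable_funM.
    - by move=> t _; rewrite lee_fin w0.
  apply: ae_ge0_le_integral => //.
  - by move=> t _; rewrite lee_fin g0.
  - apply/measurable_EFinP; apply: measurable_funTS.
    exact: continuous_measurable_fun.
  - by move=> t _; rewrite lee_fin w0.
  - apply/measurable_EFinP; apply: (measurable_funS _ sub) => //.
    by apply: measurable_funD => //; exact: measurable_funM.
  apply: ae_imply qv => t qv; rewrite /= in_itv/= => /andP[t0 _].
  rewrite lee_fin /g /h max_r ?(ltW t0)// lerD2l qv ?nsqM; last by rewrite /= in_itv/= t0.
  rewrite ler_wpM2r ?nsq_ge0// /nsq /= expr0n addr0 ler_sqr ?nnegrE.
  - by have /andP[] := mM t.
  - by have /andP[/ltW] := mM t.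
  - by have /andP[/ltW h1 /(le_trans h1)] := mM t.
apply: fine_le => //.
- rewrite ge0_fin_numE; first exact: le_lt_trans Efin.
  by apply: integral_ge0 => t _; rewrite lee_fin g0.
- by rewrite ge0_fin_numE.
Qed.

End halfline.

(** * Periodic functions *)

Section periodic.
Context {R : realType}.

Lemma periodicZ {T} (f : R -> T) : (forall x, f (x + 1) = f x) ->
  forall (n : int) x, f (x + n%:~R) = f x.
Proof.
move=> fper.
have fn (n : nat) x : f (x + n%:R) = f x.
  elim: n x => [|n IH] x; first by rewrite addr0.
  by rewrite -natr1 addrA fper.
move=> [n|n] x; first by rewrite -pmulrn fn.
by rewrite NegzE mulrNz -pmulrn -(fn n.+1) subrK.
Qed.

Lemma fract01 (x : R) : 0 <= x + (- Num.floor x)%:~R <= 1.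
Proof.
rewrite mulrNz; have /andP[h1 h2] := mem_rg1_floor x.
by apply/andP; split; lra.
Qed.

Lemma periodic_min (f : R -> R) : continuous f -> (forall x, f (x + 1) = f x) ->
  exists c, forall x, f c <= f x.
Proof.
move=> cf fper; have [c _ hc] := EVT_min (@ler01 R) (within_cont cf (D := `[0, 1])).
exists c => x; rewrite -(periodicZ fper (- Num.floor x) x); apply: hc.
by rewrite in_itv/= fract01.
Qed.

Lemma periodic_max (f : R -> R) : continuous f -> (forall x, f (x + 1) = f x) ->
  exists c, forall x, f x <= f c.
Proof.
move=> cf fper; have [c _ hc] := EVT_max (@ler01 R) (within_cont cf (D := `[0, 1])).
exists c => x; rewrite -(periodicZ fper (- Num.floor x) x); apply: hc.
by rewrite in_itv/= fract01.
Qed.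

Lemma cper_bounded (f : R -> R[i]) : ccontinuous_on setT f -> periodic1 f ->
  exists2 B, 0 <= B & forall s, nsq (f s) <= B.
Proof.
move=> /ccont_nsq cn fper.
have nper x : nsq (f (x + 1)) = nsq (f x) by rewrite fper.
have [a ha] := periodic_max cn nper.
by exists (nsq (f a)) => //; exact: nsq_ge0.
Qed.

Lemma Nper_bounds (f : R -> R[i]) : Nper f ->
  exists2 C, 0 <= C & forall a b, nsq (f a / f b) <= C.
Proof.
move=> [/ccont_nsq cn fper fn0].
have nper x : nsq (f (x + 1)) = nsq (f x) by rewrite fper.
have [a ha] := periodic_max cn nper; have [b hb] := periodic_min cn nper.
exists (nsq (f a) / nsq (f b)); first by rewrite divr_ge0// nsq_ge0.
have b0 t : 0 < nsq (f t).
  rewrite lt_neqAle nsq_ge0 andbT eq_sym; apply/eqP => /nsq_eq0 /eqP.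
  by rewrite (negbTE (fn0 t)).
move=> s t; rewrite nsq_div//.
by rewrite ler_pM ?nsq_ge0 ?invr_ge0 ?nsq_ge0// lef_pV2 ?posrE.
Qed.

Lemma periodic2_bounded (f : R * R -> R) : continuous f ->
  (forall y1 y2, f (y1 + 1, y2) = f (y1, y2) /\ f (y1, y2 + 1) = f (y1, y2)) ->
  exists B, forall y, f y <= B.
Proof.
move=> cf fper.
have K : compact ((`[0, 1]%classic : set R) `*` (`[0, 1]%classic : set R)).
  by apply: compact_setX; exact: segment_compact.
have K0 : ((`[0, 1]%classic : set R) `*` (`[0, 1]%classic : set R)) !=set0.
  by exists (0, 0) => /=; split; rewrite /= in_itv/= lexx ler01.
have [[c1 c2] _ hc] := compact_EVT_max K0 K (continuous_subspaceT cf).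
exists (f (c1, c2)) => -[y1 y2].
rewrite -(periodicZ (fun x => proj1 (fper x y2)) (- Num.floor y1) y1).
rewrite -(periodicZ (fun x => proj2 (fper _ x)) (- Num.floor y2) y2).
by apply: hc; rewrite inE/=; split; rewrite in_itv/= fract01.
Qed.

(** The segment is compact, hence continuity at the points of {s0} x [0, X] is
    uniform. *)
Lemma continuous_unif_segment (f : R * R -> R) : continuous f ->
  forall (X s0 e : R), 0 < e ->
  \forall s \near s0, forall x, 0 <= x <= X -> `|f (s, x) - f (s0, x)| < e.
Proof.
move=> cf X s0 e e0.
have /compact_near_coveringP K : compact (`[0, X]%classic : set R) by exact: segment_compact.
have := K R (nbhs s0) (fun s x => `|f (s, x) - f (s0, x)| < e).
have F : Filter (nbhs s0) by exact: nbhs_filter.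
move=> /(_ F) H.
have {}H : \forall s \near s0, `[0, X]%classic `<=` (fun x => `|f (s, x) - f (s0, x)| < e).
  apply: H => x _.
  have e20 : 0 < e / 2 by rewrite divr_gt0.
  have h1 : \forall y \near (s0, x), `|f (s0, x) - f y| < e / 2.
    by move/cvgrPdist_lt : (cf (s0, x)) => /(_ _ e20).
  have [[U V] [/= nU nV] UV] := h1.
  exists (V, U); first by split.
  move=> [x' s] [/= Vx Us].
  have := UV (s, x') (conj Us Vx); have := UV (s0, x') (conj (nbhs_singleton nU) Vx).
  move=> /= h2 h3; rewrite -(subrKA (f (s0, x))) (le_lt_trans (ler_normD _ _))//.
  by rewrite (splitr e) ltrD// distrC.
apply: filterS H => s H x xX; apply: H.
by rewrite /= in_itv.
Qed.

(** The periods of f form a group. Either it contains arbitrarily small positive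
    elements, and f is constant by continuity, or it is generated by its least
    positive element, which would make d rational. *)
Lemma two_periods_constant (f : R -> R) (d : R) : continuous f ->
  (forall x, f (x + 1) = f x) -> (forall x, f (x + d) = f x) -> irrational d ->
  forall x, f x = f 0.
Proof.
move=> cf f1 fd dirr.
pose per (p : R) := forall x, f (x + p) = f x.
have perZ (p : R) (n : int) : per p -> per (n%:~R * p).
  move=> hp x; have := @periodicZ _ (fun t => f (x + t * p)) _ n 0.
  rewrite add0r mul0r addr0; apply => t.
  by rewrite mulrDl mul1r addrA hp.
have perB (p q : R) : per p -> per q -> per (p - q).
  by move=> hp hq x; rewrite -(hq (x + (p - q))) addrA subrK hp.
have perM (p q : R) : per p -> 0 < p -> per q ->
    exists n : int, per (q - n%:~R * p) /\ 0 <= q - n%:~R * p < p.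
  move=> hp p0 hq; exists (Num.floor (q / p)); split; first by apply: perB => //; exact: perZ.
  have /andP[h1 h2] := mem_rg1_floor (q / p).
  move: h1 h2; rewrite ler_pdivlMr// ltr_pdivrMr// => h1 h2.
  by apply/andP; split; [rewrite subr_ge0|move: h2; rewrite mulrDl mul1r; lra].
have small (h : R) : 0 < h -> exists p, [/\ per p, 0 < p & p < h].
  move=> h0; apply: contrapT => noh.
  pose E := [set p : R | per p /\ 0 < p].
  have lbE : lbound E h.
    by move=> p [hp p0]; rewrite leNgt; apply/negP => ph; apply: noh; exists p.
  have E1 : E 1 by split.
  have infE : has_inf E by split; [exists 1|exists h].
  have gh : h <= inf E by apply: lb_le_inf => //; exists 1.
  have lbg p : E p -> inf E <= p by move=> Ep; apply: ge_inf => //; exists h.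
  have [p1 [hp1 p10] p1g] := inf_adherent h0 infE.
  (* otherwise two periods in ]inf E, inf E + h[ would differ by a positive
     period below h *)
  have g_per : inf E = p1.
    apply/eqP; rewrite eq_le lbg//= leNgt; apply/negP => gp1.
    have [p2 [hp2 p20] p2p] : exists2 e, E e & e < inf E + (p1 - inf E).
      by apply: inf_adherent => //; rewrite subr_gt0.
    have : E (p1 - p2).
      by split; [exact: perB|rewrite subr_gt0; move: p2p; lra].
    by move=> /lbE; have := lbg p2 (conj hp2 p20); lra.
  have mult q : per q -> exists n : int, q = n%:~R * p1.
    move=> hq; have [n [hn /andP[n0 n1]]] := perM p1 q hp1 p10 hq; exists n.
    apply/eqP; rewrite -subr_eq0; apply/eqP; apply: contrapT => /eqP nz.
    have : E (q - n%:~R * p1) by split => //; rewrite lt_neqAle eq_sym nz.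
    by move=> /lbg; rewrite g_per leNgt n1.
  have [k kE] := mult 1 f1; have [l lE] := mult d fd.
  have k0 : k%:~R != 0 :> R.
    by apply/eqP => k0; move: kE; rewrite k0 mul0r => /eqP; rewrite oner_eq0.
  apply: dirr; exists (l%:~R / k%:~R) => //.
  rewrite fmorph_div/= !ratr_int lE.
  have -> : p1 = k%:~R^-1 by apply: (mulfI k0); rewrite -kE mulfV.
  by [].
move=> x; apply/eqP; rewrite -subr_eq0 -normr_le0; apply/ler_addgt0Pl => h h0.
rewrite addr0; have /cvgrPdist_lt /(_ _ h0) /nbhs_ballP[r /= r0 hr] := cf 0.
have [p [hp p0 pr]] := small r r0.
pose n := Num.floor (x / p).
have -> : f x = f (x - n%:~R * p) by rewrite -(perZ p n hp (x - n%:~R * p)) subrK.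
rewrite distrC; apply: ltW; apply: hr.
have /andP[h1 h2] := mem_rg1_floor (x / p).
move: h1 h2; rewrite ler_pdivlMr// ltr_pdivrMr// mulrDl mul1r -/n => h1 h2.
by rewrite /ball/= sub0r normrN ger0_norm; lra.
Qed.

End periodic.

(** * Integration in sheared coordinates *)

Section translation.
Context {R : realType}.
Local Notation leb := (@lebesgue_measure R).

Lemma measurable_translation (c : R) : measurable_fun [set: R] (fun x : R => x + c).
Proof. by apply: continuous_measurable_fun; exact: continuous_shift. Qed.

(** The translated measure agrees with Lebesgue measure on half-open intervals,
    which characterize it. *)
Lemma lebesgue_measure_translation (c : R) (A : set R) : measurable A ->
  leb ((fun x => x + c) @^-1` A) = leb A.
Proof.
move=> mA; have mt := measurable_translation c.
pose m := pushforward leb (fun x : measurableTypeR R => (x + c : measurableTypeR R)).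
have h (X : set R) : ocitv X -> leb X = m X.
  move=> [[a b] _ <-]; rewrite /m /pushforward /=.
  rewrite (_ : _ @^-1` _ = `]a - c, b - c]%classic); last first.
    by apply/seteqP; split => x /=; rewrite !in_itv/= ltrBlDr lerBrDr.
  rewrite !lebesgue_measure_itv/= !lte_fin ltrD2r.
  by case: ifPn => // _; rewrite -!EFinB; congr EFin; ring.
exact: esym (@lebesgue_measure_unique R m h A mA).
Qed.

Lemma ge0_integral_translation (f : R -> \bar R) (c : R) :
  measurable_fun setT f -> (forall x, (0 <= f x)%E) ->
  (\int[leb]_x f (x + c)%R = \int[leb]_x f x)%E.
Proof.
move=> mf f0.
have mt : measurable_fun [set: measurableTypeR R]
  (fun x : measurableTypeR R => (x + c)%R : measurableTypeR R).
  exact: measurable_translation.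
have := @ge0_integral_pushforward _ _ (measurableTypeR R) (measurableTypeR R) R _ mt
  leb setT f measurableT mf (fun x _ => f0 x).
rewrite preimage_setT => <-.
by apply: eq_measure_integral => A mA _; exact: lebesgue_measure_translation.
Qed.

Lemma integral_translation (f : R -> \bar R) (c : R) : measurable_fun setT f ->
  (\int[leb]_x f (x + c)%R = \int[leb]_x f x)%E.
Proof.
move=> mf; rewrite [LHS]integralE [RHS]integralE; congr (_ - _)%E.
- rewrite -(ge0_integral_translation c (measurable_funepos mf) (funepos_ge0 f)).
  by apply: eq_integral => x _; rewrite unlock.
- rewrite -(ge0_integral_translation c (measurable_funeneg mf) (funeneg_ge0 f)).
  by apply: eq_integral => x _; rewrite unlock.
Qed.

End translation.

Section plane.
Context {R : realType}.
Local Notation leb := (@lebesgue_measure R).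
Local Notation leb2 := (@lebesgue_measure R \x @lebesgue_measure R)%E.

(** The sigma-algebra of the plane is the product one; an open set is the union
    of the countably many rational boxes that it contains. *)
Lemma open_measurable_plane (O : set (R * R)) : open O -> measurable O.
Proof.
move=> oO; pose box (q : rat * rat * (rat * rat)) : set (R * R) :=
  `]ratr q.1.1, ratr q.1.2[%classic `*` `]ratr q.2.1, ratr q.2.2[%classic.
have -> : O = \bigcup_q (if `[< box q `<=` O >] then box q else set0).
  apply/seteqP; split => [[x y] Oxy|z [q _]]; last first.
    by case: ifPn => // /asboolP; exact.
  have [[U V] [/= /nbhs_ballP[d1 /= d10 B1] /nbhs_ballP[d2 /= d20 B2]] UV] := oO _ Oxy.
  have near_rat (t e : R) : 0 < e -> exists q : rat * rat,
      ratr q.1 < t < ratr q.2 /\ forall w : R, ratr q.1 < w < ratr q.2 -> ball t e w.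
    move=> e0.
    have [q1] : exists q : rat, ratr q \in `]t - e, t[ by apply: rat_in_itvoo; rewrite ltrBlDr ltrDl.
    rewrite in_itv/= => /andP[h1 h2].
    have [q2] : exists q : rat, ratr q \in `]t, t + e[ by apply: rat_in_itvoo; rewrite ltrDl.
    rewrite in_itv/= => /andP[h3 h4].
    exists (q1, q2); split; first by rewrite /= h2.
    move=> w /= /andP[h5 h6]; rewrite /ball/= ltr_norml; apply/andP; split; lra.
  have [q1 [xq1 w1]] := near_rat x d1 d10; have [q2 [yq2 w2]] := near_rat y d2 d20.
  exists (q1, q2) => //.
  rewrite asboolT; first by split; rewrite /= in_itv.
  move=> [a b] [/=]; rewrite !in_itv/= => aq bq; apply: UV; split => /=.
    by apply: B1; exact: w1.
  by apply: B2; exact: w2.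
apply: countable_bigcupT_measurable => // q; case: ifPn => // _.
by apply: measurableX; exact: measurable_itv.
Qed.

Lemma continuous_measurable_plane (f : R * R -> R) : continuous f ->
  measurable_fun setT f.
Proof.
move=> /continuousP cf; apply: (measurability _ (RGenOpens.measurableE R)).
move=> _ [_ [a [b ->] <-]]; rewrite setTI; apply: open_measurable_plane.
exact/cf/interval_open.
Qed.

(** Sends (s, y2) to the point of height y2 on the line through (s, 0) directed
    by (d, 1). *)
Definition shear (d : R) (y : R * R) : R * R := (y.1 + d * y.2, y.2).

Lemma measurable_shear d : measurable_fun setT (shear d).
Proof.
apply/measurable_fun_pairP; split => /=.
  rewrite /comp /=; apply: measurable_funD; first exact: measurable_fst.
  by apply: measurable_funM => //; exact: measurable_snd.
by rewrite /comp /=; exact: measurable_snd.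
Qed.

(** On each horizontal line the shear is a translation; conclude by Tonelli. *)
Lemma ge0_integral_shear d (h : R * R -> \bar R) : measurable_fun setT h ->
  (forall y, (0 <= h y)%E) ->
  (\int[leb2]_y h (shear d y) = \int[leb2]_y h y)%E.
Proof.
move=> mh h0; have mhs : measurable_fun setT (h \o shear d).
  by apply: measurableT_comp => //; exact: measurable_shear.
rewrite (@fubini_tonelli2 _ _ _ _ _ leb leb (h \o shear d) mhs (fun y => h0 _)).
rewrite (@fubini_tonelli2 _ _ _ _ _ leb leb h mh h0).
apply: eq_integral => y _; rewrite /fubini_G /shear /=.
apply: (@ge0_integral_translation _ (fun x => h (x, y)) (d * y)) => //.
exact: measurable_fun_pair1.
Qed.

Lemma integral_shear d (h : R * R -> \bar R) : leb2.-integrable setT h ->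
  leb2.-integrable setT (h \o shear d) /\
  (\int[leb2]_y h y = \int[leb]_s \int[leb]_y h (shear d (s, y)))%E.
Proof.
move=> ih; have /integrableP[mh hfin] := ih.
have mhs : measurable_fun setT (h \o shear d).
  by apply: measurableT_comp => //; exact: measurable_shear.
have ihs : leb2.-integrable setT (h \o shear d).
  apply/integrableP; split => //.
  rewrite (@ge0_integral_shear d (abse \o h))//; first exact: measurableT_comp.
  by move=> y; exact: abse_ge0.
split => //.
rewrite -(@integral21_prod_meas1 _ _ _ _ _ leb leb h ih).
rewrite -[RHS]/(\int[leb]_s fubini_F leb (h \o shear d) s)%E.
rewrite (@integral12_prod_meas1 _ _ _ _ _ leb leb _ ihs).
rewrite -(@integral21_prod_meas1 _ _ _ _ _ leb leb _ ihs).
apply: eq_integral => y _; rewrite /fubini_G /shear /=.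
apply: esym; apply: (@integral_translation _ (fun x => h (x, y)) (d * y)) => //.
exact: measurable_fun_pair1.
Qed.

(** Seen from the characteristic lines, a bounded piece of the strip only
    involves values of s in a bounded interval. *)
Lemma strip_integral_lty d (p q : R) (w : R -> R) : measurable_fun setT w ->
  (forall s, 0 <= w s) ->
  (forall a b : R, (\int[leb]_(s in `]a, b[) (w s)%:E < +oo)%E) ->
  (\int[leb2]_(y in `]0%R, 1%R[ `*` `]p, q[) (w (y.1 - d * y.2)%R)%:E < +oo)%E.
Proof.
(* |s| < S on the strip, since s = y1 - d y2 *)
move=> mw w0 wfin; pose S := 1 + `|d| * (`|p| + `|q|).
pose O : set (R * R) := `]0%R, 1%R[ `*` `]p, q[.
have mO : measurable O by apply: measurableX; exact: measurable_itv.
pose f (y : R * R) : \bar R := (w (y.1 - d * y.2) * \1_O y)%:E.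
have mf : measurable_fun setT f.
  apply/measurable_EFinP; apply: measurable_funM; last exact: measurable_indic.
  apply: measurableT_comp => //; apply: measurable_funB; first exact: measurable_fst.
  by apply: measurable_funM => //; exact: measurable_snd.
have f0 y : (0 <= f y)%E by rewrite lee_fin mulr_ge0// indicE.
have -> : (\int[leb2]_(y in O) (w (y.1 - d * y.2)%R)%:E = \int[leb2]_y f y)%E.
  rewrite integral_mkcond; apply: eq_integral => y _; rewrite patchE /f indicE.
  by case: ifPn => _; rewrite ?mulr1 ?mulr0.
rewrite -(ge0_integral_shear d mf f0).
pose k (y : R * R) : \bar R := ((w y.1 * \1_(`]- S, S[%classic : set R) y.1) * \1_(`]p, q[%classic : set R) y.2)%:E.
have mi (a b : R) : measurable (`]a, b[%classic : set R) by exact: measurable_itv.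
have mk1 : measurable_fun setT (fun s : R => w s * \1_(`]- S, S[%classic : set R) s).
  by apply: measurable_funM => //; exact: measurable_indic.
have mk : measurable_fun setT k.
  apply/measurable_EFinP; apply: measurable_funM.
    by apply: (measurableT_comp mk1); exact: measurable_fst.
  apply: measurableT_comp; last exact: measurable_snd.
  exact: measurable_indic.
have k0 y : (0 <= k y)%E by rewrite lee_fin !mulr_ge0// indicE.
apply: (@le_lt_trans _ _ (\int[leb2]_y k y)%E).
  apply: ge0_le_integral => //.
    by apply: measurableT_comp => //; exact: measurable_shear.
  move=> [s y] _; rewrite /f /k /shear /= addrK lee_fin -mulrA ler_wpM2l//.
  rewrite !indicE; case: (boolP ((s + d * y, y) \in O)) => [|_]; last by rewrite mulr_ge0.
  rewrite inE => -[/=]; rewrite !in_itv/= => /andP[h1 h2] /andP[h3 h4].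
  rewrite [X in _ <= X * _](_ : _ = 1); last first.
    rewrite mem_set//= in_itv/=.
    have dy : `|d * y| <= `|d| * (`|p| + `|q|).
      rewrite normrM ler_wpM2l// ler_norml.
      have := ler_norm q; have := ler_norm (- p); rewrite normrN.
      by have := normr_ge0 p; have := normr_ge0 q; lra.
    by move: dy; rewrite ler_norml /S => /andP[? ?]; apply/andP; split; lra.
  by rewrite mem_set ?mulr1//= in_itv/= h3.
rewrite (@fubini_tonelli2 _ _ _ _ _ leb leb k mk k0) /fubini_G /k /=.
pose c := (\int[leb]_(s in `](- S)%R, S[) (w s)%:E)%E.
have c0 : (0 <= c)%E by apply: integral_ge0 => s _; rewrite lee_fin.
have -> : (fun y : R => \int[leb]_s (w s * \1_(`](- S)%R, S[%classic : set R) s * \1_(`]p, q[%classic : set R) y)%:E)%E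
    = (fun y : R => c * (\1_(`]p, q[%classic : set R) y)%:E)%E.
  apply/funext => y; under eq_integral do rewrite EFinM.
  rewrite ge0_integralZr//; last 2 first.
  - by apply/measurable_EFinP; exact: mk1.
  - by move=> s _; rewrite lee_fin mulr_ge0// indicE.
  congr (_ * _)%E; rewrite /c [RHS]integral_mkcond; apply: eq_integral => s _.
  by rewrite patchE indicE; case: ifPn => _; rewrite ?mulr1 ?mulr0.
rewrite ge0_integralZl//; last first.
  by apply/measurable_EFinP; exact: measurable_indic.
apply: lte_mul_pinfty => //; first by rewrite ge0_fin_numE//; exact: wfin.
rewrite integral_indic// setIT.
suff : (leb `]p, q[ < +oo)%E by [].
rewrite lebesgue_measure_itv/=.
by case: ifPn => _; rewrite ?ltry.
Qed.

End plane.

(** * The weak derivative along the characteristic lines *)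

Section chain.
Context {R : realType}.
Implicit Types (g : R * R -> R).

Lemma mean_value_between (f df : R -> R) (a b : R) :
  (forall x : R, is_derive x 1 f (df x)) ->
  exists2 c, `|c - a| <= `|b - a| & f b - f a = df c * (b - a).
Proof.
move=> hf; have cf D : {within D, continuous f}.
  apply: within_cont => x; apply: differentiable_continuous.
  by apply/derivable1_diffP; case: (hf x).
have [ab|ba|->] := ltgtP a b; last first.
- by exists b; rewrite ?lexx// !subrr mulr0.
- have [c] := MVT ba (fun x _ => hf x) (cf _).
  rewrite in_itv/= => /andP[bc ca] E; exists c.
    by rewrite !ler0_norm ?subr_le0 ?ltW//; lra.
  by apply: oppr_inj; rewrite opprB E; ring.
- have [c] := MVT ab (fun x _ => hf x) (cf _).
  rewrite in_itv/= => /andP[bc ca] E; exists c => //.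
  by rewrite !ger0_norm ?subr_ge0 ?ltW//; lra.
Qed.

Lemma partial1 g (a b : R) : derivable g (a, b) ((1, 0) : R * R) ->
  is_derive a 1 (fun t => g (t, b)) ('D_((1, 0) : R * R) g (a, b)).
Proof.
move=> dg.
have E : (fun h : R => h^-1 *: (((fun t => g (t, b)) \o shift a) (h *: (1 : R)) - g (a, b))) =
   (fun h : R => h^-1 *: ((g \o shift (a, b)) (h *: ((1, 0) : R * R)) - g (a, b))).
  apply/funext => h; rewrite /shift /=; congr (_ *: (g _ - _)).
  by congr (_, _) => /=; rewrite /GRing.scale/= ?mulr0 ?add0r.
split; first by rewrite /derivable E.
by rewrite /derive E.
Qed.

Lemma partial2 g (a b : R) : derivable g (a, b) ((0, 1) : R * R) ->
  is_derive b 1 (fun t => g (a, t)) ('D_((0, 1) : R * R) g (a, b)).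
Proof.
move=> dg.
have E : (fun h : R => h^-1 *: (((fun t => g (a, t)) \o shift b) (h *: (1 : R)) - g (a, b))) =
   (fun h : R => h^-1 *: ((g \o shift (a, b)) (h *: ((0, 1) : R * R)) - g (a, b))).
  apply/funext => h; rewrite /shift /=; congr (_ *: (g _ - _)).
  by congr (_, _) => /=; rewrite /GRing.scale/= ?mulr0 ?add0r.
split; first by rewrite /derivable E.
by rewrite /derive E.
Qed.

(** The chain rule for a function with continuous partial derivatives: the
    increment along the line is split into a horizontal and a vertical one, and
    the mean value theorem is applied to each. *)
Lemma derive_along_line g (d s y : R) : Ck 1 g ->
  is_derive y 1 (fun t => g (s + d * t, t))
   (d * 'D_((1, 0) : R * R) g (s + d * y, y) + 'D_((0, 1) : R * R) g (s + d * y, y)).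
Proof.
move=> [cg [d1 d2 [cd1 _] [cd2 _]]].
pose g1 := 'D_((1, 0) : R * R) g; pose g2 := 'D_((0, 1) : R * R) g.
pose x := s + d * y; rewrite -/x.
pose f := (fun t => g (s + d * t, t)); rewrite -/f.
suff lim : h^-1 *: ((f \o shift y) (h *: (1 : R)) - f y) @[h --> 0^'] -->
    d * g1 (x, y) + g2 (x, y).
  split; first by apply/cvg_ex; eexists; exact: lim.
  exact: cvg_lim lim.
apply/cvgrPdist_lt => e e0.
pose e' := e / (`|d| + 2).
have dd : 0 < `|d| + 2 by rewrite ltr_wpDl.
have e'0 : 0 < e' by rewrite divr_gt0.
have h1 : \forall p \near (x, y), `|g1 (x, y) - g1 p| < e'.
  by move/cvgrPdist_lt : (cd1 (x, y)) => /(_ _ e'0).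
have h2 : \forall p \near (x, y), `|g2 (x, y) - g2 p| < e'.
  by move/cvgrPdist_lt : (cd2 (x, y)) => /(_ _ e'0).
have [r /= r0 hr] : exists2 r : R, 0 < r & forall a b : R, `|a - x| < r -> `|b - y| < r ->
    `|g1 (x, y) - g1 (a, b)| < e' /\ `|g2 (x, y) - g2 (a, b)| < e'.
  have [[U V] [/= /nbhs_ballP[r1 /= r10 B1] /nbhs_ballP[r2 /= r20 B2]] UV] := filterI h1 h2.
  exists (Num.min r1 r2); first by rewrite lt_min r10.
  move=> a b; rewrite !lt_min => /andP[ha _] /andP[_ hb].
  by apply: (UV (a, b)); split; [apply: B1|apply: B2]; rewrite /ball/= distrC.
(* increments smaller than k keep both mean value points within distance r of
   (x, y) *)
pose k := r / (`|d| + 1).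
have d1' : 0 < `|d| + 1 by rewrite ltr_wpDl.
have k0 : 0 < k by rewrite divr_gt0.
have kr : k <= r by rewrite ler_pdivrMr// ler_peMr ?(ltW r0)// lerDr.
have dkr (h : R) : `|h| < k -> `|d * h| < r.
  move=> hk; rewrite normrM; apply: (@le_lt_trans _ _ ((`|d| + 1) * `|h|)).
    by rewrite ler_wpM2r// lerDl.
  by rewrite mulrC -ltr_pdivlMr.
near=> h.
have h0 : h != 0 by near: h; exact: nbhs_dnbhs_neq.
have hk : `|h| < k.
  near: h; apply: nbhs_dnbhs; have := @nbhs0_lt R R k k0; exact.
rewrite /f /shift/= /GRing.scale/= mulr1.
have [c1 c1h E1] := @mean_value_between (fun t => g (t, h + y)) (fun t => g1 (t, h + y)) x (s + d * (h + y))
  (fun t => partial1 (d1 _)).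
have [c2 c2h E2] := @mean_value_between (fun t => g (x, t)) (fun t => g2 (x, t)) y (h + y)
  (fun t => partial2 (d2 _)).
have xh : s + d * (h + y) - x = d * h by rewrite /x; ring.
rewrite xh in c1h E1; rewrite addrK in c2h E2.
have -> : h^-1 * (g (s + d * (h + y), h + y) - g (s + d * y, y)) =
    d * g1 (c1, h + y) + g2 (x, c2).
  have -> : g (s + d * (h + y), h + y) - g (s + d * y, y) =
    (g (s + d * (h + y), h + y) - g (x, h + y)) + (g (x, h + y) - g (x, y)) by rewrite -/x; ring.
  by rewrite E1 E2; field.
have [b1 _] : `|g1 (x, y) - g1 (c1, h + y)| < e' /\ `|g2 (x, y) - g2 (c1, h + y)| < e'.
  apply: hr; first by apply: le_lt_trans c1h (dkr _ hk).
  by rewrite addrK (lt_le_trans hk).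
have [_ b2] : `|g1 (x, y) - g1 (x, c2)| < e' /\ `|g2 (x, y) - g2 (x, c2)| < e'.
  apply: hr; first by rewrite subrr normr0.
  by rewrite (le_lt_trans c2h)// (lt_le_trans hk).
have -> : d * g1 (x, y) + g2 (x, y) - (d * g1 (c1, h + y) + g2 (x, c2)) =
  d * (g1 (x, y) - g1 (c1, h + y)) + (g2 (x, y) - g2 (x, c2)) by ring.
apply: le_lt_trans (ler_normD _ _) _; rewrite normrM.
apply: (@le_lt_trans _ _ (`|d| * e' + e')).
  by rewrite lerD ?ler_wpM2l// ltW.
rewrite -{2}(mul1r e') -mulrDl mulrC -ltr_pdivlMr//.
by rewrite /e' ltr_pM2l// ltf_pV2 ?posrE// ltrD2l ltr1n.
Unshelve. all: by end_near. Qed.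

End chain.

Section weak_along.
Context {R : realType}.
Local Notation leb := (@lebesgue_measure R).
Local Notation leb2 := (@lebesgue_measure R \x @lebesgue_measure R)%E.
Context (th1 th2 : R) (th2_gt0 : 0 < th2) (p q : R) (pq : p < q).
Local Notation d := (delta th1 th2).
Local Notation O := (`]0%R, 1%R[%classic `*` `]p, q[%classic : set (R * R)).

Definition Dtheta (g : R * R -> R) (y : R * R) : R :=
  th1 * 'D_((1, 0) : R * R) g y + th2 * 'D_((0, 1) : R * R) g y.

(** The coordinates (s, x) such that y = (s + th1 x, th2 x). *)
Definition characteristic (y : R * R) : R * R :=
  (y.1 - delta th1 th2 * y.2, y.2 / th2).

Lemma measurable_characteristic : measurable_fun setT characteristic.
Proof.
apply/measurable_fun_pairP; split; rewrite /comp /=.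
  apply: measurable_funB; first exact: measurable_fst.
  by apply: measurable_funM => //; exact: measurable_snd.
by apply: measurable_funM => //; exact: measurable_snd.
Qed.

Lemma test2_continuous g : test2 O g -> continuous g /\ continuous (Dtheta g).
Proof.
move=> [[cg [_ _ [c1 _] [c2 _]]] _]; split => // y.
by apply: cvgD; apply: cvgM; [exact: cvg_cst|exact: c1|exact: cvg_cst|exact: c2].
Qed.

(** A test function and its derivatives vanish off a common compact set, since
    the complement of a compact set is open. *)
Lemma test2_support g : test2 O g -> exists K : set (R * R),
  [/\ compact K, K `<=` O & forall y, ~ K y -> g y = 0 /\ Dtheta g y = 0].
Proof.
move=> [[cg _] [K [cK KO g0]]]; exists K; split => // y Ky; split; first exact: g0.
have oK : open (~` K) by rewrite openC; apply: compact_closed => //; exact: norm_hausdorff.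
have n0 : \forall t \near y, cst (0 : R) t = g t.
  by apply: filterS (open_nbhs_nbhs (conj oK Ky)) => t Kt; rewrite /= g0.
have D0 (v : R * R) : v != 0 -> 'D_v g y = 0.
  move=> v0; have h : is_derive y v g 0 by apply: near_eq_is_derive n0 _.
  by rewrite (@derive_val _ _ _ _ _ _ _ h).
rewrite /Dtheta !D0 ?mulr0 ?addr0//.
  by apply/eqP => -[/eqP]; rewrite oner_eq0.
by apply/eqP => -[/eqP]; rewrite oner_eq0.
Qed.

Lemma test2_bounded g : test2 O g -> exists2 C, 0 <= C &
  forall y, `|g y| <= C /\ `|Dtheta g y| <= C.
Proof.
move=> tg; have [cg cD] := test2_continuous tg; have [K [cK _ K0]] := test2_support tg.
have bound (f : R * R -> R) : continuous f -> (forall y, ~ K y -> f y = 0) ->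
    exists2 C, 0 <= C & forall y, `|f y| <= C.
  move=> cf f0; have [K1|/set0P/negP] := pselect (K !=set0); last first.
    rewrite negbK => /eqP K00; exists 0 => // y.
    by rewrite f0 ?normr0// K00.
  have cn : continuous (fun y => `|f y|).
    by move=> y; apply: cvg_norm; exact: cf.
  have [c _ hc] := compact_EVT_max K1 cK (continuous_subspaceT cn).
  exists `|f c| => // y; have [Ky|nKy] := pselect (K y).
    by apply: hc; rewrite inE.
  by rewrite f0// normr0.
have [C1 C10 h1] := bound g cg (fun y Ky => proj1 (K0 y Ky)).
have [C2 C20 h2] := bound _ cD (fun y Ky => proj2 (K0 y Ky)).
exists (C1 + C2); first exact: addr_ge0.
by move=> y; split; [rewrite (le_trans (h1 y))// lerDl|rewrite (le_trans (h2 y))// lerDr].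
Qed.

Local Notation line := characteristic.
Local Notation mline := measurable_characteristic.
Context (phi : R -> R) (mphi : measurable_fun setT phi).
Context (iphi : forall a b : R, (\int[leb]_(s in `]a, b[) `|phi s|%:E < +oo)%E).
Context (G H : R * R -> R) (mG : measurable_fun setT G) (mH : measurable_fun setT H).
Context (B : R) (GB : forall y, `|G y| <= B) (HB : forall y, `|H y| <= B).
Context (cG : forall s, {within `[p / th2, q / th2], continuous (fun x => G (s, x))}).
Context (cH : forall s, {within `[p / th2, q / th2], continuous (fun x => H (s, x))}).
Context (dG : forall s x, p / th2 < x < q / th2 ->
  is_derive x 1 (fun x => G (s, x)) (H (s, x))).

(** The factors other than phi are bounded, and phi is locally integrable. *)
Lemma strip_integrable (G0 g : R * R -> R) (C : R) : measurable_fun setT G0 ->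
  (forall y, `|G0 y| <= B) -> measurable_fun setT g ->
  (forall y, `|g y| <= C) -> (forall y, ~ O y -> g y = 0) ->
  leb2.-integrable setT (fun y => (phi (line y).1 * G0 (line y) * g y)%:E).
Proof.
move=> mG0 G0B mg gC g0; have ml := mline.
have mO : measurable O by apply: measurableX; exact: measurable_itv.
have mphil : measurable_fun setT (fun y => phi (line y).1).
  exact: (measurableT_comp mphi (measurableT_comp measurable_fst mline)).
have mk : measurable_fun setT (fun y => phi (line y).1 * G0 (line y) * g y).
  apply: measurable_funM => //; apply: measurable_funM => //.
  exact: measurableT_comp.
have B0 : 0 <= B by apply: le_trans (normr_ge0 _) (G0B 0).
have C0 : 0 <= C by apply: le_trans (normr_ge0 _) (gC 0).
apply/integrableP; split; first exact/measurable_EFinP.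
have : (\int[leb2]_(y in O) ((B * C) * `|phi (line y).1|)%:E < +oo)%E.
  under eq_integral do rewrite EFinM.
  have mphiO : measurable_fun O (fun y => `|phi (line y).1|%:E).
    apply/measurable_EFinP; apply: measurable_funTS.
    exact: measurableT_comp.
  have BC0 : (0 <= (B * C)%:E)%E by rewrite lee_fin mulr_ge0.
  rewrite ge0_integralZl//.
  apply: lte_mul_pinfty; rewrite ?lee_fin ?mulr_ge0//.
  have mn : measurable_fun setT (fun s => `|phi s|) by exact: measurableT_comp.
  exact: (@strip_integral_lty _ d p q _ mn (fun s => normr_ge0 _) iphi).
apply: le_lt_trans; rewrite [leRHS]integral_mkcond.
apply: ge0_le_integral => //.
- by apply: measurableT_comp => //; exact/measurable_EFinP.
- apply/(measurable_restrictT _ _).1 => //; apply/measurable_EFinP.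
  apply: measurable_funM => //; apply: measurable_funTS.
  exact: measurableT_comp.
move=> y _; rewrite patchE; case: ifPn => [yO|]; last first.
  by rewrite notin_setE => /g0 ->; rewrite mulr0/= normr0.
rewrite /= lee_fin !normrM.
have -> : B * C * `|phi (line y).1| = `|phi (line y).1| * B * C by ring.
by rewrite ler_pM// ler_wpM2l.
Qed.

(** In the coordinates (s, y2) the sum of the two integrands is phi(s) times the
    derivative in y2 of th2 G g along the line of s. This function vanishes at
    both ends of the line in the strip because g does, so the inner integral is
    0 for every s. Derivatives are taken along the lines only, which is why
    local integrability of phi is enough. *)
Lemma weak_along_lines g : test2 O g ->
  (\int[leb2]_(y in O) (phi (line y).1 * G (line y) * Dtheta g y)%:E =
  - \int[leb2]_(y in O) (phi (line y).1 * H (line y) * g y)%:E)%E.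
Proof.
move=> tg; have [cg cD] := test2_continuous tg; have [C C0 gC] := test2_bounded tg.
have [K [cK KO K0]] := test2_support tg.
have g0 y : ~ O y -> g y = 0 by move=> nO; have [] := K0 y (fun k => nO (KO y k)).
have D0 y : ~ O y -> Dtheta g y = 0 by move=> nO; have [] := K0 y (fun k => nO (KO y k)).
have i1 := strip_integrable mG GB (continuous_measurable_plane cD) (fun y => proj2 (gC y)) D0.
have i2 := strip_integrable mH HB (continuous_measurable_plane cg) (fun y => proj1 (gC y)) g0.
have ext (f h : R * R -> R) : (forall y, ~ O y -> h y = 0) ->
   (\int[leb2]_(y in O) (f y * h y)%:E = \int[leb2]_y (f y * h y)%:E)%E.
  move=> h0; rewrite integral_mkcond; apply: eq_integral => y _; rewrite patchE.
  by case: ifPn => //; rewrite notin_setE => /h0 ->; rewrite mulr0.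
rewrite !ext//.
have fa := integrable_fin_num measurableT i1; have fb := integrable_fin_num measurableT i2.
suff : (\int[leb2]_y ((phi (line y).1 * G (line y) * Dtheta g y)%:E +
    (phi (line y).1 * H (line y) * g y)%:E) = 0)%E.
  rewrite integralD// -(fineK fa) -(fineK fb) -EFinD -EFinN => -[/eqP].
  by rewrite addr_eq0 => /eqP ->.
have i12 := integrableD measurableT i1 i2.
have [_ ->] := integral_shear d i12.
rewrite -[RHS](integral0 leb setT); apply: eq_integral => s' _; pose s : R := s'.
rewrite -[s']/s; move: s => {}s.
pose h (y : R) := g (s + d * y, y).
have dh (y : R) : is_derive y 1 h (Dtheta g (s + d * y, y) / th2).
  have [ck _] := tg; apply: is_derive_eq; first exact: (derive_along_line d s y ck).
  by rewrite /Dtheta /delta; field; rewrite gt_eqF.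
have hp : h p = 0 by apply: g0 => -[_ /=]; rewrite in_itv/= ltxx.
have hq : h q = 0 by apply: g0 => -[_ /=]; rewrite in_itv/= ltxx andbF.
pose f (y : R) := G (s, y / th2) * Dtheta g (s + d * y, y) + H (s, y / th2) * h y.
pose F (y : R) := th2 * G (s, y / th2) * h y.
have cline : continuous (fun y : R => (s + d * y, y) : R * R).
  move=> y; have h1 : s + d * t @[t --> y] --> s + d * y.
    by apply: cvgD; [exact: cvg_cst|apply: cvgM; [exact: cvg_cst|exact: cvg_id]].
  exact: (cvg_pair h1 (@cvg_id _ (nbhs y))).
have ch : continuous h by move=> y; apply: continuous_comp; [exact: cline|exact: cg].
have cDh : continuous (fun y : R => Dtheta g (s + d * y, y)).
  by move=> y; apply: (@continuous_comp _ _ _ _ (Dtheta g)); [exact: cline|exact: cD].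
have cdiv : continuous (fun y : R => y / th2).
  by apply: contM; [move=> ?; exact: cvg_id|exact: cont_cst].
have sub (y : R) : `[p, q]%classic y -> `[p / th2, q / th2]%classic (y / th2).
  by rewrite /= !in_itv/= !ler_pM2r ?invr_gt0.
have cGs := @within_comp _ _ _ (fun x : R => G (s, x)) _ sub cdiv (@cG s).
have cHs := @within_comp _ _ _ (fun x : R => H (s, x)) _ sub cdiv (@cH s).
have cf : {within `[p, q], continuous f}.
  by apply: within_contD; apply: within_contM => //; exact: within_cont.
have cF : {within `[p, q], continuous F}.
  by apply: within_contM; [apply: within_contM => //; exact: within_cst|exact: within_cont].
have dF (y : R) : p < y < q -> is_derive y 1 F (f y).
  move=> ypq; have ypq' : p / th2 < y / th2 < q / th2 by rewrite !ltr_pM2r ?invr_gt0.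
  have dGy : is_derive y 1 (fun y => G (s, y / th2)) (H (s, y / th2) / th2).
    have := @is_derive_affine _ (fun x => G (s, x)) th2^-1 0 y (H (s, y / th2)).
    have -> : (fun t : R => G (s, th2^-1 * t + 0)) = (fun t : R => G (s, t / th2)).
      by apply/funext => t; rewrite addr0 mulrC.
    by rewrite addr0 mulrC; apply; exact: dG.
  have := is_deriveM1 (is_deriveZ1 th2 dGy) (dh y).
  move=> D; apply: (@is_derive_eq _ _ _ _ _ _ _ _ D).
  by rewrite /f; field; rewrite gt_eqF.
have fF : \int[leb]_(y in `[p, q]) f y = 0.
  by rewrite (RFTC2 pq cf cF dF) /F hp hq !mulr0 subrr.
transitivity (\int[leb]_y ((phi s)%:E * ((f \_ `[p, q]) y)%:E))%E.
  apply: eq_integral => y _; rewrite /shear /characteristic /= addrK -EFinD -EFinM; congr EFin.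
  rewrite patchE; case: ifPn => [_|]; first by rewrite /f /h; ring.
  rewrite notin_setE/= in_itv/= => ypq.
  have nO : ~ O (s + d * y, y).
    by move=> [_ /=]; rewrite in_itv/= => /andP[/ltW y1 /ltW y2]; apply: ypq; rewrite y1.
  by rewrite D0// g0// !mulr0 addr0.
have fi : leb.-integrable `[p, q] (EFin \o f) by exact: ccompact_integrable.
have fi' : leb.-integrable setT (fun y => ((f \_ `[p, q]) y)%:E).
  have := (integrable_mkcond _ _).1 fi.
  rewrite restrict_EFin; apply. 
  exact: measurable_itv.
rewrite integralZl//.
have -> : (\int[leb]_y ((f \_ `[p, q]) y)%:E = 0)%E.
  have -> : (\int[leb]_y ((f \_ `[p, q]) y)%:E = \int[leb]_(y in `[p, q]) (f y)%:E)%E.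
    by rewrite [RHS]integral_mkcond restrict_EFin.
  by rewrite -[LHS]fineK ?integrable_fin_num// -/(Rintegral _ _ _) fF.
by rewrite mule0.
Qed.

End weak_along.

(** * Norm estimates *)

Section caratheodory.
Context {R : realType}.

Lemma measurable_floor_fiber (n : nat) (k : int) :
  measurable [set x : R | Num.floor (n.+1%:R * x) = k].
Proof.
rewrite (_ : [set x | _] = `[k%:~R / n.+1%:R, (k + 1)%:~R / n.+1%:R[%classic).
  exact: measurable_itv.
have n0 : 0 < n.+1%:R :> R by rewrite ltr0n.
apply/seteqP; split => x /=; rewrite in_itv/= ler_pdivrMr// ltr_pdivlMr// [x * _]mulrC.
  by move=> <-; have := mem_rg1_floor (n.+1%:R * x); rewrite intrD.
by move=> /floor_def.
Qed.

(** Such an f is the pointwise limit of the functions obtained by rounding the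
    second variable down to a grid, which are measurable on each of countably
    many product sets. *)
Lemma caratheodory_measurable (f : R * R -> R) :
  (forall x, measurable_fun setT (fun s => f (s, x))) ->
  (forall s, continuous (fun x => f (s, x))) -> measurable_fun setT f.
Proof.
move=> mf cf; pose grid (n : nat) (x : R) : R := (Num.floor (n.+1%:R * x))%:~R / n.+1%:R.
pose fn n (y : R * R) := f (y.1, grid n y.2).
have mfn n : measurable_fun setT (fn n).
  move=> _ V mV; rewrite setTI.
  rewrite (_ : _ @^-1` _ = \bigcup_(k : int) ([set s | V (f (s, k%:~R / n.+1%:R))] `*`
      [set x : R | Num.floor (n.+1%:R * x) = k])); last first.
    apply/seteqP; split => [[s x] /= Vs|[s x] [k _ [/= Vs xk]]].
      by exists (Num.floor (n.+1%:R * x)).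
    by rewrite /fn /grid /= xk.
  apply: countable_bigcupT_measurable => // k; apply: measurableX.
    by rewrite -[X in measurable X]setTI; exact: mf.
  exact: measurable_floor_fiber.
apply: (@measurable_fun_cvg _ _ R setT fn f mfn) => -[s x] _.
have n0 n : 0 < n.+1%:R :> R by rewrite ltr0n.
have gx : grid n x @[n --> \oo] --> x.
  apply/cvgrPdist_lt => e e0.
  have := @cvg_harmonic R; move/cvgrPdist_lt => /(_ e e0); apply: filterS => n.
  rewrite sub0r normrN /harmonic /= ger0_norm ?invr_ge0 ?ler0n// => ne.
  apply: le_lt_trans ne.
  have /andP[h1 h2] := mem_rg1_floor (n.+1%:R * x).
  have -> : x - grid n x = (n.+1%:R * x - (Num.floor (n.+1%:R * x))%:~R) / n.+1%:R.
    by rewrite /grid; field; rewrite gt_eqF.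
  rewrite normrM [`|_^-1|]ger0_norm ?invr_ge0 ?ler0n// ler_piMl ?invr_ge0 ?ler0n//.
  by rewrite ger0_norm; lra.
exact: (cvg_comp _ _ gx (cf s x)).
Qed.

End caratheodory.

Section L2per_facts.
Context {R : realType}.
Local Notation leb := (@lebesgue_measure R).
Context (f : R -> R[i]) (fL2 : L2per f).

Lemma measurable_of_segments (g : R -> R) :
  (forall a b : R, measurable_fun `]a, b[ g) -> measurable_fun setT g.
Proof.
move=> mg; rewrite (_ : setT = \bigcup_(n : nat) `](- n%:R : R), n%:R[%classic).
  by apply/measurable_fun_bigcup.
apply/seteqP; split => // x _; exists (Num.Def.archi_bound `|x|) => //=.
by rewrite in_itv/= -ltr_norml; exact: archi_boundP.
Qed.

Lemma L2per_measurable :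
  measurable_fun setT (fun s => complex.Re (f s)) /\
  measurable_fun setT (fun s => complex.Im (f s)).
Proof.
have [_ h] := fL2; split; apply: measurable_of_segments => a b.
  by have [? _ _] := h a b.
by have [_ ? _] := h a b.
Qed.

Lemma L2per_square_integrable (a b : R) :
  (\int[leb]_(s in `]a, b[) (nsq (f s))%:E < +oo)%E.
Proof. by have [_ h] := fL2; have [_ _ /L2norm_lty] := h a b. Qed.

(** |g| <= 1 + g^2. *)
Lemma L2per_locally_integrable (g : R -> R) : measurable_fun setT g ->
  (forall s, g s ^+ 2 <= nsq (f s)) ->
  forall a b : R, (\int[leb]_(s in `]a, b[) `|g s|%:E < +oo)%E.
Proof.
move=> mg gf a b; have [m1 m2] := L2per_measurable.
have mf : measurable_fun `]a, b[ (fun s => nsq (f s)).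
  by apply: measurable_funTS; exact: nsq_measurable.
have mI : measurable (`]a, b[%classic : set R) by exact: measurable_itv.
apply: (@le_lt_trans _ _ (\int[leb]_(s in `]a, b[) (1 + nsq (f s))%:E)%E).
  apply: ge0_le_integral => //.
  - by apply/measurable_EFinP; apply: measurableT_comp => //; apply: (@measurable_funS _ _ _ _ setT).
  - by apply/measurable_EFinP; apply: measurable_funD.
  move=> s _; rewrite lee_fin; have := gf s; rewrite -(real_normK (num_real (g s))).
  by have := normr_ge0 (g s); nra.
under eq_integral do rewrite EFinD.
rewrite ge0_integralD//; last 2 first.
- by move=> s _; rewrite lee_fin nsq_ge0.
- exact/measurable_EFinP.
apply: lte_add_pinfty; last exact: L2per_square_integrable.
rewrite integral_cst// mul1e.
suff : (leb `]a, b[ < +oo)%E by [].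
rewrite lebesgue_measure_itv/=.
by case: ifPn => _; rewrite ?ltry.
Qed.

End L2per_facts.

Section H1theta_bound.
Context {R : realType}.
Local Notation leb := (@lebesgue_measure R).
Local Notation leb2 := (@lebesgue_measure R \x @lebesgue_measure R)%E.
Context (th1 th2 : R) (th2_gt0 : 0 < th2) (p q : R) (pq : p < q).
Context (f : R -> R[i]) (fL2 : L2per f).
Local Notation d := (delta th1 th2).
Local Notation O := (`]0%R, 1%R[%classic `*` `]p, q[%classic : set (R * R)).

Let a := p / th2.

Let b := q / th2.

Let ab : a < b. Proof. by rewrite ltr_pM2r ?invr_gt0. Qed.

Let mO : measurable O.
Proof. by apply: measurableX; exact: measurable_itv. Qed.

Local Notation line := (characteristic th1 th2).

Let lineO y : O y -> a < (line y).2 < b.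
Proof.
by move=> [_] /=; rewrite in_itv/= /characteristic /a /b !ltr_pM2r ?invr_gt0.
Qed.

(** The finite constant that multiplies the uniform error in the norm estimate.
    *)
Lemma strip_mass : exists2 M : R, 0 <= M &
  (\int[leb2]_(y in O) (nsq (f (line y).1))%:E = M%:E)%E.
Proof.
have [m1 m2] := L2per_measurable fL2.
have fin := @strip_integral_lty _ d p q _ (nsq_measurable m1 m2) (fun s => nsq_ge0 _)
  (L2per_square_integrable fL2).
exists (fine (\int[leb2]_(y in O) (nsq (f (line y).1))%:E)%E).
  by apply: fine_ge0; apply: integral_ge0 => y _; rewrite lee_fin nsq_ge0.
rewrite fineK// ge0_fin_numE//.
by apply: integral_ge0 => y _; rewrite lee_fin nsq_ge0.
Qed.

Section functions.
Context (G H : R -> R -> R[i]) (B : R).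
Context (sG : forall x, a <= x <= b -> ccontinuous_on setT (G ^~ x)).
Context (sH : forall x, a <= x <= b -> ccontinuous_on setT (H ^~ x)).
Context (xG : forall s, ccontinuous_on `[a, b] (G s)).
Context (xH : forall s, ccontinuous_on `[a, b] (H s)).
Context (dG : forall s x, a < x < b -> cderive (G s) x (H s x)).
Context (GB : forall s x, a <= x <= b -> nsq (G s x) <= B).
Context (HB : forall s x, a <= x <= b -> nsq (H s x) <= B).

(** G and H are only known on [a, b]; they are extended by clamping so that
    measurability can be stated on the whole plane. *)
Let cl (g : R -> R -> R) (y : R * R) : R := g y.1 (clamp a b y.2).

Let mcl (g : R -> R -> R) : (forall x, a <= x <= b -> continuous (g ^~ x)) ->
  (forall s, {within `[a, b], continuous (g s)}) -> measurable_fun setT (cl g).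
Proof.
move=> h1 h2; apply: caratheodory_measurable => [x|s].
  exact: (continuous_measurable_fun (h1 _ (clamp_itv x (ltW ab)))).
exact: (continuous_clamp (ltW ab) (h2 s)).
Qed.

Let B0 : 0 <= B.
Proof. by apply: le_trans (nsq_ge0 _) (@GB 0 a _); rewrite lexx ltW. Qed.

Let clB (g : R -> R -> R) (K : R -> R -> R[i]) :
  (forall s x, a <= x <= b -> nsq (K s x) <= B) ->
  (forall s x, g s x ^+ 2 <= nsq (K s x)) -> forall y, `|cl g y| <= B + 1.
Proof.
move=> KB gK [s x]; have B1 : 0 <= B + 1 by rewrite addr_ge0.
rewrite -ler_sqr ?nnegrE// real_normK ?num_real//.
apply: le_trans (gK _ _) _; apply: (@le_trans _ _ B); last by have := B0; nra.
by apply: KB; exact: clamp_itv (ltW ab).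
Qed.

Let clcont (g : R -> R -> R) s : {within `[a, b], continuous (g s)} ->
  {within `[a, b], continuous (fun x => cl g (s, x))}.
Proof. by move=> h; apply: within_cont; exact: (continuous_clamp (ltW ab) h). Qed.

Let clderive (g k : R -> R -> R) s x : a < x < b ->
  is_derive x 1 (g s) (k s x) -> is_derive x 1 (fun x => cl g (s, x)) (cl k (s, x)).
Proof.
move=> /andP[ax xb] dg; rewrite /cl /= clamp_id ?(ltW ax) ?(ltW xb)//.
apply: near_eq_is_derive dg; near=> t.
rewrite clamp_id//; apply/andP; split; near: t; [exact: lt_le_nbhsr|exact: lt_le_nbhsl].
Unshelve. all: by end_near. Qed.

Let real_part (h : R -> R) (g k : R -> R -> R) (t : R * R -> R) :
  test2 O t -> measurable_fun setT h -> (forall s, h s ^+ 2 <= nsq (f s)) ->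
  (forall x, a <= x <= b -> continuous (g ^~ x)) ->
  (forall x, a <= x <= b -> continuous (k ^~ x)) ->
  (forall s, {within `[a, b], continuous (g s)}) ->
  (forall s, {within `[a, b], continuous (k s)}) ->
  (forall s x, a < x < b -> is_derive x 1 (g s) (k s x)) ->
  (forall s x, g s x ^+ 2 <= nsq (G s x)) ->
  (forall s x, k s x ^+ 2 <= nsq (H s x)) ->
  [/\ leb2.-integrable O (fun y => (h (line y).1 * cl g (line y) * Dtheta th1 th2 t y)%:E),
      leb2.-integrable O (fun y => (h (line y).1 * cl k (line y) * t y)%:E) &
      \int[leb2]_(y in O) (h (line y).1 * cl g (line y) * Dtheta th1 th2 t y) =
      - \int[leb2]_(y in O) (h (line y).1 * cl k (line y) * t y)].
Proof.
move=> tt mh hf g1 k1 g2 k2 gk gG kH.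
have ih := L2per_locally_integrable fL2 mh hf.
have [ct cD] := test2_continuous th1 th2 tt; have [C C0 tC] := test2_bounded th1 th2 tt.
have [K [cK KO K0]] := test2_support th1 th2 tt.
have t0 y : ~ O y -> t y = 0 by move=> nO; have [] := K0 y (fun k => nO (KO y k)).
have D0 y : ~ O y -> Dtheta th1 th2 t y = 0 by move=> nO; have [] := K0 y (fun k => nO (KO y k)).
have gB := clB GB gG; have kB := clB HB kH.
split.
- apply: (integrableS measurableT) => //.
  exact: (strip_integrable th1 th2 mh ih (mcl g1 g2) gB (continuous_measurable_plane cD) (fun y => proj2 (tC y)) D0).
- apply: (integrableS measurableT) => //.
  exact: (strip_integrable th1 th2 mh ih (mcl k1 k2) kB (continuous_measurable_plane ct) (fun y => proj1 (tC y)) t0).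
rewrite /Rintegral -fineN; congr fine.
apply: (@weak_along_lines _ th1 th2 th2_gt0 p q pq h mh ih (cl g) (cl k) (mcl g1 g2) (mcl k1 k2) (B + 1)) => //.
- by move=> s; apply: clcont.
- by move=> s; apply: clcont.
- by move=> s x xab; apply: clderive => //; exact: gk.
Qed.

Let L2_part (K : R -> R -> R[i]) (W : R * R -> R[i]) (M : R) :
  (forall x, a <= x <= b -> ccontinuous_on setT (K ^~ x)) ->
  (forall s, ccontinuous_on `[a, b] (K s)) ->
  (forall s x, a <= x <= b -> nsq (K s x) <= B) ->
  (forall y, O y -> W y = f (line y).1 * K (line y).1 (line y).2) ->
  (\int[leb2]_(y in O) (nsq (f (line y).1))%:E = M%:E)%E ->
  L2 leb2 O W /\ (\int[leb2]_(y in O) (nsq (W y))%:E <= (B * M)%:E)%E.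
Proof.
move=> sK xK KB WE hM; have [m1 m2] := L2per_measurable fL2.
have ml := measurable_characteristic th1 th2.
have ml1 := measurableT_comp (@measurable_fst _ _ R R) ml.
have mKr := mcl (fun x xab => proj1 (ccontinuousT (sK x xab))) (fun s => proj1 (xK s)).
have mKi := mcl (fun x xab => proj2 (ccontinuousT (sK x xab))) (fun s => proj2 (xK s)).
have mfr := measurableT_comp m1 ml1; have mfi := measurableT_comp m2 ml1.
have mKrl := measurableT_comp mKr ml; have mKil := measurableT_comp mKi ml.
have clE (g : R -> R -> R) y : O y -> cl g (line y) = g (line y).1 (line y).2.
  by move=> /lineO/andP[h1 h2]; rewrite /cl clamp_id// (ltW h1) ltW.
have mWr : measurable_fun O (fun y => complex.Re (W y)).
  apply: (@eq_measurable_fun _ _ _ _ O (fun y => complex.Re (f (line y).1) * cl (fun s x => complex.Re (K s x)) (line y)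
      - complex.Im (f (line y).1) * cl (fun s x => complex.Im (K s x)) (line y))).
    by move=> y; rewrite inE => Oy; rewrite WE// ReM !clE.
  apply: measurable_funTS.
  by apply: measurable_funB; apply: measurable_funM.
have mWi : measurable_fun O (fun y => complex.Im (W y)).
  apply: (@eq_measurable_fun _ _ _ _ O (fun y => complex.Re (f (line y).1) * cl (fun s x => complex.Im (K s x)) (line y)
      + complex.Im (f (line y).1) * cl (fun s x => complex.Re (K s x)) (line y))).
    by move=> y; rewrite inE => Oy; rewrite WE// ImM !clE.
  apply: measurable_funTS.
  by apply: measurable_funD; apply: measurable_funM.
have bound : (\int[leb2]_(y in O) (nsq (W y))%:E <= (B * M)%:E)%E.
  have mff : measurable_fun O (fun y => (nsq (f (line y).1))%:E).
    apply/measurable_EFinP; apply: measurable_funTS.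
    exact: (nsq_measurable mfr mfi).
  have BE : (0 <= B%:E)%E by rewrite lee_fin.
  have nf0 y : O y -> (0 <= (nsq (f (line y).1))%:E)%E by rewrite lee_fin nsq_ge0.
  rewrite EFinM -hM -ge0_integralZl//.
  apply: ge0_le_integral => //.
  - by move=> y _; rewrite lee_fin nsq_ge0.
  - by apply/measurable_EFinP; exact: nsq_measurable.
  - exact: measurable_funeM.
  move=> y Oy; rewrite WE// nsqM -EFinM lee_fin mulrC ler_wpM2r ?nsq_ge0//.
  by have /andP[h1 h2] := lineO Oy; apply: KB; rewrite !ltW.
split=> //; split => //; apply/L2norm_lty.
exact: le_lt_trans bound (ltry _).
Qed.

Let weak_part (U V : R * R -> R[i]) (t : R * R -> R) :
  (forall y, O y -> U y = f (line y).1 * G (line y).1 (line y).2) ->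
  (forall y, O y -> V y = f (line y).1 * H (line y).1 (line y).2) ->
  test2 O t ->
  cintegral leb2 O (fun y => U y * (Dtheta th1 th2 t y)%:C) =
  - cintegral leb2 O (fun y => V y * (t y)%:C).
Proof.
move=> UE VE tt; have [m1 m2] := L2per_measurable fL2.
have sqr (w : R[i]) : complex.Re w ^+ 2 <= nsq w by rewrite lerDl sqr_ge0.
have sqi (w : R[i]) : complex.Im w ^+ 2 <= nsq w by rewrite lerDr sqr_ge0.
have rG x (xab : a <= x <= b) := proj1 (ccontinuousT (sG xab)).
have iG x (xab : a <= x <= b) := proj2 (ccontinuousT (sG xab)).
have rH x (xab : a <= x <= b) := proj1 (ccontinuousT (sH xab)).
have iH x (xab : a <= x <= b) := proj2 (ccontinuousT (sH xab)).
have dr s x (xab : a < x < b) := proj1 (@dG s x xab).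
have di s x (xab : a < x < b) := proj2 (@dG s x xab).
have [rr1 rr2 rr] := real_part tt m1 (fun s => sqr _) rG rH (fun s => proj1 (xG s))
  (fun s => proj1 (xH s)) dr (fun s x => sqr _) (fun s x => sqr _).
have [ri1 ri2 ri] := real_part tt m1 (fun s => sqr _) iG iH (fun s => proj2 (xG s))
  (fun s => proj2 (xH s)) di (fun s x => sqi _) (fun s x => sqi _).
have [ir1 ir2 ir] := real_part tt m2 (fun s => sqi _) rG rH (fun s => proj1 (xG s))
  (fun s => proj1 (xH s)) dr (fun s x => sqr _) (fun s x => sqr _).
have [ii1 ii2 ii] := real_part tt m2 (fun s => sqi _) iG iH (fun s => proj2 (xG s))
  (fun s => proj2 (xH s)) di (fun s x => sqi _) (fun s x => sqi _).
have clE (g : R -> R -> R) y : O y -> cl g (line y) = g (line y).1 (line y).2.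
  by move=> /lineO/andP[h1 h2]; rewrite /cl clamp_id// (ltW h1) ltW.
rewrite /cintegral; apply/eqP; rewrite eq_complex /=; apply/andP; split; apply/eqP.
- transitivity (\int[leb2]_(y in O) (complex.Re (f (line y).1) * cl (fun s x => complex.Re (G s x)) (line y) * Dtheta th1 th2 t y - complex.Im (f (line y).1) * cl (fun s x => complex.Im (G s x)) (line y) * Dtheta th1 th2 t y)).
    by apply: eq_Rintegral => y; rewrite inE => Oy; rewrite UE// !ReM !clE//=; ring.
  rewrite RintegralB// rr ii.
  transitivity (- (\int[leb2]_(y in O) (complex.Re (f (line y).1) * cl (fun s x => complex.Re (H s x)) (line y) * t y - complex.Im (f (line y).1) * cl (fun s x => complex.Im (H s x)) (line y) * t y))).
    by rewrite RintegralB//; ring.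
  congr (- _); apply: eq_Rintegral => y; rewrite inE => Oy.
  by rewrite VE// !ReM !clE//=; ring.
- transitivity (\int[leb2]_(y in O) (complex.Re (f (line y).1) * cl (fun s x => complex.Im (G s x)) (line y) * Dtheta th1 th2 t y + complex.Im (f (line y).1) * cl (fun s x => complex.Re (G s x)) (line y) * Dtheta th1 th2 t y)).
    by apply: eq_Rintegral => y; rewrite inE => Oy; rewrite UE// !ImM !ReM !clE//=; ring.
  rewrite RintegralD// ri ir.
  transitivity (- (\int[leb2]_(y in O) (complex.Re (f (line y).1) * cl (fun s x => complex.Im (H s x)) (line y) * t y + complex.Im (f (line y).1) * cl (fun s x => complex.Re (H s x)) (line y) * t y))).
    by rewrite RintegralD//; ring.
  congr (- _); apply: eq_Rintegral => y; rewrite inE => Oy.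
  by rewrite VE// !ImM !ReM !clE//=; ring.
Qed.

(** With V = f H as weak derivative of U = f G along the lines, each of the two
    L2 norms is at most sqrt B times the L2 mass of f in the strip. The products
    of real and imaginary parts of f and G are treated one by one. *)
Lemma H1theta_norm_le (U : R * R -> R[i]) (M : R) :
  (forall y, O y -> U y = f (line y).1 * G (line y).1 (line y).2) ->
  (\int[leb2]_(y in O) (nsq (f (line y).1))%:E = M%:E)%E -> 0 <= M ->
  (H1theta_norm th1 th2 O U <= ((2 * B * M) `^ 2^-1)%:E)%E.
Proof.
move=> UE hM M0; pose V y := f (line y).1 * H (line y).1 (line y).2.
have VE y : O y -> V y = f (line y).1 * H (line y).1 (line y).2 by [].
have [LU boundU] := L2_part sG xG GB UE hM.
have [LV boundV] := L2_part sH xH HB VE hM.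
apply: (@le_trans _ _ (poweR (L2norm leb2 O U ^+ 2 + L2norm leb2 O V ^+ 2)%E 2^-1)).
  apply: ereal_inf_lbound; exists V => //; split => // t tt.
  exact: weak_part.
have sqE W : (\int[leb2]_(y in O) (nsq (W y))%:E <= (B * M)%:E)%E -> exists r : R,
    [/\ 0 <= r, r <= B * M & (L2norm leb2 O W ^+ 2 = r%:E)%E].
  move=> bW; have i0 : (0 <= \int[leb2]_(y in O) (nsq (W y))%:E)%E.
    by apply: integral_ge0 => y _; rewrite lee_fin nsq_ge0.
  have iE : (\int[leb2]_(y in O) (nsq (W y))%:E)%E \is a fin_num.
    by rewrite ge0_fin_numE// (le_lt_trans bW)// ltry.
  rewrite L2normE; move: i0 bW; rewrite -(fineK iE); move: (fine _) => r.
  rewrite !lee_fin => r0 rB; exists r; split => //.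
  by rewrite poweR_EFin powR12_sqrt// -EFin_expe sqr_sqrtr.
have [r1 [r10 r1B ->]] := sqE U boundU; have [r2 [r20 r2B ->]] := sqE V boundV.
rewrite -EFinD poweR_EFin lee_fin; apply: ge0_ler_powR.
- by rewrite invr_ge0.
- by rewrite nnegrE addr_ge0.
- by rewrite nnegrE; lra.
- by lra.
Qed.

End functions.

End H1theta_bound.

Section vanishing_norms.
Context {R : realType}.
Local Notation leb := (@lebesgue_measure R).

Lemma ge0_ereal_cvg0 (x : nat -> \bar R) : (forall j, (0 <= x j)%E) ->
  (forall h : R, 0 < h -> \forall j \near \oo, (x j <= h%:E)%E) ->
  x j @[j --> \oo] --> 0%E.
Proof.
move=> x0 H; apply/fine_cvgP; split.
  by apply: filterS (H 1 ltr01) => j xj; rewrite ge0_fin_numE// (le_lt_trans xj)// ltry.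
apply/cvgrPdist_le => h h0; apply: filterS (H h h0) => j xj /=.
rewrite sub0r normrN ger0_norm ?fine_ge0//.
have xf : x j \is a fin_num by rewrite ge0_fin_numE// (le_lt_trans xj)// ltry.
by rewrite -lee_fin fineK.
Qed.

Lemma H1theta_norm_ge0 (th1 th2 : R) O U : (0 <= H1theta_norm th1 th2 O U)%E.
Proof. by apply/ereal_infP => _ [V _ ->]; exact: poweR_ge0. Qed.

Lemma L2per_opnorm_ge0 (T : (R -> R[i]) -> R -> R[i]) : (0 <= L2per_opnorm T)%E.
Proof. by apply/ereal_infP => _ [c [c0 _] <-]; rewrite lee_fin. Qed.

Lemma L2per_opnorm_multiplier (m : R -> R[i]) (T : (R -> R[i]) -> R -> R[i]) (c : R) :
  0 <= c -> ccontinuous_on setT m -> periodic1 m ->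
  (forall s, nsq (m s) <= c ^+ 2) -> (forall f s, T f s = m s * f s) ->
  (L2per_opnorm T <= c%:E)%E.
Proof.
move=> c0 /ccontinuousT[cm1 cm2] mper mc TE; apply: ereal_inf_lbound; exists c => //; split => // f fL2.
have [fper fL] := fL2; have [f1 f2] := L2per_measurable fL2.
have mm1 : measurable_fun setT (fun s => complex.Re (m s)).
  exact: continuous_measurable_fun.
have mm2 : measurable_fun setT (fun s => complex.Im (m s)).
  exact: continuous_measurable_fun.
have mT1 : measurable_fun setT (fun s => complex.Re (T f s)).
  under eq_fun do rewrite TE ReM.
  by apply: measurable_funB; apply: measurable_funM.
have mT2 : measurable_fun setT (fun s => complex.Im (T f s)).
  under eq_fun do rewrite TE ImM.
  by apply: measurable_funD; apply: measurable_funM.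
have bound (a b : R) : (\int[leb]_(s in `]a, b[) (nsq (T f s))%:E <=
    (c ^+ 2)%:E * \int[leb]_(s in `]a, b[) (nsq (f s))%:E)%E.
  have mff : measurable_fun `]a, b[ (fun s => (nsq (f s))%:E).
    apply/measurable_EFinP; apply: measurable_funTS.
    exact: nsq_measurable.
  have cE : (0 <= (c ^+ 2)%:E)%E by rewrite lee_fin sqr_ge0.
  have nf0 s : `]a, b[%classic s -> (0 <= (nsq (f s))%:E)%E by rewrite lee_fin nsq_ge0.
  rewrite -ge0_integralZl//; apply: ge0_le_integral => //.
  - by move=> s _; rewrite lee_fin nsq_ge0.
  - apply/measurable_EFinP; apply: measurable_funTS.
    exact: nsq_measurable.
  - exact: measurable_funeM.
  by move=> s _; rewrite TE nsqM -EFinM lee_fin ler_wpM2r// nsq_ge0.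
have fin (a b : R) : (\int[leb]_(s in `]a, b[) (nsq (f s))%:E)%E \is a fin_num.
  rewrite ge0_fin_numE; first exact: L2per_square_integrable.
  by apply: integral_ge0 => s _; rewrite lee_fin nsq_ge0.
split.
  split; first by move=> s; rewrite !TE mper fper.
  move=> a b; split.
  - exact: measurable_funTS.
  - exact: measurable_funTS.
  apply/L2norm_lty; apply: le_lt_trans (bound a b) _.
  rewrite lte_mul_pinfty ?lee_fin ?sqr_ge0//.
  by rewrite -ge0_fin_numE//; apply: integral_ge0 => s _; rewrite lee_fin nsq_ge0.
rewrite /L2per_norm !L2normE; have := bound 0 1; have := fin 0 1.
have i0 : (0 <= \int[leb]_(s in `]0%R, 1%R[) (nsq (f s))%:E)%E.
  by apply: integral_ge0 => s _; rewrite lee_fin nsq_ge0.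
have j0 : (0 <= \int[leb]_(s in `]0%R, 1%R[) (nsq (T f s))%:E)%E.
  by apply: integral_ge0 => s _; rewrite lee_fin nsq_ge0.
move=> iE; move: i0; rewrite -(fineK iE); move: (fine _) => r; rewrite lee_fin => r0 jr.
have jE : (\int[leb]_(s in `]0%R, 1%R[) (nsq (T f s))%:E)%E \is a fin_num.
  by rewrite ge0_fin_numE// (le_lt_trans jr)// -EFinM ltry.
move: j0 jr; rewrite -(fineK jE); move: (fine _) => t; rewrite lee_fin => t0.
rewrite -EFinM !poweR_EFin -EFinM !lee_fin !powR12_sqrt// => tr.
rewrite -{1}(ger0_norm c0) -sqrtr_sqr -sqrtrM ?sqr_ge0//.
exact: ler_wsqrtr.
Qed.

Lemma negligible_translation (c : R) (A : set R) : leb.-negligible A ->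
  leb.-negligible ((fun x => x + c) @^-1` A).
Proof.
move=> [B [mB B0 AB]]; exists ((fun x => x + c) @^-1` B); split.
- by rewrite -[X in measurable X]setTI; exact: measurable_translation.
- by rewrite -B0; exact: lebesgue_measure_translation.
- by move=> x /AB.
Qed.

(** Countably many translates of a negligible set of [0, 1[ cover the
    exceptional set. *)
Lemma periodic_ae0 (f : R -> R[i]) : periodic1 f ->
  {ae leb, forall s, `]0, 1[%classic s -> f s = 0} -> {ae leb, forall s, f s = 0}.
Proof.
move=> fper H.
pose A : set R := [set s | (0 <= s < 1) /\ f s != 0].
have nA : leb.-negligible A.
  have n0 : leb.-negligible [set (0 : R)].
    by apply/negligibleP; [exact: measurable_set1|exact: lebesgue_measure_set1].
  apply: negligibleS (negligibleU H n0) => s [/andP[s0 s1] fs].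
  have [->|sn0] := eqVneq s 0; first by right.
  left => /= H'; move/eqP: fs; apply; apply: H'.
  by rewrite /= in_itv/= s1 lt_neqAle eq_sym sn0 s0.
(* translates by both signs, since the integer part of s may be negative *)
have nB : leb.-negligible (\bigcup_n ((fun x => x + n%:R) @^-1` A) `|`
    \bigcup_n ((fun x => x + - n%:R) @^-1` A)).
  by apply: negligibleU; apply: negligible_bigcup => n; exact: negligible_translation.
apply: negligibleS nB => s /= /eqP fs.
pose k := Num.floor s.
have kA : A (s + (- k)%:~R).
  split; last by rewrite (periodicZ fper).
  rewrite mulrNz; have /andP[h1 h2] := mem_rg1_floor s.
  by rewrite -/k in h1 h2; apply/andP; split; lra.
move: kA; case: k => n kA.
  by right; exists n => //=; move: kA; rewrite mulrNz -pmulrn.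
by left; exists n.+1 => //=; move: kA; rewrite NegzE opprK -pmulrn.
Qed.

End vanishing_norms.

(** * The periodic medium restricted to lines *)

Section medium.
Context {R : realType} (mu rho : R * R -> R) (th1 th2 z om : R).
Context (mu_cont : continuous mu) (rho_cont : continuous rho).
Context (mu_per : forall y1 y2, mu (y1 + 1, y2) = mu (y1, y2) /\
                          mu (y1, y2 + 1) = mu (y1, y2)).
Context (rho_per : forall y1 y2, rho (y1 + 1, y2) = rho (y1, y2) /\
                           rho (y1, y2 + 1) = rho (y1, y2)).
Context (mu_pos : exists2 c, 0 < c & forall y, c <= mu y).
Context (rho_pos : exists2 c, 0 < c & forall y, c <= rho y).
Context (th2_pos : 0 < th2) (z_pos : 0 < z).
Implicit Types (F G : solution R) (X x s e eps : R).
Local Notation Rp := (Robin_plus z rgt).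
Local Notation Rm := (Robin_minus z rgt).
Local Notation dl := (delta th1 th2).

(** The coefficients of the first-order system satisfied by the Cauchy data
    along the line of s. *)
Definition imu s x : R := (slice th1 th2 mu s x)^-1.

Definition srho s x : R := slice th1 th2 rho s x.

Definition kappa eps : R[i] := (om ^+ 2) +i* eps.

Lemma mu_gt0 y : 0 < mu y.
Proof. by have [c c0 hc] := mu_pos; exact: lt_le_trans (hc y). Qed.

Lemma rho_gt0 y : 0 < rho y.
Proof. by have [c c0 hc] := rho_pos; exact: lt_le_trans (hc y). Qed.

Lemma coef_bounds : exists C : R, [/\ 0 <= C,
  forall s x, 0 <= imu s x <= C & forall s x, 0 <= srho s x <= C].
Proof.
have [c c0 hc] := mu_pos; have [B hB] := periodic2_bounded rho_cont rho_per.
have cV : 0 <= c^-1 by rewrite invr_ge0 ltW.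
exists (c^-1 + `|B|); split; first by rewrite addr_ge0.
- move=> s x; rewrite /imu /slice invr_ge0 (ltW (mu_gt0 _))/=.
  apply: (@le_trans _ _ c^-1); last by rewrite lerDl.
  by rewrite lef_pV2 ?posrE ?hc ?mu_gt0.
- move=> s x; rewrite /srho /slice (ltW (rho_gt0 _))/=.
  by rewrite (le_trans (hB _))// (le_trans (ler_norm _))// lerDr.
Qed.

Lemma slice_shift (f : R * R -> R) s x :
  (forall y1 y2, f (y1 + 1, y2) = f (y1, y2) /\ f (y1, y2 + 1) = f (y1, y2)) ->
  slice th1 th2 f s (x + th2^-1) = slice th1 th2 f (s + dl) x.
Proof.
move=> fper; rewrite /slice !mulrDr divff ?gt_eqF// -/dl (fper _ _).2.
by congr (f (_, _)); rewrite /delta; ring.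
Qed.

Lemma slice_per (f : R * R -> R) s x :
  (forall y1 y2, f (y1 + 1, y2) = f (y1, y2) /\ f (y1, y2 + 1) = f (y1, y2)) ->
  slice th1 th2 f (s + 1) x = slice th1 th2 f s x.
Proof. by move=> fper; rewrite /slice addrAC (fper _ _).1. Qed.

Lemma imu_shift s x : imu s (x + th2^-1) = imu (s + dl) x.
Proof. by rewrite /imu slice_shift. Qed.

Lemma srho_shift s x : srho s (x + th2^-1) = srho (s + dl) x.
Proof. by rewrite /srho slice_shift. Qed.

Lemma imu_per s : imu (s + 1) = imu s.
Proof. by apply/funext => x; rewrite /imu slice_per. Qed.

Lemma srho_per s : srho (s + 1) = srho s.
Proof. by apply/funext => x; rewrite /srho slice_per. Qed.

Lemma slice_pair_continuous (f : R * R -> R) : continuous f ->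
  continuous (fun sx : R * R => slice th1 th2 f sx.1 sx.2).
Proof.
move=> cf sx; apply: (@continuous_comp _ _ _ (fun sx : R * R => (sx.1 + th1 * sx.2, th2 * sx.2)) f).
  have h2 : th2 * y.2 @[y --> sx] --> th2 * sx.2.
    by apply: cvgM; [exact: cvg_cst|exact: cvg_snd].
  have h1 : y.1 + th1 * y.2 @[y --> sx] --> sx.1 + th1 * sx.2.
    apply: cvgD; first exact: cvg_fst.
    by apply: cvgM; [exact: cvg_cst|exact: cvg_snd].
  exact: (cvg_pair h1 h2).
exact: cf.
Qed.

Lemma slice_continuous (f : R * R -> R) s : continuous f ->
  continuous (slice th1 th2 f s).
Proof.
move=> cf x; apply: (@continuous_comp _ _ _ (fun x : R => (s, x)) (fun sx : R * R => slice th1 th2 f sx.1 sx.2)).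
  have h1 : s @[y --> x] --> s by exact: cvg_cst.
  exact: (cvg_pair h1 (@cvg_id _ (nbhs x))).
exact: slice_pair_continuous.
Qed.

Lemma coef_near X s0 e : 0 < e -> \forall s \near s0, forall x, 0 <= x <= X ->
  (imu s x - imu s0 x) ^+ 2 <= e ^+ 2 /\ (srho s x - srho s0 x) ^+ 2 <= e ^+ 2.
Proof.
move=> e0.
have cimu : continuous (fun sx : R * R => imu sx.1 sx.2).
  rewrite /imu => sx; apply: (@continuousV _ _ (fun sx => slice th1 th2 mu sx.1 sx.2)).
    by rewrite /slice gt_eqF// mu_gt0.
  exact: (slice_pair_continuous mu_cont).
have h1 := continuous_unif_segment cimu X s0 e0.
have h2 := continuous_unif_segment (slice_pair_continuous rho_cont) X s0 e0.
have sq (t : R) : `|t| < e -> t ^+ 2 <= e ^+ 2.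
  by move=> te; rewrite -real_normK ?num_real// ler_sqr ?nnegrE ?(ltW e0)// ltW.
near=> s => x xX; split; apply: sq.
  by move: x xX; near: s; exact: h1.
by move: x xX; near: s; exact: h2.
Unshelve. all: by end_near. Qed.

Lemma half_line_exact eps s F :
  is_half_line_solution mu rho th1 th2 z om rgt eps s F ->
  [/\ forall X, exact_sol (imu s) (srho s) (kappa eps) X F, finite_energy F &
      Rp F 0 = 1].
Proof.
move=> [Fs R1]; split => //.
- move=> X.
  move: Fs; apply: is_solution_exact.
  + exact: interval_open.
  + by rewrite /half_line set_itvoy closure_gt => x /=; rewrite in_itv/= => /andP[].
  + by move=> x; rewrite /half_line /= !in_itv/= andbT => /andP[].
  + exact: slice_continuous.
  + exact: slice_continuous.
  + by move=> x; exact: mu_gt0.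
- have [B hB] := periodic2_bounded mu_cont mu_per.
  by apply: energy_of_H1 Fs => x; apply/andP; split; [exact: mu_gt0|exact: hB].
Qed.

Lemma cell_exact s F a b :
  is_cell_solution mu rho th1 th2 z om rgt s F a b ->
  [/\ exact_sol (imu s) (srho s) (kappa 0) th2^-1 F, Rp F 0 = a &
      Rm F th2^-1 = b].
Proof.
have L0 : 0 < th2^-1 by rewrite invr_gt0.
move=> [Fs R1 R2]; split => //; last by rewrite -R2 /cell_end /sgn mul1r.
move: Fs; apply: is_solution_exact.
- exact: interval_open.
- exact: segment_closure.
- by [].
- exact: slice_continuous.
- exact: slice_continuous.
- by move=> x; exact: mu_gt0.
Qed.

Lemma nsq_kappa eps : nsq (kappa eps) = om ^+ 4 + eps ^+ 2.
Proof. by rewrite /nsq /= -exprM. Qed.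

Lemma nsq_kappa_ge0 eps : 0 <= om ^+ 4 + eps ^+ 2.
Proof. by rewrite -nsq_kappa nsq_ge0. Qed.

(** R+(0) = 0 and a nonnegative flux force R-(0) = 0 as well, so the Cauchy data
    vanish at 0. *)
Lemma half_line_unique eps s F : 0 <= eps ->
  (forall X, exact_sol (imu s) (srho s) (kappa eps) X F) -> finite_energy F ->
  Rp F 0 = 0 -> forall x, 0 <= x -> pval F x = 0 /\ pflux F x = 0.
Proof.
move=> eps0 Fs Fe F0 x x0; apply: cauchy_norm_eq0.
have [C [C0 hA hr]] := coef_bounds.
have fl : 0 <= flux F 0.
  have r0 y : 0 < y -> 0 <= srho s y by move=> _; have /andP[] := hr s y.
  exact: (@flux_ge0 _ _ _ (kappa eps) _ r0 eps0 Fs Fe _ (lexx 0)).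
have := robin_flux z F 0; rewrite F0.
have z4 : 0 <= 4 * z * flux F 0 by rewrite !mulr_ge0// ltW.
rewrite nsq0 sub0r => Rm0; have := nsq_ge0 (Rm F 0) => Rm0'.
have {Rm0 Rm0' z4} Rm0 : nsq (Rm F 0) = 0 by lra.
have := robin_cauchy F 0 z_pos; rewrite Rm0 F0 nsq0 addr0 mulr0 => N0.
have [K K0 HK] := approx_sol_growth x0 C0 C0 (nsq_kappa_ge0 eps).
apply: le_trans (HK _ _ _ _ _ _ _ _ (exact_approx (Fs x)) x _) _ => //.
- by rewrite nsq_kappa.
- by rewrite x0 lexx.
rewrite expr0n/= addr0 pmulr_rle0//.
Qed.

Lemma coef_diff_near (k : R[i]) X s0 e : 0 < e ->
  \forall s \near s0, forall x, 0 <= x <= X ->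
  (imu s x - imu s0 x) ^+ 2 <= e ^+ 2 /\
  nsq ((srho s x)%:C * k - (srho s0 x)%:C * k) <= e ^+ 2.
Proof.
move=> e0; have k0 := nsq_ge0 k; pose l := 1 + nsq k.
have l0 : 0 < l by rewrite ltr_pwDl.
have := coef_near X s0 (divr_gt0 e0 l0); apply: filterS => s H x /H[h1 h2].
have le : (e / l) ^+ 2 * l <= e ^+ 2.
  rewrite exprMn -mulrA ler_piMr ?sqr_ge0// expr2 -mulrA mulVf ?gt_eqF// mulr1.
  by rewrite invf_le1// lerDl.
have el0 : 0 <= (e / l) ^+ 2 by rewrite sqr_ge0.
split.
  by apply: le_trans h1 (le_trans _ le); rewrite ler_peMr// lerDl.
rewrite -mulrBl -rmorphB nsqM; apply: le_trans le.
rewrite ler_pM ?nsq_ge0//; last by rewrite lerDr.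
by rewrite /nsq /= expr0n addr0.
Qed.

(** * Half-line solutions with absorption *)

Section absorption.
Context (eps : R) (u : R -> solution R).
Context (eps_gt0 : 0 < eps).
Context (u_def : forall s, is_half_line_solution mu rho th1 th2 z om rgt eps s (u s)).
Let u_exact s X := let: And3 h _ _ := half_line_exact (u_def s) in h X.
Let u_energy s := let: And3 _ h _ := half_line_exact (u_def s) in h.
Let u_robin s := let: And3 _ _ h := half_line_exact (u_def s) in h.

(** The nonnegative flux read on the Robin traces. *)
Lemma half_line_reflection s x : 0 <= x -> nsq (Rm (u s) x) <= nsq (Rp (u s) x).
Proof.
move=> x0; rewrite -subr_ge0 robin_flux !mulr_ge0 ?(ltW z_pos)//.
have [C [C0 hA hr]] := coef_bounds.
have r0 y : 0 < y -> 0 <= srho s y by move=> _; have /andP[] := hr s y.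
exact: (@flux_ge0 _ _ _ (kappa eps) _ r0 (ltW eps_gt0) (u_exact s) (u_energy s)).
Qed.

(** After one cell the medium is the one of s + delta, so the shifted solution
    is proportional to the half-line solution at s + delta; the factor is read
    off on R+. *)
Lemma half_line_shift s x : 0 <= x ->
  pval (u s) (x + th2^-1) = Rp (u s) th2^-1 * pval (u (s + dl)) x /\
  pflux (u s) (x + th2^-1) = Rp (u s) th2^-1 * pflux (u (s + dl)) x.
Proof.
move=> x0; have L0 : 0 <= th2^-1 by rewrite invr_ge0 ltW.
pose p := Rp (u s) th2^-1.
pose F := lincomb 1 (shift_sol th2^-1 (u s)) (- p) (u (s + dl)).
have Fs X : exact_sol (imu (s + dl)) (srho (s + dl)) (kappa eps) X F.
  apply: exact_sol_lincomb => //.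
  have := exact_sol_shift L0 (u_exact s (X + th2^-1)).
  under eq_fun do rewrite imu_shift; under [X in exact_sol _ X]eq_fun do rewrite srho_shift.
  exact.
have Fe : finite_energy F.
  by apply: finite_energy_lincomb => //; exact: finite_energy_shift.
have F0 : Rp F 0 = 0.
  by rewrite robin_plus_lincomb u_robin mul1r mulr1 /Robin_plus /= add0r subrr.
have [] := half_line_unique (ltW eps_gt0) Fs Fe F0 x0.
rewrite /F /= !mul1r !mulNr => /eqP; rewrite subr_eq0 => /eqP ->.
by move=> /eqP; rewrite subr_eq0 => /eqP ->.
Qed.

(** The media of s and s + 1 coincide. *)
Lemma half_line_per s x : 0 <= x ->
  pval (u (s + 1)) x = pval (u s) x /\ pflux (u (s + 1)) x = pflux (u s) x.
Proof.
move=> x0; pose F := lincomb 1 (u (s + 1)) (- 1) (u s).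
have Fs X : exact_sol (imu s) (srho s) (kappa eps) X F.
  apply: exact_sol_lincomb => //.
  by have := u_exact (s + 1) X; rewrite imu_per srho_per.
have Fe : finite_energy F by exact: finite_energy_lincomb.
have F0 : Rp F 0 = 0.
  by rewrite robin_plus_lincomb !u_robin mul1r mulr1 subrr.
have [] := half_line_unique (ltW eps_gt0) Fs Fe F0 x0.
rewrite /F /= !mul1r !mulN1r => /eqP; rewrite subr_eq0 => /eqP ->.
by move=> /eqP; rewrite subr_eq0 => /eqP ->.
Qed.

Section eigen.
Context (lam : R[i]) (f : R -> R[i]).
Context (f_eigen : is_fundamental_eigenpair th1 th2 z rgt u lam f).

Lemma eigen_neq0 s : f s != 0.
Proof. by have [_ [_ _ ->]] := f_eigen. Qed.

(** The eigenvalue equation at s + delta, solved for the multiplier p(s). *)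
Lemma eigen_robin s : Rp (u s) th2^-1 = lam * f (s + dl) / f s.
Proof.
have [_ _ _ _ /(_ (s + dl))] := f_eigen.
rewrite /Peps /wshift /sdelta /cell_end /sgn !mul1r addrK => <-.
by rewrite mulfK// eigen_neq0.
Qed.

(** The products of the multipliers along the orbit of s telescope. *)
Lemma half_line_cell n s x : 0 <= x ->
  pval (u s) (x + n%:R * th2^-1) =
    lam ^+ n * (f (s + n%:R * dl) / f s) * pval (u (s + n%:R * dl)) x /\
  pflux (u s) (x + n%:R * th2^-1) =
    lam ^+ n * (f (s + n%:R * dl) / f s) * pflux (u (s + n%:R * dl)) x.
Proof.
move=> x0; elim: n s => [|n IH] s.
  by rewrite !mul0r !addr0 expr0 divff ?eigen_neq0// !mul1r.
have xn : 0 <= x + n%:R * th2^-1 by rewrite addr_ge0// mulr_ge0// invr_ge0 ltW.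
have [h1 h2] := half_line_shift s xn; have [h3 h4] := IH (s + dl).
have E : s + n.+1%:R * dl = s + dl + n%:R * dl by rewrite -natr1; ring.
have E' : x + n.+1%:R * th2^-1 = x + n%:R * th2^-1 + th2^-1 by rewrite -natr1; ring.
rewrite E E' h1 h2 h3 h4 eigen_robin exprS.
have n1 := eigen_neq0 s; have n2 := eigen_neq0 (s + dl).
by split; field; rewrite n1 n2.
Qed.

(** The factor phi(s + n delta) / phi(s) is bounded because phi is periodic and
    does not vanish, so the decay is geometric and uniform in s. This plays the
    role of a boundary condition at infinity in the continuity with respect to
    s. *)
Lemma half_line_decay : exists2 C, 0 <= C & forall n s,
  nsq (Rm (u s) (n%:R * th2^-1)) <= nsq lam ^+ n * C.
Proof.
have [_ fN _ _ _] := f_eigen; have [C C0 hC] := Nper_bounds fN.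
exists C => // n s; have n0 : 0 <= n%:R * th2^-1 by rewrite mulr_ge0// invr_ge0 ltW.
apply: le_trans (half_line_reflection s n0) _.
have [] := half_line_cell n s (lexx 0); rewrite add0r => h1 h2.
have -> : Rp (u s) (n%:R * th2^-1) =
    lam ^+ n * (f (s + n%:R * dl) / f s) * Rp (u (s + n%:R * dl)) 0.
  by rewrite /Robin_plus h1 h2; ring.
rewrite u_robin mulr1 nsqM nsqX; by rewrite ler_wpM2l// exprn_ge0// nsq_ge0.
Qed.

(** Compare u_s and u_(s0) on a long segment of n cells: their difference has
    R+(0) = 0 and, by [half_line_decay], a small R- at the other end, while its
    residual is small for s near s0. The energy balance bounds its Cauchy data
    at 0, and Gronwall its values on [0, X]. The number n of cells is chosen
    first, then the neighbourhood of s0. *)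
Lemma half_line_continuous s0 X e : 0 <= X -> 0 < e -> \forall s \near s0,
  forall x, 0 <= x <= X -> cauchy_norm (lincomb 1 (u s) (-1) (u s0)) x <= e.
Proof.
move=> X0 e0; have [C [C0 hA hr]] := coef_bounds.
have [KX KX0 growX] := approx_sol_growth X0 C0 C0 (nsq_kappa_ge0 eps).
pose Cz := 1 + z ^- 2.
have Cz0 : 0 < Cz by rewrite ltr_pwDl// invr_ge0 sqr_ge0.
have [Cf Cf0 decay] := half_line_decay.
have q1 : nsq lam < 1.
  by have [l1 _ _ _ _] := f_eigen; rewrite -modc_sqr expr_lt1// modc_ge0.
have [n hn] : exists n, KX * (Cz * (4 * (nsq lam ^+ n * Cf))) <= e / 2.
  have : (fun n => KX * (Cz * (4 * (nsq lam ^+ n * Cf)))) @ \oo --> 0.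
    rewrite -[X in _ --> X](_ : KX * (Cz * (4 * (0 * Cf))) = 0); last by rewrite mul0r !mulr0.
    do 3 (apply: cvgM; first exact: cvg_cst).
    by apply: cvgM; [apply: cvg_expr; rewrite ger0_norm// nsq_ge0|exact: cvg_cst].
  move=> /cvgrPdist_lt /(_ (e / 2)) []; first by rewrite divr_gt0.
  move=> N _ /(_ N (leqnn N)); rewrite sub0r normrN => h; exists N.
  exact: le_trans (ler_norm _) (ltW h).
pose Ln := n%:R * th2^-1.
have Ln0 : 0 <= Ln by rewrite mulr_ge0// invr_ge0 ltW.
have [Kn Kn0 grown] := approx_sol_growth Ln0 C0 C0 (nsq_kappa_ge0 eps).
have bound s x : 0 <= x <= Ln -> cauchy_norm (u s) x <= Kn * (2 * Cz).
  move=> xL; have := grown _ _ _ _ _ _ _ _ (exact_approx (u_exact s Ln)) x xL.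
  rewrite nsq_kappa lexx expr0n/= addr0 => /(_ (fun y _ => hA s y) (fun y _ => hr s y) isT).
  move=> /le_trans; apply; rewrite ler_wpM2l ?(ltW Kn0)//.
  apply: le_trans (robin_cauchy _ _ z_pos) _; rewrite -/Cz mulrC ler_wpM2r ?(ltW Cz0)//.
  have := half_line_reflection s (lexx 0); rewrite u_robin nsq1.
  by lra.
(* an a priori bound of the difference on the n cells, independent of s *)
pose M' := 8 * (Kn * Cz) + 1.
have KC0 : 0 <= Kn * Cz by rewrite mulr_ge0// ltW.
have M'0 : 0 <= M' by rewrite addr_ge0// mulr_ge0.
pose Y := Num.max X Ln.
have XY : X <= Y by rewrite le_max lexx.
have LY : Ln <= Y by rewrite le_max lexx orbT.
have [M M0 hM] := exact_sol_bounded (le_trans X0 XY) (u_exact s0 Y).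
pose T := KX * (Cz * (8 * z * (M * M' * Ln)) + M ^+ 2).
have T0 : 0 <= T.
  apply: mulr_ge0; first exact: ltW.
  apply: addr_ge0; last exact: sqr_ge0.
  apply: mulr_ge0; first exact: ltW.
  apply: mulr_ge0; first by rewrite mulr_ge0// ltW.
  by apply: mulr_ge0 => //; exact: mulr_ge0.
(* the tolerance on the coefficients, chosen after n *)
have e20 : 0 < e / 2 by rewrite divr_gt0.
have [e1 /andP[e10 e11] e1T] := small_factor T0 e20.
have := coef_diff_near (kappa eps) Y s0 e10; apply: filterS => s Hs x xX.
pose D := lincomb 1 (u s) (-1) (u s0); rewrite -/D.
have DY : approx_sol (imu s) (srho s) (kappa eps) (e1 * M) Y D.
  apply: exact_sol_diff (u_exact s Y) (u_exact s0 Y) _ _ _ => t /andP[/ltW t0 /ltW tY].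
  - by have [] := Hs t; rewrite ?t0.
  - by have [] := Hs t; rewrite ?t0.
  - by apply: hM; rewrite t0.
have D0 : Rp D 0 = 0 by rewrite robin_plus_lincomb !u_robin !mulr1 subrr.
have r0 t : 0 < t < Ln -> 0 <= srho s t by move=> _; have /andP[] := hr s t.
have DM t : 0 < t < Ln -> cauchy_norm D t <= M' ^+ 2.
  move=> /andP[/ltW t0 /ltW tL]; apply: le_trans (cauchy_norm_diff _ _ _) _.
  have := bound s t; have := bound s0 t; rewrite t0 tL => /(_ isT) h1 /(_ isT) h2.
  rewrite /M'; nra.
have e1M0 : 0 <= e1 * M by rewrite mulr_ge0// ltW.
have := @robin_reflection _ _ _ _ (kappa eps) _ _ _ _ z_pos Ln0 e1M0 M'0 (ltW eps_gt0) r0 DM (approx_solW LY DY).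
rewrite D0 nsq0 add0r => refl.
have RmL : nsq (Rm D Ln) <= 4 * (nsq lam ^+ n * Cf).
  rewrite robin_minus_lincomb; apply: le_trans (nsqD _ _) _.
  rewrite !nsqM nsqN nsq1 !mul1r.
  by have := decay n s; have := decay n s0; rewrite -/Ln; lra.
have N0 := robin_cauchy D 0 z_pos; rewrite D0 nsq0 add0r -/Cz in N0.
have := growX _ _ _ _ _ _ _ _ (approx_solW XY DY) x xX.
rewrite nsq_kappa lexx => /(_ (fun y _ => hA s y) (fun y _ => hr s y) isT).
move=> /le_trans; apply.
have Rm0 : nsq (Rm D 0) <= 4 * (nsq lam ^+ n * Cf) + 8 * z * (e1 * M * M' * Ln).
  by have := nsq_ge0 (Rp D Ln); lra.
have ND0 : cauchy_norm D 0 <=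
    Cz * (4 * (nsq lam ^+ n * Cf)) + Cz * (8 * z * (e1 * M * M' * Ln)).
  by apply: le_trans N0 _; rewrite -mulrDr ler_wpM2l ?(ltW Cz0).
have e1M2 : (e1 * M) ^+ 2 <= e1 * M ^+ 2.
  by rewrite exprMn ler_wpM2r ?sqr_ge0// expr2 ler_piMl// ltW.
apply: (@le_trans _ _ (KX * (Cz * (4 * (nsq lam ^+ n * Cf)) + Cz * (8 * z * (e1 * M * M' * Ln)) + e1 * M ^+ 2))).
  by rewrite ler_wpM2l ?(ltW KX0)// lerD.
have -> : KX * (Cz * (4 * (nsq lam ^+ n * Cf)) + Cz * (8 * z * (e1 * M * M' * Ln)) + e1 * M ^+ 2) = KX * (Cz * (4 * (nsq lam ^+ n * Cf))) + e1 * T.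
  by rewrite /T; ring.
by rewrite [leRHS](splitr e) lerD.
Qed.

End eigen.

End absorption.

(** * Cell solutions without absorption *)

Let L0 : 0 <= th2^-1. Proof. by rewrite invr_ge0 ltW. Qed.

Let O0L : 0 <= (0 : R) <= th2^-1. Proof. by rewrite L0 lexx. Qed.

(** The stability estimate with zero entering traces. *)
Lemma cell_unique s F : exact_sol (imu s) (srho s) (kappa 0) th2^-1 F ->
  Rp F 0 = 0 -> Rm F th2^-1 = 0 ->
  forall x, 0 <= x <= th2^-1 -> pval F x = 0 /\ pflux F x = 0.
Proof.
move=> Fs F0 FL x xL; apply: cauchy_norm_eq0.
have [C [C0 hA hr]] := coef_bounds.
have [K K0 HK] := robin_stability_exact z_pos L0 C0 C0 (nsq_kappa_ge0 0).
have := HK (imu s) (srho s) (kappa 0) F (fun y _ => hA s y) (fun y _ => hr s y).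
rewrite nsq_kappa lexx => /(_ isT (lexx 0) Fs x xL).
by rewrite F0 FL nsq0 addr0 mulr0.
Qed.

Section cell.
Context (e : R -> solution R) (a b : R[i]).
Context (e_def : forall s, is_cell_solution mu rho th1 th2 z om rgt s (e s) a b).
Let e_exact s := let: And3 h _ _ := cell_exact (e_def s) in h.
Let e_plus s := let: And3 _ h _ := cell_exact (e_def s) in h.
Let e_minus s := let: And3 _ _ h := cell_exact (e_def s) in h.

Lemma cell_per s x : 0 <= x <= th2^-1 ->
  pval (e (s + 1)) x = pval (e s) x /\ pflux (e (s + 1)) x = pflux (e s) x.
Proof.
move=> xL; pose F := lincomb 1 (e (s + 1)) (- 1) (e s).
have Fs : exact_sol (imu s) (srho s) (kappa 0) th2^-1 F.
  apply: exact_sol_lincomb => //.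
  by have := e_exact (s + 1); rewrite imu_per srho_per.
have F0 : Rp F 0 = 0.
  by rewrite robin_plus_lincomb !e_plus mul1r mulN1r subrr.
have FL : Rm F th2^-1 = 0.
  by rewrite robin_minus_lincomb !e_minus mul1r mulN1r subrr.
have [] := cell_unique Fs F0 FL xL.
rewrite /F /= !mul1r !mulN1r => /eqP; rewrite subr_eq0 => /eqP ->.
by move=> /eqP; rewrite subr_eq0 => /eqP ->.
Qed.

Lemma cell_bounded : exists2 B, 0 <= B & forall s x, 0 <= x <= th2^-1 ->
  cauchy_norm (e s) x <= B.
Proof.
have [C [C0 hA hr]] := coef_bounds.
have [K K0 HK] := robin_stability_exact z_pos L0 C0 C0 (nsq_kappa_ge0 0).
exists (K * (nsq a + nsq b)).
  by rewrite mulr_ge0 ?(ltW K0)// addr_ge0// nsq_ge0.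
move=> s x xL.
have := HK (imu s) (srho s) (kappa 0) (e s) (fun y _ => hA s y) (fun y _ => hr s y).
rewrite nsq_kappa lexx => /(_ isT (lexx 0) (e_exact s) x xL).
by rewrite e_plus e_minus.
Qed.

(** The difference of the solutions at s and s0 has zero entering traces and a
    small residual. *)
Lemma cell_continuous s0 h : 0 < h -> \forall s \near s0,
  forall x, 0 <= x <= th2^-1 -> cauchy_norm (lincomb 1 (e s) (-1) (e s0)) x <= h.
Proof.
move=> h0; have [C [C0 hA hr]] := coef_bounds.
have [K K0 HK] := robin_stability z_pos L0 C0 C0 (nsq_kappa_ge0 0).
have [B B0 hB] := cell_bounded.
pose M := B + 1; pose M' := 4 * B + 1.
have M0 : 0 <= M by rewrite addr_ge0.
have M'0 : 0 <= M' by rewrite addr_ge0// mulr_ge0.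
have T0 : 0 <= K * (M * M' + M ^+ 2).
  apply: mulr_ge0; first exact: ltW.
  by apply: addr_ge0; [exact: mulr_ge0|exact: sqr_ge0].
have [e1 /andP[e10 e11] e1T] := small_factor T0 h0.
have := coef_diff_near (kappa 0) th2^-1 s0 e10; apply: filterS => s Hs x xL.
pose D := lincomb 1 (e s) (-1) (e s0); rewrite -/D.
have DL : approx_sol (imu s) (srho s) (kappa 0) (e1 * M) th2^-1 D.
  apply: exact_sol_diff (e_exact s) (e_exact s0) _ _ _ => t /andP[/ltW t0 /ltW tY].
  - by have [] := Hs t; rewrite ?t0.
  - by have [] := Hs t; rewrite ?t0.
  - by apply: le_trans (hB _ _ _) (le_sqr_succ B0); rewrite t0.
have DM t : 0 < t < th2^-1 -> cauchy_norm D t <= M' ^+ 2.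
  move=> /andP[/ltW t0 /ltW tL]; apply: le_trans (cauchy_norm_diff _ _ _) _.
  have tt : 0 <= t <= th2^-1 by rewrite t0.
  apply: (@le_trans _ _ (4 * B)); last by apply: le_sqr_succ; rewrite mulr_ge0.
  by have := hB s t tt; have := hB s0 t tt; lra.
have D0 : Rp D 0 = 0.
  by rewrite robin_plus_lincomb !e_plus mul1r mulN1r subrr.
have DL0 : Rm D th2^-1 = 0.
  by rewrite robin_minus_lincomb !e_minus mul1r mulN1r subrr.
have e1M0 : 0 <= e1 * M by rewrite mulr_ge0// ltW.
have := HK (imu s) (srho s) (kappa 0) (e1 * M) M' D (fun y _ => hA s y) (fun y _ => hr s y).
rewrite nsq_kappa lexx => /(_ isT (lexx 0) e1M0 M'0 DM DL x xL).
move=> /le_trans; apply; apply: le_trans e1T.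
rewrite D0 DL0 nsq0 !add0r.
have -> : e1 * (K * (M * M' + M ^+ 2)) = K * (e1 * M * M' + e1 * M ^+ 2) by ring.
rewrite ler_wpM2l ?(ltW K0)// lerD2l exprMn ler_wpM2r ?sqr_ge0//.
by rewrite expr2 ler_piMl// ltW.
Qed.

End cell.

(** * The limit modes and the flux density *)

Section limit.
Context (u : R -> R -> solution R).
Context (u_def : forall eps s, 0 < eps ->
  is_half_line_solution mu rho th1 th2 z om rgt eps s (u eps s)).
Context (lamE : R -> R[i]) (phiE : R -> R -> R[i]).
Context (eigen_def : forall eps, 0 < eps ->
  is_fundamental_eigenpair th1 th2 z rgt (u eps) (lamE eps) (phiE eps)).
Context (e0 e1 : R -> solution R).
Context (e0_def : forall s, is_cell_solution mu rho th1 th2 z om rgt s (e0 s) 1 0).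
Context (e1_def : forall s, is_cell_solution mu rho th1 th2 z om rgt s (e1 s) 0 1).
Context (eps : nat -> R) (lam0 : R[i]) (phi0 psi0 : R -> R[i]).
Context (eps_gt0 : forall j, 0 < eps j) (eps_cvg : eps j @[j --> \oo] --> 0).
Context (lam_cvg : modc (lamE (eps j) - lam0) @[j --> \oo] --> 0).
Context (phi0_cont : ccontinuous_on setT phi0) (phi0_per : periodic1 phi0).
Context (psi0_cont : ccontinuous_on setT psi0) (psi0_per : periodic1 psi0).
Context (phi_cvg : converges_uniformly (fun j => phiE (eps j)) phi0).
Context (psi_cvg : converges_uniformly
  (fun j => Seps th1 th2 z rgt (u (eps j)) (phiE (eps j))) psi0).

Let Q := flux_density th1 th2 z rgt e0 e1 phi0 psi0.

(** The limit w_s of phi_eps(s) u_(s, eps) on the first cell. *)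
Definition limit_mode s : solution R :=
  lincomb (phi0 s) (e0 s) (psi0 (s + dl)) (e1 s).

(** phi_eps(s) u_(s, eps), written as a linear combination so that the lemmas on
    linear combinations apply. *)
Definition absorbing_mode j s : solution R :=
  lincomb (phiE (eps j) s) (u (eps j) s) 0 (u (eps j) s).

Let e0_exact s := let: And3 h _ _ := cell_exact (e0_def s) in h.
Let e0_plus s := let: And3 _ h _ := cell_exact (e0_def s) in h.
Let e0_minus s := let: And3 _ _ h := cell_exact (e0_def s) in h.
Let e1_exact s := let: And3 h _ _ := cell_exact (e1_def s) in h.
Let e1_plus s := let: And3 _ h _ := cell_exact (e1_def s) in h.
Let e1_minus s := let: And3 _ _ h := cell_exact (e1_def s) in h.
Let u_exact j s X := let: And3 h _ _ := half_line_exact (u_def s (eps_gt0 j)) in h X.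
Let u_plus j s := let: And3 _ _ h := half_line_exact (u_def s (eps_gt0 j)) in h.

Lemma limit_mode_exact s : exact_sol (imu s) (srho s) (kappa 0) th2^-1 (limit_mode s).
Proof. exact: exact_sol_lincomb. Qed.

Lemma limit_mode_plus s : Rp (limit_mode s) 0 = phi0 s.
Proof. by rewrite robin_plus_lincomb e0_plus e1_plus mulr1 mulr0 addr0. Qed.

Lemma limit_mode_minus s : Rm (limit_mode s) th2^-1 = psi0 (s + dl).
Proof. by rewrite robin_minus_lincomb e0_minus e1_minus mulr1 mulr0 add0r. Qed.

Lemma absorbing_mode_plus j s : Rp (absorbing_mode j s) 0 = phiE (eps j) s.
Proof. by rewrite robin_plus_lincomb u_plus mulr1 mul0r addr0. Qed.

Lemma absorbing_mode_minus j s : Rm (absorbing_mode j s) th2^-1 =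
  Seps th1 th2 z rgt (u (eps j)) (phiE (eps j)) (s + dl).
Proof.
rewrite robin_minus_lincomb mul0r addr0 /Seps /wshift /sdelta /cell_end /sgn !mul1r.
by rewrite addrK mulrC.
Qed.

Lemma limit_mode_bounded : exists2 B, 0 <= B & forall s x, 0 <= x <= th2^-1 ->
  cauchy_norm (limit_mode s) x <= B.
Proof.
have [B0 B00 hB0] := cell_bounded e0_def; have [B1 B10 hB1] := cell_bounded e1_def.
have [C0 C00 hC0] := cper_bounded phi0_cont phi0_per.
have [C1 C10 hC1] := cper_bounded psi0_cont psi0_per.
exists (2 * (C0 * B0 + C1 * B1)).
  by apply: mulr_ge0 => //; apply: addr_ge0; exact: mulr_ge0.
move=> s x xL; apply: le_trans (cauchy_norm_lincomb _ _ _ _ _) _.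
rewrite ler_wpM2l// lerD//.
  by rewrite ler_pM ?nsq_ge0 ?cauchy_norm_ge0//; exact: hB0.
by rewrite ler_pM ?nsq_ge0 ?cauchy_norm_ge0//; exact: hB1.
Qed.

(** The entering traces of the difference are phi_eps - phi0 at s and psi_eps -
    psi0 at s + delta, and the residual comes from the absorption only: all
    three are small uniformly in s. *)
Lemma mode_cvg h : 0 < h -> \forall j \near \oo, forall s x, 0 <= x <= th2^-1 ->
  cauchy_norm (lincomb 1 (absorbing_mode j s) (-1) (limit_mode s)) x <= h.
Proof.
move=> h0; have [C [C0 hA hr]] := coef_bounds.
have [K K0 HK] := robin_stability z_pos L0 C0 C0 (nsq_kappa_ge0 1).
have [K' K'0 HK'] := robin_stability_exact z_pos L0 C0 C0 (nsq_kappa_ge0 1).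
have [Bw Bw0 hBw] := limit_mode_bounded.
have [C1 C10 hC1] := cper_bounded phi0_cont phi0_per.
have [C2 C20 hC2] := cper_bounded psi0_cont psi0_per.
pose Bv := K' * (2 * (1 + C1) + 2 * (1 + C2)).
have Bv0 : 0 <= Bv.
  apply: mulr_ge0; first exact: ltW.
  by apply: addr_ge0; apply: mulr_ge0 => //; exact: addr_ge0.
have BB0 : 0 <= 2 * (Bv + Bw) by apply: mulr_ge0 => //; exact: addr_ge0.
pose M := Bw + 1; pose M' := 2 * (Bv + Bw) + 1.
have M0 : 0 <= M by rewrite addr_ge0.
have M'0 : 0 <= M' by rewrite addr_ge0.
have CM0 : 0 <= C * M by exact: mulr_ge0.
have T0 : 0 <= K * (2 + C * M * M' + (C * M) ^+ 2).
  apply: mulr_ge0; first exact: ltW.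
  by apply: addr_ge0; [apply: addr_ge0 => //; exact: mulr_ge0|exact: sqr_ge0].
have [t /andP[t0 t1] tT] := small_factor T0 h0.
have n1 := converges_uniformly_nsq phi_cvg t0.
have n2 := converges_uniformly_nsq psi_cvg t0.
have n3 : \forall j \near \oo, eps j <= t.
  move/cvgrPdist_lt : eps_cvg => /(_ t t0); apply: filterS => j.
  by rewrite sub0r normrN ger0_norm ?(ltW (eps_gt0 j))// => /ltW.
near=> j => s x xL.
have phij r : nsq (phiE (eps j) r - phi0 r) <= t by move: r; near: j; exact: n1.
have psij r : nsq (Seps th1 th2 z rgt (u (eps j)) (phiE (eps j)) r - psi0 r) <= t.
  by move: r; near: j; exact: n2.
have epsj : eps j <= t by near: j; exact: n3.
have epsj0 := eps_gt0 j.
pose V := absorbing_mode j s; pose W := limit_mode s; pose D := lincomb 1 V (-1) W.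
rewrite -/V -/W -/D.
have kj : nsq (kappa (eps j)) <= om ^+ 4 + 1 ^+ 2.
  by rewrite nsq_kappa lerD2l ler_sqr ?nnegrE ?(ltW epsj0)// (le_trans epsj).
have Vs : exact_sol (imu s) (srho s) (kappa (eps j)) th2^-1 V by exact: exact_sol_lincomb.
have DL : approx_sol (imu s) (srho s) (kappa (eps j)) (C * eps j * M) th2^-1 D.
  apply: exact_sol_diff Vs (limit_mode_exact s) _ _ _ => y /andP[/ltW y0 /ltW yL].
  - by rewrite subrr expr0n sqr_ge0.
  - rewrite -mulrBr nsqM exprMn.
    have -> : nsq (kappa (eps j) - kappa 0) = eps j ^+ 2.
      by rewrite /nsq /= subrr expr0n add0r subr0.
    rewrite ler_wpM2r ?sqr_ge0// /nsq /= expr0n addr0.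
    by have /andP[r0 rC] := hr s y; rewrite ler_sqr ?nnegrE.
  - by apply: le_trans (hBw _ _ _) (le_sqr_succ Bw0); rewrite y0.
have close (a b : R[i]) (B : R) : nsq (a - b) <= t -> nsq b <= B -> nsq a <= 2 * (1 + B).
  move=> ab bB; have := nsqD (a - b) b; rewrite subrK => /le_trans; apply.
  by rewrite ler_wpM2l// lerD// (le_trans ab).
have VM y : 0 <= y <= th2^-1 -> cauchy_norm V y <= Bv.
  move=> yL; have := HK' (imu s) (srho s) (kappa (eps j)) V (fun y _ => hA s y) (fun y _ => hr s y).
  move=> /(_ kj (ltW epsj0) Vs y yL) /le_trans; apply; rewrite ler_wpM2l ?(ltW K'0)//.
  rewrite /V absorbing_mode_plus absorbing_mode_minus lerD//.
    exact: close (phij s) (hC1 s).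
  exact: close (psij (s + dl)) (hC2 _).
have DM y : 0 < y < th2^-1 -> cauchy_norm D y <= M' ^+ 2.
  move=> /andP[/ltW y0 /ltW yL]; apply: le_trans (cauchy_norm_diff _ _ _) _.
  apply: le_trans (le_sqr_succ BB0); rewrite ler_wpM2l// lerD//.
    by apply: VM; rewrite y0.
  by apply: hBw; rewrite y0.
have eta0 : 0 <= C * eps j * M.
  by apply: mulr_ge0 => //; apply: mulr_ge0 => //; exact: ltW.
have := HK (imu s) (srho s) (kappa (eps j)) _ M' D (fun y _ => hA s y) (fun y _ => hr s y).
move=> /(_ _ kj (ltW epsj0) eta0 M'0 DM DL x xL) /le_trans; apply; apply: le_trans tT.
have D0 : nsq (Rp D 0) <= t.
  rewrite robin_plus_lincomb absorbing_mode_plus limit_mode_plus mul1r mulN1r.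
  exact: phij.
have DL0 : nsq (Rm D th2^-1) <= t.
  rewrite robin_minus_lincomb absorbing_mode_minus limit_mode_minus mul1r mulN1r.
  exact: psij.
have -> : t * (K * (2 + C * M * M' + (C * M) ^+ 2)) =
  K * (t + t + t * (C * M * M') + t * (C * M) ^+ 2) by ring.
rewrite ler_wpM2l ?(ltW K0)//.
have -> : C * eps j * M = eps j * (C * M) by ring.
apply: lerD; [apply: lerD; [exact: lerD|]|].
  rewrite -mulrA ler_wpM2r//; exact: mulr_ge0.
rewrite exprMn ler_wpM2r ?sqr_ge0// (le_trans _ epsj)// expr2 ler_piMl ?(ltW epsj0)//.
exact: le_trans t1.
Unshelve. all: by end_near. Qed.

Lemma lam_ccvg : ccvg (fun j => lamE (eps j)) lam0.
Proof.
apply: ccvg_nsq => h h0; have t0 : 0 < Num.min 1 h by rewrite lt_min ltr01.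
move/cvgrPdist_lt : lam_cvg => /(_ _ t0); apply: filterS => j.
by rewrite sub0r normrN ger0_norm ?modc_ge0// => /nsq_modc.
Qed.

Lemma mode_pointwise_cvg s x : 0 <= x <= th2^-1 ->
  ccvg (fun j => pval (absorbing_mode j s) x) (pval (limit_mode s) x) /\
  ccvg (fun j => pflux (absorbing_mode j s) x) (pflux (limit_mode s) x).
Proof.
by move=> xL; split; apply: ccvg_nsq => h h0; apply: filterS (mode_cvg h0) => j;
  move=> /(_ s x xL)/cauchy_norm_diff_small[].
Qed.

Lemma absorbing_mode_shift j s :
  pval (absorbing_mode j s) th2^-1 = lamE (eps j) * pval (absorbing_mode j (s + dl)) 0 /\
  pflux (absorbing_mode j s) th2^-1 = lamE (eps j) * pflux (absorbing_mode j (s + dl)) 0.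
Proof.
have ej := eps_gt0 j.
have [] := half_line_cell ej (fun s => u_def s ej) (eigen_def ej) 1 s (lexx 0).
rewrite add0r !mul1r expr1 /absorbing_mode /= => -> ->.
have fs := eigen_neq0 (eigen_def ej) s; rewrite !mul0r !addr0.
by split; field.
Qed.

(** The limit of the corresponding relation with absorption; it says that w_s
    continues as lam0 w_(s + delta) in the next cell. *)
Lemma limit_mode_shift s :
  pval (limit_mode s) th2^-1 = lam0 * pval (limit_mode (s + dl)) 0 /\
  pflux (limit_mode s) th2^-1 = lam0 * pflux (limit_mode (s + dl)) 0.
Proof.
have L0L : 0 <= th2^-1 <= th2^-1 by rewrite L0 lexx.
have [p1 q1] := mode_pointwise_cvg s L0L.
have [p2 q2] := mode_pointwise_cvg (s + dl) O0L.
split.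
- apply: ccvg_unique p1 _; rewrite (_ : (fun _ => _) = (fun j => lamE (eps j) *
    pval (absorbing_mode j (s + dl)) 0)); first exact: ccvgM lam_ccvg p2.
  by apply/funext => j; have [] := absorbing_mode_shift j s.
- apply: ccvg_unique q1 _; rewrite (_ : (fun _ => _) = (fun j => lamE (eps j) *
    pflux (absorbing_mode j (s + dl)) 0)); first exact: ccvgM lam_ccvg q2.
  by apply/funext => j; have [] := absorbing_mode_shift j s.
Qed.

(** By definition Q_s is |R+|^2 - |R-|^2 for the traces at 0 of w_s. *)
Lemma flux_density_eq s : Q s = 4 * z * flux (limit_mode s) 0.
Proof.
rewrite -robin_flux limit_mode_plus robin_minus_lincomb /Q /flux_density /tcoef.
rewrite /sdelta /sgn mul1r /nsq.
move: (phi0 s) (psi0 (s + dl)) (Rm (e0 s) 0) (Rm (e1 s) 0) => [a b] [c d] [a' b'] [c' d'] /=.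
by ring.
Qed.

(** Without absorption the flux of w_s is the same at both ends of the cell. *)
Lemma flux_density_shift s : Q s = nsq lam0 * Q (s + dl).
Proof.
rewrite !flux_density_eq -(flux_conserved L0 _ (limit_mode_exact s))//.
have [h1 h2] := limit_mode_shift s; rewrite /flux h1 h2 /nsq.
move: (pval _ _) (pflux _ _) (lam0) => [a b] [c d] [l l'] /=.
by ring.
Qed.

(** A limit of fluxes of half-line solutions, which are nonnegative. *)
Lemma flux_density_ge0 s : 0 <= Q s.
Proof.
rewrite flux_density_eq mulr_ge0 ?mulr_ge0 ?(ltW z_pos)//.
have [[p1 p2] [q1 q2]] := mode_pointwise_cvg s O0L.
have fc : flux (absorbing_mode j s) 0 @[j --> \oo] --> flux (limit_mode s) 0.
  by apply: cvgB; apply: cvgM.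
rewrite -(cvg_lim _ fc)//; apply: limr_ge; first by apply/cvg_ex; eexists; exact: fc.
apply: nearW => j.
have := half_line_reflection (eps_gt0 j) (fun s => u_def s (eps_gt0 j)) s (lexx 0).
rewrite -subr_ge0 robin_flux pmulr_rge0 ?mulr_gt0// => H.
have -> : flux (absorbing_mode j s) 0 = nsq (phiE (eps j) s) * flux (u (eps j) s) 0.
  rewrite /flux /absorbing_mode /= !mul0r !addr0 /nsq.
  by move: (pval _ _) (pflux _ _) (phiE _ _) => [a b] [c d] [l l'] /=; ring.
by rewrite mulr_ge0// nsq_ge0.
Qed.

(** |R-|^2 is dropped from |R+|^2 - |R-|^2. *)
Lemma flux_density_le s : Q s <= nsq (phi0 s).
Proof.
by rewrite flux_density_eq -robin_flux limit_mode_plus gerBl nsq_ge0.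
Qed.

Lemma flux_density_per s : Q (s + 1) = Q s.
Proof.
have [h1 h2] := cell_per e0_def s O0L; have [h3 h4] := cell_per e1_def s O0L.
by rewrite !flux_density_eq /flux /limit_mode /= h1 h2 h3 h4 phi0_per addrAC psi0_per.
Qed.

Lemma cell_continuous_in_slice (e : R -> solution R) (a b : R[i]) x :
  (forall s, is_cell_solution mu rho th1 th2 z om rgt s (e s) a b) ->
  0 <= x <= th2^-1 ->
  ccontinuous_on setT (fun s => pval (e s) x) /\
  ccontinuous_on setT (fun s => pflux (e s) x).
Proof.
by move=> e_def xL; split; apply: ccontinuous_nsq => s0 h h0;
  apply: filterS (cell_continuous e_def s0 h0) => s /(_ x xL)/cauchy_norm_diff_small[].
Qed.

Lemma limit_mode_continuous x : 0 <= x <= th2^-1 ->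
  ccontinuous_on setT (fun s => pval (limit_mode s) x) /\
  ccontinuous_on setT (fun s => pflux (limit_mode s) x).
Proof.
move=> xL; have [p0 q0] := cell_continuous_in_slice e0_def xL.
have [p1 q1] := cell_continuous_in_slice e1_def xL.
by split; apply: ccontinuousD; apply: ccontinuousM => //; exact: ccontinuous_shift.
Qed.

Lemma flux_density_continuous : continuous Q.
Proof.
have [[p1 p2] [q1 q2]] := limit_mode_continuous O0L.
have -> : Q = (fun s => 4 * z * flux (limit_mode s) 0).
  by apply/funext => s; exact: flux_density_eq.
apply: contM; first exact: cont_cst.
by apply: contB; apply: contM; exact/continuous_subspace_setT.
Qed.

Context (Q_neq0 : Q 0 != 0) (dl_irr : irrational dl).

Lemma flux_density_gt0 : 0 < Q 0.
Proof. by rewrite lt_neqAle eq_sym Q_neq0 flux_density_ge0. Qed.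

(** |lam0| <= 1 as a limit. If |lam0| < 1, iterating [flux_density_shift] would
    give Q_0 = |lam0|^(2n) Q_(n delta), which tends to 0 because Q is bounded.
    *)
Lemma lam0_norm : nsq lam0 = 1.
Proof.
have le1 : nsq lam0 <= 1.
  have [l1 l2] := lam_ccvg.
  have lc : nsq (lamE (eps j)) @[j --> \oo] --> nsq lam0.
    by apply: cvgD; apply: cvgM.
  rewrite -(cvg_lim _ lc)//; apply: limr_le; first by apply/cvg_ex; eexists; exact: lc.
  apply: nearW => j; have [l _ _ _ _] := eigen_def (eps_gt0 j).
  by rewrite -modc_sqr expr_le1 ?modc_ge0// ltW.
apply/eqP; rewrite eq_le le1/= leNgt; apply/negP => lt1.
have [B B0 hB] := cper_bounded phi0_cont phi0_per.
have iterQ n : Q 0 = nsq lam0 ^+ n * Q (n%:R * dl).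
  elim: n => [|n IH]; first by rewrite expr0 !mul0r mul1r.
  have -> : n.+1%:R * dl = n%:R * dl + dl by rewrite -natr1; ring.
  by rewrite IH (flux_density_shift (n%:R * dl)) exprSr; ring.
have : (fun n => nsq lam0 ^+ n * B) @ \oo --> 0.
  rewrite -[X in _ --> X](mul0r B).
  by apply: cvgM; [apply: cvg_expr; rewrite ger0_norm// nsq_ge0|exact: cvg_cst].
move=> /cvgrPdist_lt /(_ _ flux_density_gt0) [N _ /(_ N (leqnn N))].
rewrite sub0r normrN ger0_norm; last by rewrite mulr_ge0// exprn_ge0// nsq_ge0.
rewrite {1}(iterQ N) ltNge => /negP; apply.
rewrite ler_wpM2l ?exprn_ge0 ?nsq_ge0//.
exact: le_trans (flux_density_le _) (hB _).
Qed.

(** Q is continuous with the periods 1 and delta. *)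
Lemma flux_density_const s : Q s = Q 0.
Proof.
apply: (two_periods_constant flux_density_continuous flux_density_per _ dl_irr).
by move=> t; rewrite [RHS]flux_density_shift lam0_norm mul1r.
Qed.

(** This uniform bound is what allows the division by phi_eps(s) in the limit.
    *)
Lemma phi0_lower_bound s : Q 0 <= nsq (phi0 s).
Proof. by rewrite -(flux_density_const s) flux_density_le. Qed.

Lemma phi0_neq0 s : phi0 s != 0.
Proof.
apply/eqP => p0; have := phi0_lower_bound s.
by rewrite p0 nsq0 leNgt flux_density_gt0.
Qed.

(** * Convergence on each cell *)

Definition cell_factor n s : R[i] := lam0 ^+ n / phi0 s.

(** The limit field on the cell number n along the line of s, divided by phi(s);
    the zero term only makes it a linear combination. *)
Definition limit_cell n s : solution R :=
  lincomb (cell_factor n s) (limit_mode (s + n%:R * dl)) 0 (limit_mode s).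

Definition cell_error n j s : solution R :=
  lincomb 1 (shift_sol (n%:R * th2^-1) (u (eps j) s)) (-1) (limit_cell n s).

(** On the cell number n the error is c_j v - c w = c_j (v - w) + (c_j - c) w,
    where v and w are the modes at s + n delta and c_j = lam_j^n / phi_j(s)
    tends to c = lam0^n / phi0(s) uniformly in s, because |phi0| is bounded
    below. *)
Lemma cell_error_cvg n h : 0 < h -> \forall j \near \oo, forall s x,
  0 <= x <= th2^-1 -> cauchy_norm (cell_error n j s) x <= h.
Proof.
move=> h0; have Q0 := flux_density_gt0.
have [Bp Bp0 hBp] := cper_bounded phi0_cont phi0_per.
have [Bw Bw0 hBw] := limit_mode_bounded.
pose a : R := 4 / Q 0; pose b : R := 8 * (Bp + 1) / Q 0 ^+ 2.
have a0 : 0 <= a by rewrite divr_ge0// ltW.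
have b0 : 0 <= b.
  by apply: mulr_ge0; [apply: mulr_ge0 => //; exact: addr_ge0|rewrite invr_ge0 sqr_ge0].
have T0 : 0 <= 2 * (a + b * Bw).
  by apply: mulr_ge0 => //; apply: addr_ge0 => //; exact: mulr_ge0.
have [t' /andP[t'0 _] t'T] := small_factor T0 h0.
pose t := Num.min t' (Q 0 / 4).
have t0 : 0 < t by rewrite lt_min t'0 divr_gt0.
have tQ : t <= Q 0 / 4 by rewrite ge_min lexx orbT.
have tT : t * (2 * (a + b * Bw)) <= h.
  by apply: le_trans t'T; rewrite ler_wpM2r// ge_min lexx.
have n1 := converges_uniformly_nsq phi_cvg t0.
have n2 := ccvg_small (ccvgX n lam_ccvg) t0.
have n3 := mode_cvg t0.
near=> j => s x xL.
have phij : nsq (phiE (eps j) s - phi0 s) <= t by move: s; near: j; exact: n1.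
have lamj : nsq (lamE (eps j) ^+ n - lam0 ^+ n) <= t by near: j; exact: n2.
have modej : cauchy_norm (lincomb 1 (absorbing_mode j (s + n%:R * dl)) (-1)
    (limit_mode (s + n%:R * dl))) x <= t.
  by move: x xL; move: (s + _) => {phij} {}s; move: s; near: j; exact: n3.
have ej := eps_gt0 j.
have pj0 := eigen_neq0 (eigen_def ej) s; have p0 := phi0_neq0 s.
have pj0' := eigen_neq0 (eigen_def ej) (s + n%:R * dl).
(* |phi0|^2 <= 2 |phi_j|^2 + 2 t with t <= Q 0 / 4 *)
have low : Q 0 / 4 <= nsq (phiE (eps j) s).
  have := nsqD (phiE (eps j) s) (- (phiE (eps j) s - phi0 s)).
  rewrite nsqN opprB addrC subrK; have := phi0_lower_bound s; lra.
have nj0 : 0 < nsq (phiE (eps j) s) by apply: lt_le_trans low; rewrite divr_gt0.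
have n00 : 0 < nsq (phi0 s) by apply: lt_le_trans (phi0_lower_bound s).
pose cj := lamE (eps j) ^+ n / phiE (eps j) s; pose c := cell_factor n s.
have cj_le : nsq cj <= a.
  rewrite /cj nsq_div// nsqX /a -(mul1r (4 / Q 0)).
  have [l1 _ _ _ _] := eigen_def ej.
  have q1 : nsq (lamE (eps j)) <= 1 by rewrite -modc_sqr expr_le1 ?modc_ge0// ltW.
  rewrite ler_pM ?exprn_ge0 ?nsq_ge0 ?invr_ge0 ?nsq_ge0 ?exprn_ile1 ?nsq_ge0//.
  have -> : 4 / Q 0 = (Q 0 / 4)^-1 by rewrite invf_div.
  by rewrite lef_pV2 ?posrE ?divr_gt0.
have cc_le : nsq (cj - c) <= t * b.
  have -> : cj - c = ((lamE (eps j) ^+ n - lam0 ^+ n) * phi0 s +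
      lam0 ^+ n * - (phiE (eps j) s - phi0 s)) / (phiE (eps j) s * phi0 s).
    by rewrite /cj /c /cell_factor; field; rewrite pj0 p0.
  rewrite nsq_div ?mulf_neq0// nsqM ler_pdivrMr ?mulr_gt0//.
  apply: (@le_trans _ _ (t * (2 * (Bp + 1)))).
    apply: le_trans (nsqD _ _) _; rewrite !nsqM nsqX lam0_norm expr1n nsqN mul1r.
    have -> : t * (2 * (Bp + 1)) = 2 * (t * Bp + t) by ring.
    by rewrite ler_wpM2l// lerD// ler_pM ?nsq_ge0.
  rewrite -[leRHS]mulrA ler_wpM2l ?(ltW t0)//.
  apply: (@le_trans _ _ (b * (Q 0 / 4 * Q 0))).
    by rewrite /b le_eqVlt; apply/orP; left; apply/eqP; field; rewrite gt_eqF.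
  rewrite ler_wpM2l// ler_pM ?phi0_lower_bound ?(ltW Q0)//.
  by rewrite divr_ge0// ltW.
have xp : 0 <= x by case/andP: xL.
have [h1 h2] := half_line_cell ej (fun s => u_def s ej) (eigen_def ej) n s xp.
have -> : cauchy_norm (cell_error n j s) x = cauchy_norm (lincomb cj
    (lincomb 1 (absorbing_mode j (s + n%:R * dl)) (-1) (limit_mode (s + n%:R * dl)))
    (cj - c) (limit_mode (s + n%:R * dl))) x.
  rewrite /cauchy_norm; congr (nsq _ + nsq _); rewrite /= ?h1 ?h2 -/c /cj.
    by field.
  by field.
apply: le_trans (cauchy_norm_lincomb _ _ _ _ _) _; apply: le_trans tT.
have -> : t * (2 * (a + b * Bw)) = 2 * (a * t + t * b * Bw) by ring.
rewrite ler_wpM2l// lerD// ler_pM ?nsq_ge0 ?cauchy_norm_ge0//.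
exact: hBw.
Unshelve. all: by end_near. Qed.

Lemma imu_shiftn n s x : imu s (x + n%:R * th2^-1) = imu (s + n%:R * dl) x.
Proof.
elim: n s => [|n IH] s; first by rewrite !mul0r !addr0.
have -> : x + n.+1%:R * th2^-1 = x + n%:R * th2^-1 + th2^-1 by rewrite -natr1; ring.
by rewrite imu_shift IH; congr (imu _ _); rewrite -natr1; ring.
Qed.

Lemma half_line_continuous_in_slice j x : 0 <= x ->
  ccontinuous_on setT (fun s => pval (u (eps j) s) x) /\
  ccontinuous_on setT (fun s => pflux (u (eps j) s) x).
Proof.
move=> x0; have ej := eps_gt0 j.
have H s0 h (h0 : 0 < h) := half_line_continuous ej (fun s => u_def s ej) (eigen_def ej) s0 x0 h0.
have xx : 0 <= x <= x by rewrite x0 lexx.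
by split; apply: ccontinuous_nsq => s0 h h0; apply: filterS (H s0 h h0) => s;
  move=> /(_ x xx)/cauchy_norm_diff_small[].
Qed.

(** Provides the measurability in s; the continuity of the half-line solutions
    is used here. *)
Lemma cell_error_continuous_in_slice n j x : 0 <= x <= th2^-1 ->
  ccontinuous_on setT (fun s => pval (cell_error n j s) x) /\
  ccontinuous_on setT (fun s => pflux (cell_error n j s) x).
Proof.
move=> xL; have xn : 0 <= x + n%:R * th2^-1.
  by have /andP[x0 _] := xL; rewrite addr_ge0// mulr_ge0.
have [u1 u2] := half_line_continuous_in_slice j xn.
have [m1 m2] := limit_mode_continuous xL.
have cf : ccontinuous_on setT (cell_factor n).
  apply: ccontinuousM; first exact: ccontinuous_cst.
  by apply: ccontinuousV => //; exact: phi0_neq0.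
have cst c := @ccontinuous_cst R setT c.
split; rewrite /cell_error /=; apply: ccontinuousD; apply: ccontinuousM => //;
  apply: ccontinuousD; apply: ccontinuousM => //.
- exact: (ccontinuous_shift (n%:R * dl) m1).
- exact: (ccontinuous_shift (n%:R * dl) m2).
Qed.

Lemma cell_error_derive n j s :
  [/\ ccontinuous_on `[0, th2^-1] (pval (cell_error n j s)),
      ccontinuous_on `[0, th2^-1] (pflux (cell_error n j s)) &
      forall x, 0 < x < th2^-1 -> cderive (pval (cell_error n j s)) x
        ((imu (s + n%:R * dl) x)%:C * pflux (cell_error n j s) x)].
Proof.
have n0 : 0 <= n%:R * th2^-1 by rewrite mulr_ge0.
have [u1 u2 du] := exact_sol_shift n0 (u_exact j s (th2^-1 + n%:R * th2^-1)).
have [m1 m2 dm] := limit_mode_exact (s + n%:R * dl).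
have [l1 l2 _] := limit_mode_exact s.
have cst c := @ccontinuous_cst R `[0, th2^-1] c.
split.
- by apply: ccontinuousD; apply: ccontinuousM => //; apply: ccontinuousD; apply: ccontinuousM.
- by apply: ccontinuousD; apply: ccontinuousM => //; apply: ccontinuousD; apply: ccontinuousM.
move=> x xL; have [h1 _] := du x xL; have [h2 _] := dm x xL.
rewrite imu_shiftn in h1.
have -> : pval (cell_error n j s) = (fun t => 1 * pval (shift_sol (n%:R * th2^-1) (u (eps j) s)) t
    + -1 * (cell_factor n s * pval (limit_mode (s + n%:R * dl)) t)).
  by apply/funext => t; rewrite /cell_error /limit_cell /= mul0r addr0.
have -> : (imu (s + n%:R * dl) x)%:C * pflux (cell_error n j s) x =
   1 * ((imu (s + n%:R * dl) x)%:C * pflux (shift_sol (n%:R * th2^-1) (u (eps j) s)) x)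
   + -1 * (cell_factor n s * ((imu (s + n%:R * dl) x)%:C * pflux (limit_mode (s + n%:R * dl)) x)).
  by rewrite /cell_error /limit_cell /= mul0r addr0; ring.
by apply: cderiveD; apply: cderiveZ => //; apply: cderiveZ.
Qed.

(** * The limit operators *)

Let Pl := Plim th1 th2 rgt lam0 phi0.

Let Sl := Slim th1 th2 rgt phi0 psi0.

Let Ul := Ulim th1 th2 e0 e1 Pl Sl.

(** As for the half-line solutions, the products of the multipliers telescope.
    *)
Lemma Plim_iter f n s : iter n Pl f (s + n%:R * dl) =
  cell_factor n s * phi0 (s + n%:R * dl) * f s.
Proof.
elim: n s => [|n IH] s.
  by rewrite /= mul0r addr0 /cell_factor expr0 mul1r mulVf ?phi0_neq0// mul1r.
have -> : s + n.+1%:R * dl = s + n%:R * dl + dl by rewrite -natr1; ring.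
rewrite iterS {1}/Pl /Plim /wshift /sdelta /sgn mul1r addrK -/Pl IH /cell_factor exprS.
have p1 := phi0_neq0 s; have p2 := phi0_neq0 (s + n%:R * dl).
by field; rewrite p1 p2.
Qed.

Lemma Slim_shift g s : Sl g (s + dl) = psi0 (s + dl) / phi0 s * g s.
Proof. by rewrite /Sl /Slim /wshift /sdelta /sgn mul1r addrK. Qed.

(** Along each line the error on the cell number n is phi(s) times the function
    estimated in [cell_error_cvg]. *)
Lemma field_errorE n j (f : R -> R[i]) (y : R * R) : n%:R < y.2 < n.+1%:R ->
  Ueps th1 th2 (u (eps j)) f y - Ul f y =
  f (y.1 - dl * y.2) * pval (cell_error n j (y.1 - dl * y.2)) (y.2 / th2 - n%:R / th2).
Proof.
move=> /andP[ny yn]; rewrite /Ul /Ulim.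
have -> : Num.truncn y.2 = n by apply: truncn_def; rewrite (ltW ny).
rewrite /E0 /E1 /Ueps /along_lines /=; set s := y.1 - dl * y.2.
have -> : y.1 - dl * (y.2 - n%:R) = s + n%:R * dl by rewrite /s; ring.
have -> : (y.2 - n%:R) / th2 = y.2 / th2 - n%:R / th2 by rewrite mulrBl.
rewrite Slim_shift !Plim_iter subrK mul0r addr0.
have p2 := phi0_neq0 (s + n%:R * dl); by field.
Qed.

(** The derivative of the error along the lines is its flux divided by mu, so it
    is controlled by the same quantity as the error. *)
Lemma field_error_small (f : R -> R[i]) n h : L2per f -> 0 < h ->
  \forall j \near \oo, (H1theta_norm th1 th2 (`]0%R, 1%R[ `*` `]n%:R, n.+1%:R[)
    (fun y => Ueps th1 th2 (u (eps j)) f y - Ul f y)%R <= h%:E)%E.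
Proof.
move=> fL2 h0; have [C [C0 hA hr]] := coef_bounds.
have pq : n%:R < n.+1%:R :> R by rewrite ltr_nat.
have [M M0 hM] := strip_mass th1 th2 n%:R n.+1%:R fL2.
have T0 : 0 <= 2 * (1 + C ^+ 2) * M.
  by rewrite !mulr_ge0// addr_ge0// sqr_ge0.
have [t /andP[t0 _] tT] := small_factor T0 (exprn_gt0 2 h0).
near=> j.
have small s x : 0 <= x <= th2^-1 -> cauchy_norm (cell_error n j s) x <= t.
  by move: s x; near: j; exact: cell_error_cvg.
pose a : R := n%:R / th2; pose b : R := n.+1%:R / th2.
have ab (x : R) : (a <= x <= b) = (0 <= x - a <= th2^-1).
  have -> : b = a + th2^-1 by rewrite /a /b -natr1; field; rewrite gt_eqF.
  by rewrite subr_ge0 lerBlDl.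
have ab' (x : R) : (a < x < b) = (0 < x - a < th2^-1).
  have -> : b = a + th2^-1 by rewrite /a /b -natr1; field; rewrite gt_eqF.
  by rewrite subr_gt0 ltrBlDl.
(* the error in the coordinate x, shifted to the cell number n, and its
   derivative *)
pose G s x := pval (cell_error n j s) (x - a).
pose H s x := (imu (s + n%:R * dl) (x - a))%:C * pflux (cell_error n j s) (x - a).
have ca : continuous (fun x : R => x - a).
  by apply: contB; [move=> ?; exact: cvg_id|exact: cont_cst].
have sub (x : R) : `[a, b]%classic x -> `[0, th2^-1]%classic (x - a).
  by rewrite /= !in_itv/= ab.
have real_cont D (g : R -> R) : {within D, continuous g} ->
    ccontinuous_on D (fun x => (g x)%:C).
  by move=> cg; split => //=; exact: within_cst.
have cimu s : continuous (imu s).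
  move=> x; apply: continuousV; first by rewrite gt_eqF// mu_gt0.
  exact: slice_continuous.
have cimu' x : continuous (fun s => imu s x).
  move=> s; apply: (@continuousV _ _ (fun s => slice th1 th2 mu s x)).
    by rewrite gt_eqF// mu_gt0.
  apply: (@continuous_comp _ _ _ (fun s : R => (s, x)) (fun sx : R * R => slice th1 th2 mu sx.1 sx.2)).
    exact: (cvg_pair (@cvg_id _ (nbhs s)) (cvg_cst x)).
  exact: slice_pair_continuous.
have bound := @H1theta_norm_le R th1 th2 th2_pos n%:R n.+1%:R pq f fL2 G H ((1 + C ^+ 2) * t).
apply: le_trans (bound _ _ _ _ _ _ _ _ M _ hM M0) _.
- move=> x; rewrite -/a -/b ab => xL.
  by have [c1 _] := cell_error_continuous_in_slice n j xL.
- move=> x; rewrite -/a -/b ab => xL.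
  have [_ c2] := cell_error_continuous_in_slice n j xL.
  apply: ccontinuousM => //; apply: real_cont; apply: within_cont.
  move=> s; apply: (@continuous_comp _ _ _ (fun s : R => s + n%:R * dl) (fun s => imu s (x - a))).
    exact: continuous_shift.
  exact: cimu'.
- move=> s; rewrite -/a -/b; have [[c1 c2] _ _] := cell_error_derive n j s.
  by split; [exact: (within_comp sub ca c1)|exact: (within_comp sub ca c2)].
- move=> s; rewrite -/a -/b; have [_ [c1 c2] _] := cell_error_derive n j s.
  apply: ccontinuousM.
    by apply: real_cont; apply: within_cont => x; 
      apply: (@continuous_comp _ _ _ (fun t : R => t - a) (imu (s + n%:R * dl))); [exact: ca|exact: cimu].
  by split; [exact: (within_comp sub ca c1)|exact: (within_comp sub ca c2)].
- move=> s x; rewrite -/a -/b ab' => xL; have [_ _ /(_ _ xL)[d1 d2]] := cell_error_derive n j s.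
  by split; exact: (is_derive_shift d1) || exact: (is_derive_shift d2).
- move=> s x; rewrite -/a -/b ab => xL; apply: (@le_trans _ _ t).
    by apply: le_trans (small s _ xL); rewrite lerDl nsq_ge0.
  by rewrite ler_peMl ?(ltW t0)// lerDl sqr_ge0.
- move=> s x; rewrite -/a -/b ab => xL; rewrite /H nsqM ler_pM ?nsq_ge0//.
    rewrite /nsq /= expr0n addr0; have /andP[i0 iC] := hA (s + n%:R * dl) (x - a).
    by apply: (@le_trans _ _ (C ^+ 2)); rewrite ?lerDr// ler_sqr ?nnegrE.
  by apply: le_trans (small s _ xL); rewrite lerDr nsq_ge0.
- move=> y [_] /=; rewrite in_itv/= => yn; exact: field_errorE.
have E : 2 * ((1 + C ^+ 2) * t) * M = t * (2 * (1 + C ^+ 2) * M) by ring.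
rewrite lee_fin E powR12_sqrt; last by rewrite mulr_ge0// ltW.
by rewrite -(ger0_norm (ltW h0)) -sqrtr_sqr ler_wsqrtr.
Unshelve. all: by end_near. Qed.

Let Ll := Lambda_lim th1 th2 z e0 e1 Sl.

(** Both operators multiply by an R- trace at 0; their difference is the trace
    of the error on the first cell. *)
Lemma Lambda_errorE j f s : Lambda_eps z (u (eps j)) f s - Ll f s =
  Rm (cell_error 0 j s) 0 * f s.
Proof.
rewrite /Lambda_eps /Ll /Lambda_lim /tcoef Slim_shift robin_minus_lincomb.
have -> : Rm (shift_sol (0%:R * th2^-1) (u (eps j) s)) 0 = Rm (u (eps j) s) 0.
  by rewrite /Robin_minus /= mul0r addr0.
rewrite /limit_cell mul0r addr0 robin_minus_lincomb /limit_mode robin_minus_lincomb.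
rewrite /cell_factor expr0.
by have p0 := phi0_neq0 s; field.
Qed.

Lemma Lambda_error_per j s : Rm (cell_error 0 j (s + 1)) 0 = Rm (cell_error 0 j s) 0.
Proof.
have ej := eps_gt0 j.
have [u1 u2] := half_line_per ej (fun s => u_def s ej) s (lexx 0).
have [h1 h2] := cell_per e0_def s O0L; have [h3 h4] := cell_per e1_def s O0L.
rewrite /cell_error /limit_cell /limit_mode /Robin_minus /=.
rewrite /cell_factor !(mul0r dl) !addr0 !mul0r !addr0 u1 u2 h1 h2 h3 h4 !phi0_per.
by rewrite [s + 1 + dl]addrAC !psi0_per.
Qed.

Lemma Lambda_error_small h : 0 < h -> \forall j \near \oo,
  (L2per_opnorm (fun f s => (Lambda_eps z (u (eps j)) f s - Ll f s)%R) <= h%:E)%E.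
Proof.
move=> h0; have z10 : 0 < 2 * (1 + z ^+ 2) by rewrite mulr_gt0// ltr_pwDl// sqr_ge0.
have t0 : 0 < h ^+ 2 / (2 * (1 + z ^+ 2)) by rewrite divr_gt0// exprn_gt0.
apply: filterS (cell_error_cvg 0 t0) => j small.
apply: (@L2per_opnorm_multiplier _ (fun s => Rm (cell_error 0 j s) 0)).
- exact: ltW.
- have [c1 c2] := cell_error_continuous_in_slice 0 j O0L.
  rewrite (_ : (fun s => _) = (fun s => 1 * pflux (cell_error 0 j s) 0 +
      - (0 +i* z) * pval (cell_error 0 j s) 0)); last first.
    by apply/funext => s; rewrite /Robin_minus /sgn mulNr.
  by apply: ccontinuousD; apply: ccontinuousM => //; exact: ccontinuous_cst.
- by move=> s; exact: Lambda_error_per.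
- move=> s; apply: le_trans (robin_minus_le _ _ _) _.
  by rewrite mulrC -ler_pdivlMr//; exact: small.
- by move=> f s; exact: Lambda_errorE.
Qed.

(** For f(s) = c phi0(s), I - Lambda and I + Lambda map f to c (R+ - R-) and c
    (R+ + R-), with the traces of the limit mode; the real part of (R+ - R-)
    conj (R+ + R-) is |R+|^2 - |R-|^2, that is, the flux density. *)
Lemma energy_density (f : R -> R[i]) s :
  complex.Re ((f s - Ll f s) * conjc (f s + Ll f s)) =
  Q 0 * (modc (f s) ^+ 2 * modc (phi0 s) ^- 2).
Proof.
rewrite -(flux_density_const s) !modc_sqr flux_density_eq -robin_flux limit_mode_plus.
rewrite robin_minus_lincomb /Ll /Lambda_lim Slim_shift /tcoef.
have p0 := phi0_neq0 s.
have n0 : nsq (phi0 s) != 0 by apply/eqP => /nsq_eq0 /eqP; rewrite (negbTE p0).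
pose w := f s / phi0 s; have fE : f s = w * phi0 s by rewrite /w divfK.
have -> : Rm (e0 s) 0 * f s + Rm (e1 s) 0 * (psi0 (s + dl) / phi0 s * f s) =
    w * (phi0 s * Rm (e0 s) 0 + psi0 (s + dl) * Rm (e1 s) 0).
  by rewrite /w; field.
rewrite fE; move: (phi0 s * _ + _) => v.
have -> : complex.Re ((w * phi0 s - w * v) * conjc (w * phi0 s + w * v)) =
    nsq (w * phi0 s) - nsq (w * v).
  case: (w * phi0 s) (w * v) => [a b] [c d]; rewrite /nsq /=; ring.
by rewrite !nsqM mulfK//; ring.
Qed.

Local Notation leb := (@lebesgue_measure R).

(** The integral is positive, for otherwise |f|^2 / |phi0|^2 would vanish almost
    everywhere on ]0, 1[. *)
Lemma energy_identity (f : R -> R[i]) : L2per f ->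
  ~ {ae leb, forall s, f s = 0} ->
  complex.Re (cintegral leb `]0, 1[
    (fun s => (f s - Ll f s) * conjc (f s + Ll f s))) =
  Q 0 * \int[leb]_(s in `]0, 1[) (modc (f s) ^+ 2 * modc (phi0 s) ^- 2) /\
  0 < Q 0 * \int[leb]_(s in `]0, 1[) (modc (f s) ^+ 2 * modc (phi0 s) ^- 2).
Proof.
move=> fL2 fn0; have [f1 f2] := L2per_measurable fL2.
pose g s : R := modc (f s) ^+ 2 * modc (phi0 s) ^- 2.
have gE s : g s = nsq (f s) / nsq (phi0 s) by rewrite /g !modc_sqr.
have Q0 := flux_density_gt0.
have n0 s : 0 < nsq (phi0 s) by exact: lt_le_trans (phi0_lower_bound s).
have g0 s : 0 <= g s by rewrite gE divr_ge0 ?nsq_ge0.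
have cn := ccont_nsq phi0_cont.
have cV : continuous (fun s => (nsq (phi0 s))^-1).
  by move=> s; apply: (@continuousV _ _ (fun s => nsq (phi0 s))); [rewrite gt_eqF|exact: cn].
have mf : measurable_fun (`]0, 1[%classic : set R) (fun s => nsq (f s)).
  by apply: measurable_funTS; exact: nsq_measurable.
have mg : measurable_fun (`]0, 1[%classic : set R) g.
  rewrite (_ : g = fun s => nsq (f s) * (nsq (phi0 s))^-1); last exact/funext.
  apply: measurable_funM => //.
  by apply: measurable_funTS; exact: continuous_measurable_fun.
have mI : measurable (`]0, 1[%classic : set R) by exact: measurable_itv.
have ig : leb.-integrable `]0, 1[ (EFin \o g).
  apply/integrableP; split; first exact/measurable_EFinP.
  apply: (@le_lt_trans _ _ (((Q 0)^-1)%:E * \int[leb]_(s in `]0%R, 1%R[) (nsq (f s))%:E)%E).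
    have cE : (0 <= ((Q 0)^-1)%:E)%E by rewrite lee_fin invr_ge0 ltW.
    have mff : measurable_fun (`]0, 1[%classic : set R) (fun s => (nsq (f s))%:E) by exact/measurable_EFinP.
    have nf0 s : `]0, 1[%classic s -> (0 <= (nsq (f s))%:E)%E by rewrite lee_fin nsq_ge0.
    rewrite -ge0_integralZl//; apply: ge0_le_integral => //.
    - by apply: measurableT_comp => //; exact/measurable_EFinP.
    - exact: measurable_funeM.
    move=> s _; rewrite /= ger0_norm ?g0// -EFinM lee_fin gE mulrC.
    by rewrite ler_wpM2r ?nsq_ge0// lef_pV2 ?posrE// phi0_lower_bound.
  apply: lte_mul_pinfty; rewrite ?lee_fin ?invr_ge0 ?(ltW Q0)//.
  exact: L2per_square_integrable.
split.
  rewrite /cintegral /= -RintegralZl//.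
  by apply: eq_Rintegral => s _; exact: energy_density.
rewrite mulr_gt0// lt_neqAle eq_sym Rintegral_ge0 ?andbT; last by move=> s _; exact: g0.
apply/eqP => I0; apply: fn0; have [fper _] := fL2; apply: periodic_ae0 => //.
have Ifin : (\int[leb]_(s in `]0%R, 1%R[) (g s)%:E)%E \is a fin_num.
  by apply: (integrable_fin_num _ ig).
have I0' : (\int[leb]_(s in `]0%R, 1%R[) (g s)%:E = 0)%E.
  by rewrite -(fineK Ifin); congr _%:E.
have I1 : (\int[leb]_(s in `]0%R, 1%R[) `|(g s)%:E| = 0)%E.
  by rewrite -I0'; apply: eq_integral => s _; rewrite gee0_abs// lee_fin g0.
have /(ae_eq_integral_abs leb mI)[/(_ I1) H _] : measurable_fun (`]0, 1[%classic : set R) (EFin \o g).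
  exact/measurable_EFinP.
apply: ae_imply (H) => s Hs sI; have := Hs sI; rewrite /= gE => -[/eqP].
by rewrite mulf_eq0 invr_eq0 (gt_eqF (n0 s)) orbF => /eqP /nsq_eq0.
Qed.

End limit.

End medium.

Theorem proposition5p20 (R : realType)
  (mu rho : R * R -> R) (th1 th2 z om : R)
  (mu_cont : continuous mu) (rho_cont : continuous rho)
  (mu_per : forall y1 y2, mu (y1 + 1, y2) = mu (y1, y2) /\
                          mu (y1, y2 + 1) = mu (y1, y2))
  (rho_per : forall y1 y2, rho (y1 + 1, y2) = rho (y1, y2) /\
                           rho (y1, y2 + 1) = rho (y1, y2))
  (mu_pos : exists2 c, 0 < c & forall y, c <= mu y)
  (rho_pos : exists2 c, 0 < c & forall y, c <= rho y)
  (th2_pos : 0 < th2) (delta_irr : irrational (delta th1 th2)) (z_pos : 0 < z)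
  (m : nat)
  (irr_fin : (irrationality_measure (delta th1 th2) < +oo)%E)
  (irr_lt_m : (irrationality_measure (delta th1 th2) < m%:R%:E)%E)
  (mu_Cm : Ck m mu) (rho_Cm : Ck m rho)
  (om_spec : Atheta_spectrum mu rho th1 th2 (om ^+ 2)%:C)
  (u : side -> R -> R -> solution R)
  (u_def : forall i eps s, 0 < eps ->
     is_half_line_solution mu rho th1 th2 z om i eps s (u i eps s))
  (lamE : side -> R -> R[i]) (phiE : side -> R -> R -> R[i])
  (eigen_def : forall i eps, 0 < eps ->
     is_fundamental_eigenpair th1 th2 z i (u i eps) (lamE i eps) (phiE i eps))
  (e0 e1 : side -> R -> solution R)
  (e0_def : forall i s,
     is_cell_solution mu rho th1 th2 z om i s (e0 i s) 1 0)
  (e1_def : forall i s,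
     is_cell_solution mu rho th1 th2 z om i s (e1 i s) 0 1)
  (eps : nat -> R) (lam0 : side -> R[i]) (phi0 psi0 : side -> R -> R[i])
  (om_regular :
     regular_along th1 th2 z u lamE phiE e0 e1 eps lam0 phi0 psi0) :
  let P := Plim th1 th2 rgt (lam0 rgt) (phi0 rgt) in
  let S := Slim th1 th2 rgt (phi0 rgt) (psi0 rgt) in
  let U := Ulim th1 th2 (e0 rgt) (e1 rgt) P S in
  let Lambda := Lambda_lim th1 th2 z (e0 rgt) (e1 rgt) S in
  let Q0 := flux_density th1 th2 z rgt
              (e0 rgt) (e1 rgt) (phi0 rgt) (psi0 rgt) 0 in
  (exists sigma : nat -> nat,
     [/\ {homo sigma : j k / (j < k)%N},
         forall (phi : R -> R[i]) (n : nat), L2per phi ->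
           H1theta_norm th1 th2 (`]0, 1[ `*` `]n%:R, n.+1%:R[)
             (fun y => Ueps th1 th2 (u rgt (eps (sigma j))) phi y - U phi y)
             @[j --> \oo] --> 0%E &
         L2per_opnorm (fun phi s =>
             Lambda_eps z (u rgt (eps (sigma j))) phi s - Lambda phi s)
           @[j --> \oo] --> 0%E]) /\
  (forall phi : R -> R[i], L2per phi ->
     ~ {ae @lebesgue_measure R, forall s, phi s = 0} ->
     complex.Re (cintegral (@lebesgue_measure R) `]0, 1[
           (fun s => (phi s - Lambda phi s) * conjc (phi s + Lambda phi s))) =
       Q0 * \int[@lebesgue_measure R]_(s in `]0, 1[)
              (modc (phi s) ^+ 2 * modc (phi0 rgt s) ^- 2) /\
     0 < Q0 * \int[@lebesgue_measure R]_(s in `]0, 1[)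
                (modc (phi s) ^+ 2 * modc (phi0 rgt s) ^- 2)).
Proof.
have [eps_gt0 eps_cvg lim Q_neq0] := om_regular.
have [lam_cvg [phi0_cont phi0_per] [psi0_cont psi0_per] phi_cvg psi_cvg] := lim rgt.
split; last first.
  move=> phi phiL2 phi_neq0; apply: (energy_identity mu_cont rho_cont mu_per
    rho_per mu_pos rho_pos th2_pos z_pos (u_def rgt) (eigen_def rgt) (e0_def rgt)
    (e1_def rgt) eps_gt0 eps_cvg lam_cvg phi0_cont phi0_per psi0_cont psi0_per
    phi_cvg psi_cvg (Q_neq0 rgt) delta_irr phiL2 phi_neq0).
exists id; split => // [phi n phiL2|].
  apply: ge0_ereal_cvg0 => [j|h h0]; first exact: H1theta_norm_ge0.
  exact: (field_error_small mu_cont rho_cont mu_per rho_per mu_pos rho_pos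
    th2_pos z_pos (u_def rgt) (eigen_def rgt) (e0_def rgt) (e1_def rgt) eps_gt0
    eps_cvg lam_cvg phi0_cont phi0_per psi0_cont psi0_per phi_cvg psi_cvg
    (Q_neq0 rgt) delta_irr n phiL2 h0).
apply: ge0_ereal_cvg0 => [j|h h0]; first exact: L2per_opnorm_ge0.
exact: (Lambda_error_small mu_cont rho_cont mu_per rho_per mu_pos rho_pos
  th2_pos z_pos (u_def rgt) (eigen_def rgt) (e0_def rgt) (e1_def rgt) eps_gt0
  eps_cvg lam_cvg phi0_cont phi0_per psi0_cont psi0_per phi_cvg psi_cvg
  (Q_neq0 rgt) delta_irr h0).
Qed.
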